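(* Let $\mathcal{C}$ be a full comprehension category satisfying condition (LF). If $\mathcal{C}$ has weakly stable binary sums (resp.\ $\Pi$-types, identity types, $\Sigma$-types, zero types, unit types, or $\mathsf{W}$-types relative to a stable class of $\Pi$-types), then its split replacement $\mathcal{C}_!$ has strictly stable binary sums ($\Pi$-types, \ldots), and hence models the syntax of type theory with binary sums ($\Pi$-types, \ldots).
   Context: A comprehension category consists of a category $\mathcal{C}$, a cloven Grothendieck fibration $P:\mathcal{T}\to\mathcal{C}$ and a functor $\chi:\mathcal{T}\to\mathcal{C}^{\to}$ with $\mathrm{cod}\circ\chi=P$, sending cartesian arrows to pullback squares; it is full if $\chi$ is full and faithful, and split if $P$ is split. For $A\in\mathcal{T}(\Gamma)$, write $\chi(A):\Gamma.A\to\Gamma$ (composites of such maps are display maps), and $A[\sigma]$ for reindexing along $\sigma:\Delta\to\Gamma$. Condition (LF): $\mathcal{C}$ has finite products, and for maps $Z\xrightarrow{g}Y\xrightarrow{f}X$ with $f$ a display map and $g$ a display map or a product projection, a categorical dependent exponential $\prod[f,g]\in\mathcal{C}/X$ exists, i.e.\ $\mathcal{C}/X(W,\prod[f,g])\cong\mathcal{C}/Y(W\times_X Y,Z)$ naturally in $h:W\to X$. The split replacement $\mathcal{C}_!$ has the same base category; a type over $\Gamma$ is a triple $(V_A,E_A,n_A)$ with $V_A\in\mathcal{C}$, $E_A\in\mathcal{T}(V_A)$, $n_A:\Gamma\to V_A$; writing $[A]:=E_A[n_A]\in\mathcal{T}(\Gamma)$, maps $B\to A$ over $\sigma$ are maps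 $[B]\to[A]$ over $\sigma$ in $\mathcal{T}$; reindexing is $A[\sigma]:=(V_A,E_A,n_A\circ\sigma)$ (making it split), and comprehension is $\chi_!(A):=\chi([A])$. A constructor is weakly stable in $\mathcal{C}$ if for every input there exists formation/introduction data (e.g.\ the type and its constructor maps) such that every reindexing of that data along any map $\sigma$ still satisfies the defining property (eliminators, resp.\ $\lambda$-abstractions, exist for it); a pure existence condition independent of the cleaving. A split comprehension category has strictly stable structure if it is equipped with chosen formation, introduction and elimination operations which commute on the nose with reindexing. *)

(* Defs.v *)
From Stdlib Require Import ssreflect ssrfun ssrbool ClassicalEpsilon.

Set Implicit Arguments.
Unset Strict Implicit.
Unset Printing Implicit Defensive.

Lemma unique_choice (A : Type) (P : A -> Prop) : (exists! x, P x) -> {x : A | P x}.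
Proof. by move=> h; apply: constructive_definite_description. Defined.

Record category := Category {
  ob :> Type;
  hom : ob -> ob -> Type;
  idm : forall X, hom X X;
  mcomp : forall X Y Z, hom Y Z -> hom X Y -> hom X Z;
  comp_idl : forall X Y (f : hom X Y), mcomp (idm Y) f = f;
  comp_idr : forall X Y (f : hom X Y), mcomp f (idm X) = f;
  mcompA : forall X Y Z W (h : hom Z W) (g : hom Y Z) (f : hom X Y),
    mcomp h (mcomp g f) = mcomp (mcomp h g) f }.

Arguments hom {c} _ _.
Arguments idm {c} X.
Arguments mcomp {c X Y Z} _ _.

Notation "g ∘ f" := (mcomp g f) (at level 40, left associativity).

Section Limits.
Context {C : category}.

Definition is_terminal (T : C) : Prop := forall X : C, exists! f : hom X T, True.

Definition is_product (X Y Z : C) (p : hom Z X) (q : hom Z Y) : Prop :=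
  forall (W : C) (u : hom W X) (v : hom W Y),
    exists! w : hom W Z, p ∘ w = u /\ q ∘ w = v.

Definition is_product_projection (Z Y : C) (g : hom Z Y) : Prop :=
  exists (V : C) (q : hom Z V), is_product g q.

(* [p1] and [p2] exhibit [Q] as the fibre product of [f] and [g]. *)
Definition is_pullback (Q X Y Z : C) (p1 : hom Q X) (p2 : hom Q Y)
    (f : hom X Z) (g : hom Y Z) : Prop :=
  f ∘ p1 = g ∘ p2 /\
  forall (W : C) (u : hom W X) (v : hom W Y), f ∘ u = g ∘ v ->
    exists! w : hom W Q, p1 ∘ w = u /\ p2 ∘ w = v.

(* The hom-set of the slice category over [X], from [h] to [k]. *)
Definition slice_hom (X W P : C) (h : hom W X) (k : hom P X) : Type :=
  {u : hom W P | k ∘ u = h}.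

(* The bijection is given for every choice of fibre product [W ×_X Y];
   naturality also covers the comparison between two such choices. *)
Record dep_exponential (X Y Z : C) (f : hom Y X) (g : hom Z Y) := DepExponential {
  de_ob : C;
  de_map : hom de_ob X;
  de_transpose : forall (W : C) (h : hom W X) (Q : C) (p1 : hom Q W) (p2 : hom Q Y),
    is_pullback p1 p2 h f -> slice_hom h de_map -> slice_hom p2 g;
  de_bijective : forall W (h : hom W X) Q (p1 : hom Q W) (p2 : hom Q Y)
    (pb : is_pullback p1 p2 h f), bijective (de_transpose pb);
  de_natural : forall W (h : hom W X) Q (p1 : hom Q W) (p2 : hom Q Y)
    (pb : is_pullback p1 p2 h f)
    W' (h' : hom W' X) Q' (p1' : hom Q' W') (p2' : hom Q' Y)
    (pb' : is_pullback p1' p2' h' f) (t : hom W' W) (t' : hom Q' Q),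
    h ∘ t = h' -> p1 ∘ t' = t ∘ p1' -> p2 ∘ t' = p2' ->
    forall (u : slice_hom h de_map) (u' : slice_hom h' de_map),
      sval u' = sval u ∘ t ->
      sval (de_transpose pb' u') = sval (de_transpose pb u) ∘ t' }.

End Limits.

Definition has_terminal (C : category) : Prop := exists T : C, is_terminal T.

Definition has_finite_products (C : category) : Prop :=
  has_terminal C /\
  forall X Y : C, exists (Z : C) (p : hom Z X) (q : hom Z Y), is_product p q.

(* A functor P : T -> C.  The objects of T are presented as the disjoint union
   of its fibres, [Ty Γ] being the objects over [Γ]; P on arrows is [tover]. *)
Record total_cat (C : category) := TotalCat {
  Ty : C -> Type;
  tmap : forall Γ Δ : C, Ty Γ -> Ty Δ -> Type;
  tid : forall Γ (A : Ty Γ), tmap A A;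
  tcomp : forall Γ Δ Θ (A : Ty Γ) (B : Ty Δ) (D : Ty Θ),
    tmap B D -> tmap A B -> tmap A D;
  tcomp_idl : forall Γ Δ (A : Ty Γ) (B : Ty Δ) (f : tmap A B), tcomp (tid B) f = f;
  tcomp_idr : forall Γ Δ (A : Ty Γ) (B : Ty Δ) (f : tmap A B), tcomp f (tid A) = f;
  tcompA : forall Γ Δ Θ Ξ (A : Ty Γ) (B : Ty Δ) (D : Ty Θ) (E : Ty Ξ)
    (h : tmap D E) (g : tmap B D) (f : tmap A B),
    tcomp h (tcomp g f) = tcomp (tcomp h g) f;
  tover : forall Γ Δ (A : Ty Γ) (B : Ty Δ), tmap A B -> hom Γ Δ;
  over_id : forall Γ (A : Ty Γ), tover (tid A) = idm Γ;
  over_comp : forall Γ Δ Θ (A : Ty Γ) (B : Ty Δ) (D : Ty Θ)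
    (g : tmap B D) (f : tmap A B), tover (tcomp g f) = tover g ∘ tover f }.

Arguments Ty {C t} Γ.
Arguments tmap {C t Γ Δ} A B.
Arguments tid {C t Γ} A.
Arguments tcomp {C t Γ Δ Θ A B D} g f.
Arguments tover {C t Γ Δ A B} f.

Definition is_cartesian (C : category) (T : total_cat C) (Γ Δ : C)
    (A : Ty (t:=T) Γ) (B : Ty (t:=T) Δ) (f : tmap A B) : Prop :=
  forall (Θ : C) (X : Ty (t:=T) Θ) (g : tmap X B) (τ : hom Θ Γ),
    tover g = tover f ∘ τ ->
    exists! k : tmap X A, tover k = τ /\ tcomp f k = g.

Record compcat := CompCat {
  base :> category;
  total : total_cat base;
  (* the cleaving of P *)
  reix : forall Γ Δ : base, Ty (t:=total) Γ -> hom Δ Γ -> Ty (t:=total) Δ;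
  lift : forall (Γ Δ : base) (A : Ty (t:=total) Γ) (σ : hom Δ Γ), tmap (reix A σ) A;
  over_lift : forall (Γ Δ : base) (A : Ty (t:=total) Γ) (σ : hom Δ Γ),
    tover (lift A σ) = σ;
  lift_cartesian : forall (Γ Δ : base) (A : Ty (t:=total) Γ) (σ : hom Δ Γ),
    is_cartesian (lift A σ);
  (* the functor χ : T -> C^→ *)
  ext : forall Γ : base, Ty (t:=total) Γ -> base;
  disp : forall (Γ : base) (A : Ty (t:=total) Γ), hom (ext A) Γ;
  emap : forall (Γ Δ : base) (A : Ty (t:=total) Γ) (B : Ty (t:=total) Δ),
    tmap A B -> hom (ext A) (ext B);
  disp_emap : forall (Γ Δ : base) (A : Ty (t:=total) Γ) (B : Ty (t:=total) Δ)
    (f : tmap A B), disp B ∘ emap f = tover f ∘ disp A;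
  emap_id : forall (Γ : base) (A : Ty (t:=total) Γ), emap (tid A) = idm (ext A);
  emap_comp : forall (Γ Δ Θ : base) (A : Ty (t:=total) Γ) (B : Ty (t:=total) Δ)
    (D : Ty (t:=total) Θ) (g : tmap B D) (f : tmap A B),
    emap (tcomp g f) = emap g ∘ emap f;
  cartesian_pullback : forall (Γ Δ : base) (A : Ty (t:=total) Γ)
    (B : Ty (t:=total) Δ) (f : tmap A B),
    is_cartesian f -> is_pullback (emap f) (disp A) (disp B) (tover f) }.

Arguments reix {c Γ Δ} A σ.
Arguments lift {c Γ Δ} A σ.
Arguments lift_cartesian {c Γ Δ} A σ.
Arguments ext {c Γ} A.
Arguments disp {c Γ} A.
Arguments emap {c Γ Δ A B} f.

Notation ty S Γ := (Ty (t:=total S) Γ) (only parsing).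
Notation "A .[ σ ]" := (reix A σ) (at level 2, left associativity, format "A .[ σ ]").

Definition is_full (S : compcat) : Prop :=
  forall (Γ Δ : S) (A : ty S Γ) (B : ty S Δ) (σ : hom Γ Δ) (u : hom (ext A) (ext B)),
    disp B ∘ u = σ ∘ disp A -> exists! f : tmap A B, tover f = σ /\ emap f = u.

(* The reindexed type and its cartesian arrow are compared as a pair. *)
Definition is_split (S : compcat) : Prop :=
  (forall (Γ : S) (A : ty S Γ),
     existT (fun A' : ty S Γ => tmap A' A) A.[idm Γ] (lift A (idm Γ))
     = existT (fun A' : ty S Γ => tmap A' A) A (tid A)) /\
  (forall (Γ Δ Θ : S) (A : ty S Γ) (σ : hom Δ Γ) (τ : hom Θ Δ),
     existT (fun A' : ty S Θ => tmap A' A) A.[σ ∘ τ] (lift A (σ ∘ τ))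
     = existT (fun A' : ty S Θ => tmap A' A) A.[σ].[τ]
         (tcomp (lift A σ) (lift A.[σ] τ))).

Inductive is_display (S : compcat) : forall X Y : S, hom X Y -> Prop :=
| display_disp (Γ : S) (A : ty S Γ) : is_display (disp A)
| display_comp (X Y Z : S) (g : hom Y Z) (f : hom X Y) :
    is_display g -> is_display f -> is_display (g ∘ f).

Definition condition_LF (S : compcat) : Prop :=
  has_finite_products S /\
  forall (X Y Z : S) (f : hom Y X) (g : hom Z Y),
    is_display f -> is_display g \/ is_product_projection g ->
    inhabited (dep_exponential f g).

Section Cartesian.
Context {S : compcat}.

Section Factor.
Context {Γ Δ : S} {A : ty S Γ} {B : ty S Δ} (f : tmap A B) (hf : is_cartesian f).

Definition tfactor_sig (Θ : S) (X : ty S Θ) (g : tmap X B) (τ : hom Θ Γ)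
    (e : tover g = tover f ∘ τ) : {k : tmap X A | tover k = τ /\ tcomp f k = g} :=
  unique_choice (hf e).

Definition tfactor (Θ : S) (X : ty S Θ) (g : tmap X B) (τ : hom Θ Γ)
    (e : tover g = tover f ∘ τ) : tmap X A := sval (tfactor_sig e).

Definition cpair_sig (X : S) (u : hom X Γ) (v : hom X (ext B))
    (e : disp B ∘ v = tover f ∘ u) :
    {w : hom X (ext A) | emap f ∘ w = v /\ disp A ∘ w = u} :=
  unique_choice (proj2 (cartesian_pullback hf) X v u e).

(* The map into [ext A] induced by the pullback square [χ(f)]. *)
Definition cpair (X : S) (u : hom X Γ) (v : hom X (ext B))
    (e : disp B ∘ v = tover f ∘ u) : hom X (ext A) := sval (cpair_sig e).

End Factor.

Lemma over_tfactor Γ Δ (A : ty S Γ) (B : ty S Δ) (f : tmap A B) (hf : is_cartesian f)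
    Θ (X : ty S Θ) (g : tmap X B) τ (e : tover g = tover f ∘ τ) :
  tover (tfactor hf e) = τ.
Proof. exact: (proj1 (proj2_sig (tfactor_sig hf e))). Qed.

Lemma tfactorK Γ Δ (A : ty S Γ) (B : ty S Δ) (f : tmap A B) (hf : is_cartesian f)
    Θ (X : ty S Θ) (g : tmap X B) τ (e : tover g = tover f ∘ τ) :
  tcomp f (tfactor hf e) = g.
Proof. exact: (proj2 (proj2_sig (tfactor_sig hf e))). Qed.

Lemma emap_cpair Γ Δ (A : ty S Γ) (B : ty S Δ) (f : tmap A B) (hf : is_cartesian f)
    X (u : hom X Γ) (v : hom X (ext B)) (e : disp B ∘ v = tover f ∘ u) :
  emap f ∘ cpair hf e = v.
Proof. exact: (proj1 (proj2_sig (cpair_sig hf e))). Qed.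

Lemma disp_cpair Γ Δ (A : ty S Γ) (B : ty S Δ) (f : tmap A B) (hf : is_cartesian f)
    X (u : hom X Γ) (v : hom X (ext B)) (e : disp B ∘ v = tover f ∘ u) :
  disp A ∘ cpair hf e = u.
Proof. exact: (proj2 (proj2_sig (cpair_sig hf e))). Qed.

Lemma cart_hom_ext Γ Δ (A : ty S Γ) (B : ty S Δ) (f : tmap A B) (hf : is_cartesian f)
    X (w w' : hom X (ext A)) :
  emap f ∘ w = emap f ∘ w' -> disp A ∘ w = disp A ∘ w' -> w = w'.
Proof.
move=> e1 e2; case: (cartesian_pullback hf) => sq up.
have e : disp B ∘ (emap f ∘ w') = tover f ∘ (disp A ∘ w') by rewrite !mcompA sq.
case: (up _ _ _ e) => w0 [_ uniq].
by rewrite -(uniq w (conj e1 e2)) -(uniq w' (conj erefl erefl)).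
Qed.

Lemma tcomp_cartesian Γ Δ Θ (A : ty S Γ) (B : ty S Δ) (D : ty S Θ)
    (g : tmap B D) (f : tmap A B) :
  is_cartesian g -> is_cartesian f -> is_cartesian (tcomp g f).
Proof.
move=> hg hf Ξ X h τ e.
have e1 : tover h = tover g ∘ (tover f ∘ τ) by rewrite e over_comp mcompA.
case: (hg _ _ _ _ e1) => k [[ok kK] uk].
case: (hf _ _ _ _ ok) => l [[ol lK] ul].
exists l; split; first by rewrite ol -tcompA lK kK.
move=> l' [ol' lK']; apply: ul; split=> //; symmetry; apply: uk; split.
  by rewrite over_comp ol'.
by rewrite tcompA.
Qed.

Lemma tfactor_cartesian Γ Δ (A : ty S Γ) (B : ty S Δ) (f : tmap A B)
    (hf : is_cartesian f) Θ (X : ty S Θ) (g : tmap X B) τ (e : tover g = tover f ∘ τ) :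
  is_cartesian g -> is_cartesian (tfactor hf e).
Proof.
move=> hg Ξ Y h ρ; rewrite over_tfactor => eh.
have e1 : tover (tcomp f h) = tover g ∘ ρ by rewrite over_comp eh e mcompA.
case: (hg _ _ _ _ e1) => k [[ok kK] uk].
exists k; split.
  split=> //.
  have e2 : tover (tcomp f h) = tover f ∘ (τ ∘ ρ) by rewrite over_comp eh.
  case: (hf _ _ _ _ e2) => l [_ ul].
  transitivity l; last by apply: ul.
  symmetry; apply: ul; split; first by rewrite over_comp over_tfactor ok.
  by rewrite tcompA tfactorK.
move=> k' [ok' kK']; apply: uk; split=> //.
by rewrite -kK' tcompA tfactorK.
Qed.

Definition section (Γ : S) (A : ty S Γ) : Type :=
  {s : hom Γ (ext A) | disp A ∘ s = idm Γ}.

Lemma pull_section_eq (Γ Δ : S) (A : ty S Γ) (B : ty S Δ) (f : tmap A B)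
    (s : section B) : disp B ∘ (sval s ∘ tover f) = tover f ∘ idm Γ.
Proof. by rewrite mcompA (proj2_sig s) comp_idl comp_idr. Qed.

Definition pull_section (Γ Δ : S) (A : ty S Γ) (B : ty S Δ) (f : tmap A B)
    (hf : is_cartesian f) (s : section B) : section A :=
  exist _ (cpair hf (pull_section_eq f s)) (disp_cpair hf (pull_section_eq f s)).

End Cartesian.

Arguments tcomp_cartesian {S Γ Δ Θ A B D g f} hg hf.
Arguments tfactor_cartesian {S Γ Δ A B f} hf {Θ X g τ} e hg.

Section Reindexing.
Context {S : compcat}.

(* The map Δ.A[σ] -> Γ.A over σ. *)
Definition qmap (Γ Δ : S) (σ : hom Δ Γ) (A : ty S Γ) : hom (ext A.[σ]) (ext A) :=
  emap (lift A σ).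

Lemma disp_q (Γ Δ : S) (σ : hom Δ Γ) (A : ty S Γ) :
  disp A ∘ qmap σ A = σ ∘ disp A.[σ].
Proof. by rewrite /qmap disp_emap over_lift. Qed.

Lemma lift_eq (Γ Δ X : S) (σ : hom Δ Γ) (A : ty S Γ) (u : hom X Δ) (v : hom X (ext A)) :
  disp A ∘ v = σ ∘ u -> disp A ∘ v = tover (lift A σ) ∘ u.
Proof. by rewrite over_lift. Qed.

(* The map (u, v) into Δ.A[σ], the pullback of Γ.A along σ. *)
Definition rpair (Γ Δ X : S) (σ : hom Δ Γ) (A : ty S Γ) (u : hom X Δ)
    (v : hom X (ext A)) (e : disp A ∘ v = σ ∘ u) : hom X (ext A.[σ]) :=
  cpair (lift_cartesian A σ) (lift_eq e).

Lemma q_rpair (Γ Δ X : S) (σ : hom Δ Γ) (A : ty S Γ) (u : hom X Δ)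
    (v : hom X (ext A)) (e : disp A ∘ v = σ ∘ u) : qmap σ A ∘ rpair e = v.
Proof. exact: emap_cpair. Qed.

Lemma disp_rpair (Γ Δ X : S) (σ : hom Δ Γ) (A : ty S Γ) (u : hom X Δ)
    (v : hom X (ext A)) (e : disp A ∘ v = σ ∘ u) : disp A.[σ] ∘ rpair e = u.
Proof. exact: disp_cpair. Qed.

Lemma reix_hom_ext (Γ Δ X : S) (σ : hom Δ Γ) (A : ty S Γ) (w w' : hom X (ext A.[σ])) :
  qmap σ A ∘ w = qmap σ A ∘ w' -> disp A.[σ] ∘ w = disp A.[σ] ∘ w' -> w = w'.
Proof. exact: cart_hom_ext (lift_cartesian A σ) _ _ _. Qed.

Definition reix_section (Γ Δ : S) (A : ty S Γ) (s : section A) (σ : hom Δ Γ) :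
    section A.[σ] := pull_section (lift_cartesian A σ) s.

Lemma q_reix_section (Γ Δ : S) (A : ty S Γ) (s : section A) (σ : hom Δ Γ) :
  qmap σ A ∘ sval (reix_section s σ) = sval s ∘ σ.
Proof. by rewrite /qmap /= emap_cpair over_lift. Qed.

Lemma wkmap_eq (Γ Δ : S) (σ : hom Δ Γ) (A B : ty S Γ) :
  disp B ∘ (qmap σ B ∘ qmap (disp A.[σ]) B.[σ])
  = disp A ∘ (qmap σ A ∘ disp B.[σ].[disp A.[σ]]).
Proof. by rewrite !mcompA !disp_q -!mcompA disp_q. Qed.

(* The canonical map Δ.A[σ].B[σ] -> Γ.A.B over [qmap σ A], where B is weakened
   along A on both sides. *)
Definition wkmap (Γ Δ : S) (σ : hom Δ Γ) (A B : ty S Γ) :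
    hom (ext B.[σ].[disp A.[σ]]) (ext B.[disp A]) :=
  rpair (wkmap_eq σ A B).

End Reindexing.

(* A constructor of type theory, presented by: the inputs of its formation
   rule; its formation and introduction data; the inputs of its elimination
   rule (of its λ-abstraction rule, for Π); the sections of the required type;
   and the equations that such a section has to satisfy. *)
Record type_former (S : compcat) := TypeFormer {
  input : S -> Type;
  input_reix : forall Γ Δ : S, input Γ -> hom Δ Γ -> input Δ;
  data : forall Γ : S, input Γ -> Type;
  data_reix : forall (Γ Δ : S) (i : input Γ),
    data i -> forall σ : hom Δ Γ, data (input_reix i σ);
  problem : forall (Γ : S) (i : input Γ), data i -> Type;
  problem_reix : forall (Γ Δ : S) (i : input Γ) (D : data i),
    problem D -> forall σ : hom Δ Γ, problem (data_reix D σ);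
  candidate : forall (Γ : S) (i : input Γ) (D : data i), problem D -> Type;
  candidate_reix : forall (Γ Δ : S) (i : input Γ) (D : data i) (P : problem D),
    candidate P -> forall σ : hom Δ Γ, candidate (problem_reix P σ);
  solves : forall (Γ : S) (i : input Γ) (D : data i) (P : problem D),
    candidate P -> Prop }.

Definition weakly_stable (S : compcat) (K : type_former S) : Prop :=
  forall (Γ : S) (i : input K Γ), exists D : data i,
    forall (Δ : S) (σ : hom Δ Γ) (P : problem (data_reix D σ)),
      exists s : candidate P, solves s.

(* [elim] takes the chosen data as an argument [D] with [D = form i], so that
   its stability can be stated on [data_reix D σ] without transports. *)
Record strictly_stable (S : compcat) (K : type_former S) := StrictlyStable {
  form : forall (Γ : S) (i : input K Γ), data i;
  form_reix : forall (Γ Δ : S) (σ : hom Δ Γ) (i : input K Γ),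
    form (input_reix i σ) = data_reix (form i) σ;
  elim : forall (Γ : S) (i : input K Γ) (D : data i), D = form i ->
    forall P : problem D, candidate P;
  elim_solves : forall (Γ : S) (i : input K Γ) (D : data i) (e : D = form i)
    (P : problem D), solves (elim e P);
  elim_reix : forall (Γ Δ : S) (σ : hom Δ Γ) (i : input K Γ) (D : data i)
    (e : D = form i) (e' : data_reix D σ = form (input_reix i σ)) (P : problem D),
    elim e' (problem_reix P σ) = candidate_reix (elim e P) σ }.

Section TypeFormers.
Context (S : compcat).

(* Reindexing along σ of a map c : X -> Γ.T over k : X -> Γ, where f : Y -> X
   and k' : Y -> Δ lie over σ. *)
Lemma constr_reix_eq (Γ Δ X Y : S) (σ : hom Δ Γ) (T : ty S Γ) (k : hom X Γ)
    (c : hom X (ext T)) (f : hom Y X) (k' : hom Y Δ) :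
  disp T ∘ c = k -> k ∘ f = σ ∘ k' -> disp T ∘ (c ∘ f) = σ ∘ k'.
Proof. by move=> e <-; rewrite mcompA e. Qed.

Lemma disp2_q (Γ Δ : S) (σ : hom Δ Γ) (A : ty S Γ) (B : ty S (ext A)) :
  disp A ∘ disp B ∘ qmap (qmap σ A) B = σ ∘ (disp A.[σ] ∘ disp B.[qmap σ A]).
Proof. by rewrite -mcompA disp_q !mcompA disp_q. Qed.

Lemma idm_comm (Γ Δ : S) (σ : hom Δ Γ) : idm Γ ∘ σ = σ ∘ idm Δ.
Proof. by rewrite comp_idl comp_idr. Qed.

Record sum_data (Γ : S) (A B : ty S Γ) := SumData {
  sum_ty : ty S Γ;
  sum_inl : hom (ext A) (ext sum_ty);
  sum_inr : hom (ext B) (ext sum_ty);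
  sum_inl_over : disp sum_ty ∘ sum_inl = disp A;
  sum_inr_over : disp sum_ty ∘ sum_inr = disp B }.

Definition sum_data_reix (Γ Δ : S) (A B : ty S Γ) (D : sum_data A B) (σ : hom Δ Γ) :
    sum_data A.[σ] B.[σ] :=
  {| sum_ty := (sum_ty D).[σ];
     sum_inl := rpair (constr_reix_eq (sum_inl_over D) (disp_q σ A));
     sum_inr := rpair (constr_reix_eq (sum_inr_over D) (disp_q σ B));
     sum_inl_over := disp_rpair _;
     sum_inr_over := disp_rpair _ |}.

Record sum_problem (Γ : S) (A B : ty S Γ) (D : sum_data A B) := SumProblem {
  sum_mot : ty S (ext (sum_ty D));
  sum_casel : hom (ext A) (ext sum_mot);
  sum_caser : hom (ext B) (ext sum_mot);
  sum_casel_over : disp sum_mot ∘ sum_casel = sum_inl D;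
  sum_caser_over : disp sum_mot ∘ sum_caser = sum_inr D }.

Definition sum_problem_reix (Γ Δ : S) (A B : ty S Γ) (D : sum_data A B)
    (P : sum_problem D) (σ : hom Δ Γ) : sum_problem (sum_data_reix D σ) :=
  @SumProblem _ _ _ (sum_data_reix D σ)
    (sum_mot P).[qmap σ (sum_ty D)]
    (rpair (constr_reix_eq (sum_casel_over P) (esym (q_rpair _))))
    (rpair (constr_reix_eq (sum_caser_over P) (esym (q_rpair _))))
    (disp_rpair _) (disp_rpair _).

Definition sum_former : type_former S :=
  {| input := fun Γ => (ty S Γ * ty S Γ)%type;
     input_reix := fun Γ Δ i σ => ((fst i).[σ], (snd i).[σ]);
     data := fun Γ i => sum_data (fst i) (snd i);
     data_reix := fun Γ Δ i D σ => sum_data_reix D σ;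
     problem := fun Γ i D => sum_problem D;
     problem_reix := fun Γ Δ i D P σ => sum_problem_reix P σ;
     candidate := fun Γ i D P => section (sum_mot P);
     candidate_reix := fun Γ Δ i D P s σ => reix_section s (qmap σ (sum_ty D));
     solves := fun Γ i D P s =>
       sval s ∘ sum_inl D = sum_casel P /\ sval s ∘ sum_inr D = sum_caser P |}.

Definition zero_former : type_former S :=
  {| input := fun Γ => unit;
     input_reix := fun Γ Δ i σ => tt;
     data := fun Γ i => ty S Γ;
     data_reix := fun Γ Δ i Z σ => Z.[σ];
     problem := fun Γ i Z => ty S (ext Z);
     problem_reix := fun Γ Δ i Z C σ => C.[qmap σ Z];
     candidate := fun Γ i Z C => section C;
     candidate_reix := fun Γ Δ i Z C s σ => reix_section s (qmap σ Z);
     solves := fun Γ i Z C s => True |}.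

Record unit_data (Γ : S) := UnitData {
  unit_ty : ty S Γ;
  unit_star : section unit_ty }.

Definition unit_data_reix (Γ Δ : S) (D : unit_data Γ) (σ : hom Δ Γ) : unit_data Δ :=
  {| unit_ty := (unit_ty D).[σ];
     unit_star := reix_section (unit_star D) σ |}.

Record unit_problem (Γ : S) (D : unit_data Γ) := UnitProblem {
  unit_mot : ty S (ext (unit_ty D));
  unit_case : hom Γ (ext unit_mot);
  unit_case_over : disp unit_mot ∘ unit_case = sval (unit_star D) }.

Definition unit_problem_reix (Γ Δ : S) (D : unit_data Γ) (P : unit_problem D)
    (σ : hom Δ Γ) : unit_problem (unit_data_reix D σ) :=
  @UnitProblem _ (unit_data_reix D σ)
    (unit_mot P).[qmap σ (unit_ty D)]
    (rpair (constr_reix_eq (unit_case_over P) (esym (q_reix_section _ _))))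
    (disp_rpair _).

Definition unit_former : type_former S :=
  {| input := fun Γ => unit;
     input_reix := fun Γ Δ i σ => tt;
     data := fun Γ i => unit_data Γ;
     data_reix := fun Γ Δ i D σ => unit_data_reix D σ;
     problem := fun Γ i D => unit_problem D;
     problem_reix := fun Γ Δ i D P σ => unit_problem_reix P σ;
     candidate := fun Γ i D P => section (unit_mot P);
     candidate_reix := fun Γ Δ i D P s σ => reix_section s (qmap σ (unit_ty D));
     solves := fun Γ i D P s => sval s ∘ sval (unit_star D) = unit_case P |}.

Record sig_data (Γ : S) (A : ty S Γ) (B : ty S (ext A)) := SigData {
  sig_ty : ty S Γ;
  sig_pair : hom (ext B) (ext sig_ty);
  sig_pair_over : disp sig_ty ∘ sig_pair = disp A ∘ disp B }.

Definition sig_data_reix (Γ Δ : S) (A : ty S Γ) (B : ty S (ext A)) (D : sig_data B)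
    (σ : hom Δ Γ) : sig_data B.[qmap σ A] :=
  @SigData _ _ B.[qmap σ A] (sig_ty D).[σ]
    (rpair (constr_reix_eq (sig_pair_over D) (disp2_q σ B)))
    (disp_rpair _).

Record sig_problem (Γ : S) (A : ty S Γ) (B : ty S (ext A)) (D : sig_data B) :=
  SigProblem {
  sig_mot : ty S (ext (sig_ty D));
  sig_case : hom (ext B) (ext sig_mot);
  sig_case_over : disp sig_mot ∘ sig_case = sig_pair D }.

Definition sig_problem_reix (Γ Δ : S) (A : ty S Γ) (B : ty S (ext A)) (D : sig_data B)
    (P : sig_problem D) (σ : hom Δ Γ) : sig_problem (sig_data_reix D σ) :=
  @SigProblem _ _ _ (sig_data_reix D σ)
    (sig_mot P).[qmap σ (sig_ty D)]
    (rpair (constr_reix_eq (sig_case_over P) (esym (q_rpair _))))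
    (disp_rpair _).

Definition fam_input (Γ : S) : Type := {A : ty S Γ & ty S (ext A)}.

Definition fam_input_reix (Γ Δ : S) (i : fam_input Γ) (σ : hom Δ Γ) : fam_input Δ :=
  existT _ (projT1 i).[σ] (projT2 i).[qmap σ (projT1 i)].

Definition sig_former : type_former S :=
  {| input := fam_input;
     input_reix := fam_input_reix;
     data := fun Γ i => sig_data (projT2 i);
     data_reix := fun Γ Δ i D σ => sig_data_reix D σ;
     problem := fun Γ i D => sig_problem D;
     problem_reix := fun Γ Δ i D P σ => sig_problem_reix P σ;
     candidate := fun Γ i D P => section (sig_mot P);
     candidate_reix := fun Γ Δ i D P s σ => reix_section s (qmap σ (sig_ty D));
     solves := fun Γ i D P s => sval s ∘ sig_pair D = sig_case P |}.

Lemma diag_eq (Γ : S) (A : ty S Γ) : disp A ∘ idm (ext A) = disp A ∘ idm (ext A).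
Proof. by []. Qed.

(* The diagonal Γ.A -> Γ.A.A. *)
Definition diag (Γ : S) (A : ty S Γ) : hom (ext A) (ext A.[disp A]) :=
  rpair (diag_eq A).

Lemma diag_wkmap (Γ Δ : S) (σ : hom Δ Γ) (A : ty S Γ) :
  diag A ∘ qmap σ A = wkmap σ A A ∘ diag A.[σ].
Proof.
apply: reix_hom_ext.
  by rewrite mcompA q_rpair mcompA q_rpair -mcompA q_rpair idm_comm.
by rewrite mcompA disp_rpair mcompA disp_rpair -mcompA disp_rpair idm_comm.
Qed.

Record id_data (Γ : S) (A : ty S Γ) := IdData {
  id_ty : ty S (ext A.[disp A]);
  id_refl : hom (ext A) (ext id_ty);
  id_refl_over : disp id_ty ∘ id_refl = diag A }.

Definition id_data_reix (Γ Δ : S) (A : ty S Γ) (D : id_data A) (σ : hom Δ Γ) :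
    id_data A.[σ] :=
  @IdData _ A.[σ] (id_ty D).[wkmap σ A A]
    (rpair (constr_reix_eq (id_refl_over D) (diag_wkmap σ A)))
    (disp_rpair _).

Record id_problem (Γ : S) (A : ty S Γ) (D : id_data A) := IdProblem {
  id_mot : ty S (ext (id_ty D));
  id_case : hom (ext A) (ext id_mot);
  id_case_over : disp id_mot ∘ id_case = id_refl D }.

Definition id_problem_reix (Γ Δ : S) (A : ty S Γ) (D : id_data A) (P : id_problem D)
    (σ : hom Δ Γ) : id_problem (id_data_reix D σ) :=
  @IdProblem _ _ (id_data_reix D σ)
    (id_mot P).[qmap (wkmap σ A A) (id_ty D)]
    (rpair (constr_reix_eq (id_case_over P) (esym (q_rpair _))))
    (disp_rpair _).

Definition id_former : type_former S :=
  {| input := fun Γ => ty S Γ;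
     input_reix := fun Γ Δ A σ => A.[σ];
     data := fun Γ A => id_data A;
     data_reix := fun Γ Δ A D σ => id_data_reix D σ;
     problem := fun Γ A D => id_problem D;
     problem_reix := fun Γ Δ A D P σ => id_problem_reix P σ;
     candidate := fun Γ A D P => section (id_mot P);
     candidate_reix := fun Γ Δ A D P s σ =>
       reix_section s (qmap (wkmap σ A A) (id_ty D));
     solves := fun Γ A D P s => sval s ∘ id_refl D = id_case P |}.

(* [pi_app] is the evaluation map Γ.A.Π[A,B] -> Γ.A.B over Γ.A. *)
Record pi_data (Γ : S) (A : ty S Γ) (B : ty S (ext A)) := PiData {
  pi_ty : ty S Γ;
  pi_app : hom (ext pi_ty.[disp A]) (ext B);
  pi_app_over : disp B ∘ pi_app = disp pi_ty.[disp A] }.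

Definition pi_data_reix (Γ Δ : S) (A : ty S Γ) (B : ty S (ext A)) (D : pi_data B)
    (σ : hom Δ Γ) : pi_data B.[qmap σ A] :=
  @PiData _ _ B.[qmap σ A] (pi_ty D).[σ]
    (rpair (constr_reix_eq (pi_app_over D) (disp_rpair (wkmap_eq σ A (pi_ty D)))))
    (disp_rpair _).

(* A λ-abstraction of [b] is a section of Π[A,B] from which [b] is recovered by
   evaluation (the β-rule); there is no η-rule. *)
Definition pi_former : type_former S :=
  {| input := fam_input;
     input_reix := fam_input_reix;
     data := fun Γ i => pi_data (projT2 i);
     data_reix := fun Γ Δ i D σ => pi_data_reix D σ;
     problem := fun Γ i D => section (projT2 i);
     problem_reix := fun Γ Δ i D b σ => reix_section b (qmap σ (projT1 i));
     candidate := fun Γ i D b => section (pi_ty D);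
     candidate_reix := fun Γ Δ i D b s σ => reix_section s σ;
     solves := fun Γ i D b s =>
       pi_app D ∘ sval (reix_section s (disp (projT1 i))) = sval b |}.

Definition is_abstraction (Γ : S) (A : ty S Γ) (B : ty S (ext A)) (D : pi_data B)
    (b : section B) (s : section (pi_ty D)) : Prop :=
  pi_app D ∘ sval (reix_section s (disp A)) = sval b.

Lemma cart_wk_eq (Γ Δ : S) (A : ty S Γ) (A' : ty S Δ) (T : ty S Γ) (T' : ty S Δ)
    (a : tmap A' A) (t : tmap T' T) :
  tover t = tover a ->
  disp T ∘ (emap t ∘ qmap (disp A') T')
  = disp A ∘ (emap a ∘ disp T'.[disp A']).
Proof.
by move=> e; rewrite !mcompA !disp_emap e -!mcompA disp_q.
Qed.

(* [D'] is a reindexing of [D] along σ, for an arbitrary choice of cartesian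
   arrows over σ. *)
Definition pi_reindexing (Γ Δ : S) (σ : hom Δ Γ)
    (A' : ty S Δ) (B' : ty S (ext A')) (D' : pi_data B')
    (A : ty S Γ) (B : ty S (ext A)) (D : pi_data B) : Prop :=
  exists (a : tmap A' A) (b : tmap B' B) (p : tmap (pi_ty D') (pi_ty D))
    (e : tover p = tover a),
    [/\ is_cartesian a, is_cartesian b & is_cartesian p] /\
    [/\ tover a = σ, tover b = emap a
      & emap b ∘ pi_app D' = pi_app D ∘ rpair (cart_wk_eq e)].

Definition pi_class : Type :=
  forall (Γ : S) (A : ty S Γ) (B : ty S (ext A)), pi_data B -> Prop.

Record stable_pi_class (Cl : pi_class) : Prop := StablePiClass {
  spc_pi : forall (Γ : S) (A : ty S Γ) (B : ty S (ext A)) (D : pi_data B),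
    Cl Γ A B D -> forall b : section B, exists s : section (pi_ty D), is_abstraction b s;
  spc_reix : forall (Γ Δ : S) (σ : hom Δ Γ)
    (A' : ty S Δ) (B' : ty S (ext A')) (D' : pi_data B')
    (A : ty S Γ) (B : ty S (ext A)) (D : pi_data B),
    pi_reindexing σ D' D -> Cl Γ A B D -> Cl Δ A' B' D';
  spc_exists : forall (Γ : S) (A : ty S Γ) (B : ty S (ext A)),
    exists D : pi_data B, Cl Γ A B D }.

(* The arity of the constructor of W : a Π-type Π[B,W] in context Γ.A.  The
   weakening of W to Γ.A.B is taken along any cartesian arrow, so that arities
   can be reindexed when the cleaving is not split. *)
Record w_arity (Γ : S) (A : ty S Γ) (B : ty S (ext A)) (W : ty S Γ) := WArity {
  w_fam : ty S (ext B);
  w_arr : tmap w_fam W;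
  w_arr_cart : is_cartesian w_arr;
  w_arr_over : tover w_arr = disp A ∘ disp B;
  w_fun : pi_data w_fam }.

Arguments w_arr_cart {Γ A B W} w.

Record w_data (Γ : S) (A : ty S Γ) (B : ty S (ext A)) := WData {
  w_ty : ty S Γ;
  w_ar : w_arity B w_ty;
  w_sup : hom (ext (pi_ty (w_fun w_ar))) (ext w_ty);
  w_sup_over : disp w_ty ∘ w_sup = disp A ∘ disp (pi_ty (w_fun w_ar)) }.

Lemma w_arr_reix_eq (Γ Δ : S) (A : ty S Γ) (B : ty S (ext A)) (W : ty S Γ)
    (R : w_arity B W) (σ : hom Δ Γ) :
  tover (tcomp (w_arr R) (lift (w_fam R) (qmap (qmap σ A) B)))
  = tover (lift W σ) ∘ (disp A.[σ] ∘ disp B.[qmap σ A]).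
Proof. by rewrite over_comp !over_lift w_arr_over disp2_q. Qed.

Definition w_arity_reix (Γ Δ : S) (A : ty S Γ) (B : ty S (ext A)) (W : ty S Γ)
    (R : w_arity B W) (σ : hom Δ Γ) : w_arity B.[qmap σ A] W.[σ] :=
  @WArity _ _ B.[qmap σ A] W.[σ]
    (w_fam R).[qmap (qmap σ A) B]
    (tfactor (lift_cartesian W σ) (w_arr_reix_eq R σ))
    (tfactor_cartesian _ _ (tcomp_cartesian (w_arr_cart R) (lift_cartesian _ _)))
    (over_tfactor _ _)
    (pi_data_reix (w_fun R) (qmap σ A)).

Definition w_data_reix (Γ Δ : S) (A : ty S Γ) (B : ty S (ext A)) (D : w_data B)
    (σ : hom Δ Γ) : w_data B.[qmap σ A] :=
  @WData _ _ B.[qmap σ A] (w_ty D).[σ] (w_arity_reix (w_ar D) σ)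
    (rpair (constr_reix_eq (w_sup_over D) (disp2_q σ (pi_ty (w_fun (w_ar D))))))
    (disp_rpair _).

Section WSubterm.
Context (Γ : S) (A : ty S Γ) (B : ty S (ext A)) (D : w_data B).

Let F := pi_ty (w_fun (w_ar D)).

Context (B' : ty S (ext F)) (b : tmap B' B) (hb : tover b = disp F).

Lemma w_fun_arg_eq : disp F ∘ disp B' = disp B ∘ emap b.
Proof. by rewrite disp_emap hb. Qed.

(* In context (x : A, f : Π[B x, W], y : B x), the subterm f(y) : W. *)
Definition w_subterm : hom (ext B') (ext (w_ty D)) :=
  emap (w_arr (w_ar D)) ∘ (pi_app (w_fun (w_ar D)) ∘ rpair w_fun_arg_eq).

End WSubterm.

Arguments w_subterm {Γ A B} D {B' b} hb.

(* [w_rec] is the recursive step: it sends x : A, f : Π[B x, W] and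
   h : Π[y : B x, C(f(y))] to an element of C(sup(x,f)).  As in [w_arity], the
   types B and C are weakened along arbitrary cartesian arrows. *)
Record w_problem (Γ : S) (A : ty S Γ) (B : ty S (ext A)) (D : w_data B) := WProblem {
  w_mot : ty S (ext (w_ty D));
  w_dom : ty S (ext (pi_ty (w_fun (w_ar D))));
  w_dom_arr : tmap w_dom B;
  w_dom_cart : is_cartesian w_dom_arr;
  w_dom_over : tover w_dom_arr = disp (pi_ty (w_fun (w_ar D)));
  w_cod : ty S (ext w_dom);
  w_cod_arr : tmap w_cod w_mot;
  w_cod_cart : is_cartesian w_cod_arr;
  w_cod_over : tover w_cod_arr = w_subterm D w_dom_over;
  w_hyp : pi_data w_cod;
  w_rec : hom (ext (pi_ty w_hyp)) (ext w_mot);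
  w_rec_over : disp w_mot ∘ w_rec = w_sup D ∘ disp (pi_ty w_hyp) }.

Arguments w_dom_cart {Γ A B D} w.
Arguments w_cod_cart {Γ A B D} w.

Definition abstraction_op (Γ : S) (A : ty S Γ) (B : ty S (ext A)) (D : pi_data B) : Type :=
  forall b : section B, {s : section (pi_ty D) | is_abstraction b s}.

(* r(sup(x,f)) = w_rec(x, f, λy. r(f(y))), for the λ-abstraction [Λ]. *)
Definition w_solves (Γ : S) (A : ty S Γ) (B : ty S (ext A)) (D : w_data B)
    (P : w_problem D) (Λ : abstraction_op (w_hyp P)) (r : section (w_mot P)) : Prop :=
  sval r ∘ w_sup D = w_rec P ∘ sval (sval (Λ (pull_section (w_cod_cart P) r))).

Lemma w_dom_reix_eq (Γ Δ : S) (A : ty S Γ) (B : ty S (ext A)) (D : w_data B)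
    (P : w_problem D) (σ : hom Δ Γ) (F := pi_ty (w_fun (w_ar D))) :
  tover (tcomp (w_dom_arr P) (lift (w_dom P) (qmap (qmap σ A) F)))
  = tover (lift B (qmap σ A)) ∘ disp F.[qmap σ A].
Proof. by rewrite over_comp !over_lift w_dom_over disp_q. Qed.

Definition w_dom_arr_reix (Γ Δ : S) (A : ty S Γ) (B : ty S (ext A)) (D : w_data B)
    (P : w_problem D) (σ : hom Δ Γ) :
    tmap (w_dom P).[qmap (qmap σ A) (pi_ty (w_fun (w_ar D)))] B.[qmap σ A] :=
  tfactor (lift_cartesian B (qmap σ A)) (w_dom_reix_eq P σ).

Definition w_dom_over_reix (Γ Δ : S) (A : ty S Γ) (B : ty S (ext A)) (D : w_data B)
    (P : w_problem D) (σ : hom Δ Γ) :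
    tover (w_dom_arr_reix P σ) = disp (pi_ty (w_fun (w_ar (w_data_reix D σ)))) :=
  over_tfactor _ _.

Lemma w_subterm_reix (Γ Δ : S) (A : ty S Γ) (B : ty S (ext A)) (D : w_data B)
    (P : w_problem D) (σ : hom Δ Γ) (F := pi_ty (w_fun (w_ar D))) :
  w_subterm D (w_dom_over P) ∘ qmap (qmap (qmap σ A) F) (w_dom P)
  = qmap σ (w_ty D) ∘ w_subterm (w_data_reix D σ) (w_dom_over_reix P σ).
Proof.
rewrite /w_subterm /= [in RHS]mcompA -[qmap σ (w_ty D)]/(emap (lift _ _)) -emap_comp.
rewrite tfactorK emap_comp -!mcompA; congr (_ ∘ _).
rewrite -/(qmap (qmap (qmap σ A) B) (w_fam (w_ar D))).
rewrite [qmap (qmap (qmap σ A) B) _ ∘ _]mcompA q_rpair -mcompA; congr (_ ∘ _).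
apply: reix_hom_ext.
  rewrite !mcompA q_rpair /wkmap q_rpair -!mcompA q_rpair.
  by rewrite disp_q.
rewrite !mcompA disp_rpair /wkmap disp_rpair -!mcompA disp_rpair.
rewrite -[qmap _ (w_dom P)]/(emap (lift _ _)) -emap_comp.
by rewrite -[qmap σ A]/(emap (lift _ _)) /w_dom_arr_reix -emap_comp tfactorK.
Qed.

Lemma w_cod_reix_eq (Γ Δ : S) (A : ty S Γ) (B : ty S (ext A)) (D : w_data B)
    (P : w_problem D) (σ : hom Δ Γ) (F := pi_ty (w_fun (w_ar D))) :
  tover (tcomp (w_cod_arr P) (lift (w_cod P) (qmap (qmap (qmap σ A) F) (w_dom P))))
  = tover (lift (w_mot P) (qmap σ (w_ty D)))
    ∘ w_subterm (w_data_reix D σ) (w_dom_over_reix P σ).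
Proof. by rewrite over_comp !over_lift w_cod_over w_subterm_reix. Qed.

Lemma w_rec_reix_eq (Γ Δ : S) (A : ty S Γ) (B : ty S (ext A)) (D : w_data B)
    (P : w_problem D) (σ : hom Δ Γ) (F := pi_ty (w_fun (w_ar D)))
    (H := pi_ty (w_hyp P)) :
  w_sup D ∘ disp H ∘ qmap (qmap (qmap σ A) F) H
  = qmap σ (w_ty D) ∘ (w_sup (w_data_reix D σ) ∘ disp H.[qmap (qmap σ A) F]).
Proof. by rewrite -mcompA disp_q !mcompA q_rpair. Qed.

Definition w_problem_reix (Γ Δ : S) (A : ty S Γ) (B : ty S (ext A)) (D : w_data B)
    (P : w_problem D) (σ : hom Δ Γ) (F := pi_ty (w_fun (w_ar D))) :
    w_problem (w_data_reix D σ) :=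
  @WProblem _ _ _ (w_data_reix D σ)
    (w_mot P).[qmap σ (w_ty D)]
    (w_dom P).[qmap (qmap σ A) F]
    (w_dom_arr_reix P σ)
    (tfactor_cartesian _ _ (tcomp_cartesian (w_dom_cart P) (lift_cartesian _ _)))
    (w_dom_over_reix P σ)
    (w_cod P).[qmap (qmap (qmap σ A) F) (w_dom P)]
    (tfactor (lift_cartesian (w_mot P) (qmap σ (w_ty D))) (w_cod_reix_eq P σ))
    (tfactor_cartesian _ _ (tcomp_cartesian (w_cod_cart P) (lift_cartesian _ _)))
    (over_tfactor _ _)
    (pi_data_reix (w_hyp P) (qmap (qmap σ A) F))
    (rpair (constr_reix_eq (w_rec_over P) (w_rec_reix_eq P σ)))
    (disp_rpair _).

(* Every Π-type of the class may serve as arity, as type of inductive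
   hypotheses, and be given any λ-abstraction: without η, these choices are not
   interchangeable. *)
Definition weakly_stable_W (Cl : pi_class) : Prop :=
  forall (Γ : S) (A : ty S Γ) (B : ty S (ext A)),
  exists W : ty S Γ, forall R : w_arity B W, Cl _ _ _ (w_fun R) ->
  exists (sup : hom (ext (pi_ty (w_fun R))) (ext W))
    (e : disp W ∘ sup = disp A ∘ disp (pi_ty (w_fun R))),
  forall (Δ : S) (σ : hom Δ Γ) (P : w_problem (w_data_reix (WData e) σ)),
    Cl _ _ _ (w_hyp P) -> forall Λ : abstraction_op (w_hyp P),
    exists r : section (w_mot P), w_solves Λ r.

Section StrictW.
Context (pi : strictly_stable pi_former).

Definition pi_form (Γ : S) (A : ty S Γ) (B : ty S (ext A)) : pi_data B :=
  form pi (existT _ A B).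

Definition pi_lam (Γ : S) (A : ty S Γ) (B : ty S (ext A)) (D : pi_data B)
    (e : D = pi_form B) : abstraction_op D :=
  fun b => exist (is_abstraction b)
    (elim (s := pi) (i := existT _ A B) e b)
    (elim_solves (s := pi) (i := existT _ A B) e b).

(* The weakened types are those given by the cleaving, and the Π-types are the
   chosen ones. *)
Record w_data_chosen (Γ : S) (A : ty S Γ) (B : ty S (ext A)) (D : w_data B) : Prop :=
  WDataChosen {
  wdc_fam : existT (fun W' : ty S (ext B) => tmap W' (w_ty D))
      (w_fam (w_ar D)) (w_arr (w_ar D))
    = existT _ (w_ty D).[disp A ∘ disp B] (lift (w_ty D) (disp A ∘ disp B));
  wdc_fun : w_fun (w_ar D) = pi_form (w_fam (w_ar D)) }.

Record w_problem_chosen (Γ : S) (A : ty S Γ) (B : ty S (ext A)) (D : w_data B)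
    (P : w_problem D) : Prop := WProblemChosen {
  wpc_dom : existT (fun B' : ty S (ext (pi_ty (w_fun (w_ar D)))) => tmap B' B)
      (w_dom P) (w_dom_arr P)
    = existT _ B.[disp (pi_ty (w_fun (w_ar D)))] (lift B (disp (pi_ty (w_fun (w_ar D)))));
  wpc_cod : existT (fun C' : ty S (ext (w_dom P)) => tmap C' (w_mot P))
      (w_cod P) (w_cod_arr P)
    = existT _ (w_mot P).[w_subterm D (w_dom_over P)]
        (lift (w_mot P) (w_subterm D (w_dom_over P)));
  wpc_hyp : w_hyp P = pi_form (w_cod P) }.

Record strictly_stable_W := StrictlyStableW {
  w_form : forall (Γ : S) (A : ty S Γ) (B : ty S (ext A)), w_data B;
  w_form_chosen : forall (Γ : S) (A : ty S Γ) (B : ty S (ext A)),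
    w_data_chosen (w_form B);
  w_form_reix : forall (Γ Δ : S) (σ : hom Δ Γ) (A : ty S Γ) (B : ty S (ext A)),
    w_form B.[qmap σ A] = w_data_reix (w_form B) σ;
  w_elim : forall (Γ : S) (A : ty S Γ) (B : ty S (ext A)) (D : w_data B),
    D = w_form B -> forall P : w_problem D, w_problem_chosen P -> section (w_mot P);
  w_elim_solves : forall (Γ : S) (A : ty S Γ) (B : ty S (ext A)) (D : w_data B)
    (e : D = w_form B) (P : w_problem D) (h : w_problem_chosen P),
    w_solves (pi_lam (wpc_hyp h)) (w_elim e h);
  w_elim_reix : forall (Γ Δ : S) (σ : hom Δ Γ) (A : ty S Γ) (B : ty S (ext A))
    (D : w_data B) (e : D = w_form B) (e' : w_data_reix D σ = w_form B.[qmap σ A])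
    (P : w_problem D) (h : w_problem_chosen P)
    (h' : w_problem_chosen (w_problem_reix P σ)),
    w_elim e' h' = reix_section (w_elim e h) (qmap σ (w_ty D)) }.

End StrictW.
End TypeFormers.

Arguments pi_class S : clear implicits.

Section SplitReplacement.
Context (S : compcat).

Record lu_ty (Γ : S) := LuTy {
  lu_base : S;
  lu_fam : ty S lu_base;
  lu_name : hom Γ lu_base }.

Definition lu_val (Γ : S) (A : lu_ty Γ) : ty S Γ := (lu_fam A).[lu_name A].

Definition lu_total : total_cat S :=
  {| Ty := lu_ty;
     tmap := fun Γ Δ A B => tmap (lu_val A) (lu_val B);
     tid := fun Γ A => tid (lu_val A);
     tcomp := fun Γ Δ Θ A B D g f => tcomp g f;
     tcomp_idl := fun Γ Δ A B f => tcomp_idl f;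
     tcomp_idr := fun Γ Δ A B f => tcomp_idr f;
     tcompA := fun Γ Δ Θ Ξ A B D E h g f => tcompA h g f;
     tover := fun Γ Δ A B f => tover f;
     over_id := fun Γ A => over_id (lu_val A);
     over_comp := fun Γ Δ Θ A B D g f => over_comp g f |}.

Definition lu_reix (Γ Δ : S) (A : lu_ty Γ) (σ : hom Δ Γ) : lu_ty Δ :=
  LuTy (lu_fam A) (lu_name A ∘ σ).

Lemma lu_lift_eq (Γ Δ : S) (A : lu_ty Γ) (σ : hom Δ Γ) :
  tover (lift (lu_fam A) (lu_name A ∘ σ)) = tover (lift (lu_fam A) (lu_name A)) ∘ σ.
Proof. by rewrite !over_lift. Qed.

(* The arrow E[n ∘ σ] -> E[n] over σ through which the lift of n ∘ σ factors. *)
Definition lu_lift (Γ Δ : S) (A : lu_ty Γ) (σ : hom Δ Γ) :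
    tmap (lu_val (lu_reix A σ)) (lu_val A) :=
  tfactor (lift_cartesian (lu_fam A) (lu_name A)) (lu_lift_eq A σ).

Lemma over_lu_lift (Γ Δ : S) (A : lu_ty Γ) (σ : hom Δ Γ) : tover (lu_lift A σ) = σ.
Proof. exact: over_tfactor. Qed.

Lemma lu_lift_cartesian (Γ Δ : S) (A : lu_ty Γ) (σ : hom Δ Γ) :
  is_cartesian (lu_lift A σ).
Proof. exact/tfactor_cartesian/lift_cartesian. Qed.

Lemma lu_cartesian (Γ Δ : S) (A : lu_ty Γ) (B : lu_ty Δ)
    (f : tmap (lu_val A) (lu_val B)) :
  is_cartesian (T := lu_total) (A := A) (B := B) f -> is_cartesian f.
Proof.
move=> hf0 Θ X g τ e.
have hf Ξ (Y : lu_ty Ξ) (h : tmap (lu_val Y) (lu_val B)) ρ : tover h = tover f ∘ ρ ->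
    exists! k : tmap (lu_val Y) (lu_val A), tover k = ρ /\ tcomp f k = h by exact: hf0.
pose X1 : lu_ty Θ := LuTy X (idm Θ).
pose i : tmap (lu_val X1) X := lift X (idm Θ).
have oi : tover i = idm Θ by exact: over_lift.
have ci : is_cartesian i := lift_cartesian X (idm Θ).
have ej : tover (tid X) = tover i ∘ idm Θ by rewrite over_id oi comp_idl.
pose j := tfactor ci ej.
have ij : tcomp i j = tid X := tfactorK _ _.
have oj : tover j = idm Θ := over_tfactor _ _.
have e1 : tover (tcomp g i) = tover f ∘ τ by rewrite over_comp oi comp_idr.
case: (hf Θ X1 (tcomp g i) τ e1) => k [[ok kK] uk].
exists (tcomp k j); split.
  split; first by rewrite over_comp oj comp_idr; exact: ok.
  by rewrite tcompA kK -tcompA ij tcomp_idr.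
move=> l [ol lK].
have -> : k = tcomp l i.
  apply: uk; split; first by rewrite over_comp ol oi comp_idr.
  by rewrite tcompA lK.
by rewrite -tcompA ij tcomp_idr.
Qed.

Definition split_replacement : compcat :=
  @CompCat S lu_total lu_reix lu_lift over_lu_lift
    (fun Γ Δ A σ Θ X => @lu_lift_cartesian Γ Δ A σ Θ (lu_val X))
    (fun Γ A => ext (lu_val A))
    (fun Γ A => disp (lu_val A))
    (fun Γ Δ A B f => emap (c := S) f)
    (fun Γ Δ A B f => disp_emap (c := S) f)
    (fun Γ A => emap_id (lu_val A))
    (fun Γ Δ Θ A B D g f => emap_comp (c := S) g f)
    (fun Γ Δ A B f hf => cartesian_pullback (lu_cartesian hf)).

End SplitReplacement.

(* A model of the type theory with the constructor [K], in the algebraic sense: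
   contexts are the objects of the base, context morphisms its arrows, types
   over Γ the objects of the fibre, terms the sections of display maps, and
   substitution the (strictly functorial) reindexing; the empty context is a
   terminal object, and the rules of [K] are interpreted by operations that
   commute with substitution. *)
Definition models_with (S : compcat) (K : type_former S) : Prop :=
  [/\ is_full S, is_split S, has_terminal S & inhabited (strictly_stable K)].

Definition models_with_W (S : compcat) : Prop :=
  [/\ is_full S, is_split S, has_terminal S
    & exists pi : strictly_stable (pi_former S), inhabited (strictly_stable_W pi)].

(* Main.v *)
(* Every type of the split replacement is, in exactly one way, the chosen
   reindexing of a generic type along its name.  Hence each input of a former is
   a reindexing of a generic input along a unique map, and (LF) does the same for
   elimination problems: dependent exponentials represent the names of motives
   and the case maps.  Weak stability gives data for the generic input and a
   solution of the generic problem over them; pulling these back along the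
   classifying maps gives operations that commute with reindexing, because the
   classifying map of a reindexing is the composite, by uniqueness.  Equations
   between types are handled by comparing canonical cartesian arrows into the
   generic objects, so that no transport is needed. *)
Require Import Defs.
From Stdlib Require Import ssreflect ssrfun ssrbool.
From Stdlib Require Import ClassicalEpsilon Classical FunctionalExtensionality Eqdep.

Set Implicit Arguments.
Unset Strict Implicit.
Unset Printing Implicit Defensive.

(** The replacement plays a small part: the generic argument works in any split [S] with (LF) and
    local universes. What has to cross from [C] to its replacement is weak stability, and it does so
    because a type of the replacement has the comprehension of its value. Elimination problems there
    are problems of [C], up to comparison isomorphisms such as the one from E[id] to E. The second
    obstacle is that weak stability speaks only of the reindexings given by the cleaving, whereas
    classifying maps produce other pullbacks. Elimination properties are therefore restated for
    arbitrary pullback squares or cartesian arrows ([shape_pull], [app_compat], [w_map]) and shown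
    to be invariant under isomorphism over the base. Five constructors share one argument, their
    eliminators being dependent liftings against the constructors. Π-types stand apart, having
    sections to abstract instead of motives. So do W-types: their recursive step contains Π-types,
    and their computation rule a λ-abstraction that, without η, is not determined by the body and
    has to be tracked. *)

Lemma sig_ext (A : Type) (P : A -> Prop) (x y : {a : A | P a}) : sval x = sval y -> x = y.
Proof.
case: x => x hx; case: y => y hy /= e; case: y / e hy => hy.
by rewrite (proof_irrelevance _ hx hy).
Qed.

(** * Pullbacks and classifying maps *)

Section Pullbacks.
Context {C : category}.

Lemma pullback_sym (Q X Y Z : C) (p1 : hom Q X) (p2 : hom Q Y) (f : hom X Z) (g : hom Y Z) :
  is_pullback p1 p2 f g -> is_pullback p2 p1 g f.
Proof.
move=> [e h]; split; first by rewrite e.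
move=> W u v euv; case: (h W v u (esym euv)) => w [[w1 w2] uw].
by exists w; split=> // w' [w1' w2']; apply: uw.
Qed.

Lemma pullback_ext (Q X Y Z : C) (p1 : hom Q X) (p2 : hom Q Y) (f : hom X Z) (g : hom Y Z)
    (pb : is_pullback p1 p2 f g) (W : C) (w w' : hom W Q) :
  p1 ∘ w = p1 ∘ w' -> p2 ∘ w = p2 ∘ w' -> w = w'.
Proof.
move=> e1 e2; case: pb => sq up.
have e : f ∘ (p1 ∘ w') = g ∘ (p2 ∘ w') by rewrite !mcompA sq.
case: (up _ _ _ e) => w0 [_ uniq].
by rewrite -(uniq w (conj e1 e2)) -(uniq w' (conj erefl erefl)).
Qed.

Lemma pullback_pair (Q X Y Z : C) (p1 : hom Q X) (p2 : hom Q Y) (f : hom X Z) (g : hom Y Z)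
    (pb : is_pullback p1 p2 f g) (W : C) (u : hom W X) (v : hom W Y) :
  f ∘ u = g ∘ v -> exists w, p1 ∘ w = u /\ p2 ∘ w = v.
Proof. by case: pb => _ up /up [w [h _]]; exists w. Qed.

Lemma pullback_paste (A B D X Y Z : C) (p : hom A B) (q : hom B D)
    (l : hom A X) (m : hom B Y) (r : hom D Z) (f : hom X Y) (g : hom Y Z) :
  is_pullback q m r g -> is_pullback p l m f -> is_pullback (q ∘ p) l r (g ∘ f).
Proof.
move=> pq pp; have [sq _] := pq; have [sp _] := pp; split.
  by rewrite mcompA sq -!mcompA sp.
move=> W u v e; rewrite -mcompA in e.
have [w [w1 w2]] := pullback_pair pq e.
have [k [k1 k2]] := pullback_pair pp w2.
exists k; split; first by split=> //; rewrite -mcompA k1.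
move=> k' [k1' k2']; apply: (pullback_ext pp); last by rewrite k2.
apply: (pullback_ext pq); first by rewrite k1 w1 -k1' mcompA.
by rewrite !mcompA sp -!mcompA k2' k2.
Qed.

Lemma pullback_cancel (A B D X Y Z : C) (p : hom A B) (q : hom B D)
    (l : hom A X) (m : hom B Y) (r : hom D Z) (f : hom X Y) (g : hom Y Z) :
  is_pullback q m r g -> m ∘ p = f ∘ l -> is_pullback (q ∘ p) l r (g ∘ f) ->
  is_pullback p l m f.
Proof.
move=> pq sp pp; have [sq _] := pq; split=> // W u v e.
have e' : r ∘ (q ∘ u) = (g ∘ f) ∘ v by rewrite mcompA sq -!mcompA e.
have [k [k1 k2]] := pullback_pair pp e'.
exists k; split.
  split=> //; apply: (pullback_ext pq); first by rewrite mcompA.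
  by rewrite mcompA sp -mcompA k2 e.
move=> k' [k1' k2']; apply: (pullback_ext pp); last by rewrite k2.
by rewrite k1 -k1' mcompA.
Qed.

Definition is_iso (X Y : C) (f : hom X Y) : Prop :=
  exists g : hom Y X, g ∘ f = idm X /\ f ∘ g = idm Y.

Lemma pullback_iso (Q X Y Z : C) (p1 : hom Q X) (p2 : hom Q Y) (f : hom X Z) (g : hom Y Z) :
  is_pullback p1 p2 f g -> is_iso g -> is_iso p1.
Proof.
move=> pb [g' [g1 g2]]; have [sq _] := pb.
have e : f ∘ idm X = g ∘ (g' ∘ f) by rewrite mcompA g2 comp_idl comp_idr.
have [k [k1 k2]] := pullback_pair pb e.
exists k; split=> //; apply: (pullback_ext pb).
  by rewrite mcompA k1 comp_idl comp_idr.
by rewrite mcompA k2 -mcompA sq mcompA g1 comp_idl comp_idr.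
Qed.

Lemma iso_pullback (X Y Z W : C) (f : hom X Z) (t : hom Y X) (l : hom Y W) (g : hom W Z) :
  is_iso t -> is_iso g -> f ∘ t = g ∘ l -> is_pullback t l f g.
Proof.
move=> [t' [t1 t2]] [g' [g1 g2]] sq; split=> // A u v e.
exists (t' ∘ u); split.
  split; first by rewrite mcompA t2 comp_idl.
  have -> : v = g' ∘ (f ∘ u) by rewrite e mcompA g1 comp_idl.
  rewrite -[u in RHS]comp_idl -t2 -[in RHS]mcompA [f ∘ _]mcompA sq.
  by rewrite -!mcompA [g' ∘ _]mcompA g1 comp_idl.
by move=> w [<- _]; rewrite mcompA t1 comp_idl.
Qed.

Lemma iso_id (X : C) : is_iso (idm X).
Proof. by exists (idm X); rewrite !comp_idl. Qed.

Lemma iso_epi (X Y Z : C) (f : hom X Y) (u v : hom Y Z) : is_iso f -> u ∘ f = v ∘ f -> u = v.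
Proof.
by move=> [f' [_ f2]] e; rewrite -[u]comp_idr -[v]comp_idr -f2 !mcompA e.
Qed.

(* [e] is the generic section of [g] over the pullbacks of [f]: every section
   over the pullback along [h] is a restriction of [e], along a unique map. *)
Definition is_classifier (X Y Z : C) (f : hom Y X) (g : hom Z Y) (U : C) (u : hom U X)
    (Q : C) (p1 : hom Q U) (p2 : hom Q Y) (e : hom Q Z) : Prop :=
  [/\ is_pullback p1 p2 u f, g ∘ e = p2 &
    forall (W : C) (h : hom W X) (Q' : C) (q1 : hom Q' W) (q2 : hom Q' Y),
      is_pullback q1 q2 h f -> forall z : hom Q' Z, g ∘ z = q2 ->
      exists! t : hom W U, u ∘ t = h /\
        forall t' : hom Q' Q, p1 ∘ t' = t ∘ q1 -> p2 ∘ t' = q2 -> e ∘ t' = z].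

(** Yoneda: the generic section is the transpose of the identity of the exponential, and by
    naturality the transpose of any [t] is a restriction of it. *)
Lemma dep_exponential_classifier (X Y Z : C) (f : hom Y X) (g : hom Z Y)
    (E : dep_exponential f g) (Q : C) (p1 : hom Q (de_ob E)) (p2 : hom Q Y) :
  is_pullback p1 p2 (de_map E) f -> exists e, is_classifier f g (de_map E) p1 p2 e.
Proof.
move=> pb; pose i : slice_hom (de_map E) (de_map E) := exist _ (idm _) (comp_idr _).
exists (sval (de_transpose pb i)); split=> //; first exact: (proj2_sig (de_transpose pb i)).
move=> W h Q' q1 q2 pb' z ez.
have key (t : slice_hom h (de_map E)) (t' : hom Q' Q) :
    p1 ∘ t' = sval t ∘ q1 -> p2 ∘ t' = q2 ->
    sval (de_transpose pb' t) = sval (de_transpose pb i) ∘ t'.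
  move=> e1 e2.
  apply: (de_natural pb pb' (proj2_sig t) e1 e2).
  by rewrite /= comp_idl.
have [inv K1 K2] := de_bijective E pb'.
pose zs : slice_hom q2 g := exist _ z ez.
exists (sval (inv zs)); split.
  split; first exact: (proj2_sig (inv zs)).
  by move=> t' e1 e2; rewrite -(key _ _ e1 e2) K2.
move=> t [et ht]; pose ts : slice_hom h (de_map E) := exist _ t et.
suff -> : zs = de_transpose pb' ts by rewrite K1.
apply: sig_ext => /=.
have e : de_map E ∘ (t ∘ q1) = f ∘ q2 by rewrite mcompA et (proj1 pb').
have [t' [e1 e2]] := pullback_pair pb e.
by rewrite (key ts t' e1 e2) (ht t' e1 e2).
Qed.

(** (LF) is silent about isomorphisms. Along one, however, pullbacks are isomorphisms too, so a
    section over the pullback of [W] amounts to a map from [W] to [Z], and [Z] itself is the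
    representing object. *)
Lemma iso_classifier (X Y Z : C) (f : hom Y X) (g : hom Z Y) :
  is_iso f -> is_classifier f g (f ∘ g) (idm Z) g (idm Z).
Proof.
move=> hf; have [f' [f1 f2]] := hf; split; last 1 first.
- move=> W h Q' q1 q2 pb z ez.
  have [q1' [k1 k2]] : is_iso q1 by apply: pullback_iso pb hf.
  exists (z ∘ q1'); split.
    split; first by rewrite mcompA -(mcompA f) ez -(proj1 pb) -mcompA k2 comp_idr.
    by move=> t'; rewrite -mcompA k1 comp_idl comp_idr => ->.
  move=> t [et /(_ (t ∘ q1))]; rewrite comp_idl => <- //.
    by rewrite -[RHS]comp_idl -f1 -[in RHS]mcompA -(proj1 pb) -et !mcompA f1 comp_idl.
  by rewrite -mcompA k2 comp_idr.
- by apply: iso_pullback hf _; [exact: iso_id|rewrite comp_idr].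
- by rewrite comp_idr.
Qed.

End Pullbacks.

(** * Display maps and their dependent exponentials *)

Section Displays.
Context {S : compcat}.

Lemma reix_pullback (Γ Δ : S) (A : ty S Γ) (σ : hom Δ Γ) :
  is_pullback (qmap σ A) (disp A.[σ]) (disp A) σ.
Proof. by have := cartesian_pullback (lift_cartesian A σ); rewrite over_lift. Qed.

Lemma cart_pullback (Γ Δ : S) (A : ty S Γ) (B : ty S Δ) (f : tmap A B) (σ : hom Γ Δ) :
  is_cartesian f -> tover f = σ -> is_pullback (emap f) (disp A) (disp B) σ.
Proof. by move=> hf <-; apply: cartesian_pullback. Qed.

Lemma display_pullback (X Y W : S) (f : hom X Y) (u : hom W Y) : is_display f ->
  exists (Q : S) (p1 : hom Q X) (p2 : hom Q W), is_pullback p1 p2 f u /\ is_display p2.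
Proof.
move=> hf; elim: hf W u => {X Y f} [Γ A|X Y Z g f _ IHg _ IHf] W u.
  exists (ext A.[u]), (qmap u A), (disp A.[u]).
  by split; [exact: reix_pullback|exact: display_disp].
have [Q [p1 [p2 [pb d]]]] := IHg W u.
have [Q' [p1' [p2' [pb' d']]]] := IHf Q p1.
exists Q', p1', (p2 ∘ p2'); split; last exact: display_comp.
by apply/pullback_sym/(pullback_paste (pullback_sym pb) (pullback_sym pb')).
Qed.

(* The maps along which (LF) provides dependent exponentials; isomorphisms are
   added for the unit type, whose constructor has the identity as arity. *)
Definition tame (X Y : S) (f : hom X Y) : Prop := is_display f \/ is_iso f.

Lemma tame_pullback (X Y W : S) (f : hom X Y) (u : hom W Y) : tame f ->
  exists (Q : S) (p1 : hom Q X) (p2 : hom Q W), is_pullback p1 p2 f u /\ tame p2.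
Proof.
case=> [/(display_pullback u) [Q [p1 [p2 [pb d]]]]|[f' [f1 f2]]].
  by exists Q, p1, p2; split=> //; left.
exists W, (f' ∘ u), (idm W); split; last by right; exact: iso_id.
apply/pullback_sym/iso_pullback; first exact: iso_id; first by exists f'.
by rewrite mcompA f2 comp_idl comp_idr.
Qed.

Lemma LF_classifier (X Y Z : S) (f : hom Y X) (g : hom Z Y) : condition_LF S ->
  tame f -> is_display g \/ is_display f /\ is_product_projection g ->
  exists (U : S) (u : hom U X), forall (Q : S) (p1 : hom Q U) (p2 : hom Q Y),
    is_pullback p1 p2 u f -> exists e, is_classifier f g u p1 p2 e.
Proof.
move=> [_ LF] hf hg.
have [[df dg]|hi] :
    (is_display f /\ (is_display g \/ is_product_projection g)) \/ is_iso f.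
  by case: hf; [left; case: hg => [|[]]; auto|right].
  have [E] := LF _ _ _ _ _ df dg.
  by exists (de_ob E), (de_map E) => Q p1 p2; apply: dep_exponential_classifier.
(* [iso_classifier] treats only the pullback with object [Z]. For any other [Q], the isomorphism
   [p1] from [Q] to [Z] serves as generic section. *)
exists Z, (f ∘ g) => Q p1 p2 pb.
have [pb0 _ cl] := iso_classifier g hi.
have [p1' [k1 k2]] := pullback_iso pb hi.
have ep : p2 = g ∘ p1.
  have [f' [f1 f2]] := hi.
  by rewrite -[p2]comp_idl -f1 -mcompA -(proj1 pb) !mcompA f1 comp_idl.
exists p1; split=> //.
move=> W h Q' q1 q2 pb' z ez; have [t [[t1 t2] ut]] := cl _ _ _ _ _ pb' z ez.
have ht (t0 : hom Q' Z) : idm Z ∘ t0 = t ∘ q1 -> g ∘ t0 = q2 -> t0 = z.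
  by move=> e1 e2; rewrite -(t2 t0 e1 e2) comp_idl.
exists t; split.
  by split=> // t' e1 e2; apply: ht; rewrite ?comp_idl // mcompA -ep.
move=> t3 [t4 t5]; apply: ut; split=> // t'; rewrite !comp_idl => e1 e2.
have k : p1 ∘ (p1' ∘ t') = t' by rewrite mcompA k2 comp_idl.
by rewrite -(t5 (p1' ∘ t')) ?k // ep -mcompA k.
Qed.

End Displays.

(* The cartesian arrows chosen by the cleaving.  In a split comprehension
   category they form a discrete fibration, so that working up to them replaces
   transports along the equations of splitness. *)
Inductive canon (S : compcat) (Δ : S) (B : ty S Δ) (Γ : S) :
    forall A : ty S Γ, tmap A B -> Prop :=
| canon_lift (σ : hom Γ Δ) : canon (lift B σ).

Section Canonical.
Context {S : compcat}.

Lemma canon_cart (Γ Δ : S) (A : ty S Γ) (B : ty S Δ) (f : tmap A B) :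
  canon f -> is_cartesian f.
Proof. by case=> σ; apply: lift_cartesian. Qed.

Lemma canon_sig (Γ Δ : S) (A : ty S Γ) (B : ty S Δ) (f : tmap A B) : canon f ->
  existT (fun A' => tmap A' B) A f = existT _ B.[tover f] (lift B (tover f)).
Proof. by case=> σ; rewrite over_lift. Qed.

Lemma sig_canon (Γ Δ : S) (A A' : ty S Γ) (B : ty S Δ) (f : tmap A B) (g : tmap A' B) :
  existT (fun A' => tmap A' B) A f = existT _ A' g -> canon g -> canon f.
Proof.
move=> e.
by have := f_equal (fun p : {A : ty S Γ & tmap A B} => canon (projT2 p)) e => /= ->.
Qed.

Lemma canon_sig_unique (Γ Δ : S) (A A' : ty S Γ) (B : ty S Δ) (f : tmap A B) (g : tmap A' B) :
  canon f -> canon g -> tover f = tover g ->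
  existT (fun A' => tmap A' B) A f = existT _ A' g.
Proof. by move=> /canon_sig -> /canon_sig -> ->. Qed.

Lemma canon_unique (Γ Δ : S) (A : ty S Γ) (B : ty S Δ) (f g : tmap A B) :
  canon f -> canon g -> tover f = tover g -> f = g.
Proof. move=> hf hg e; exact: (inj_pair2 _ (fun A' => tmap A' B) _ _ _ (canon_sig_unique hf hg e)). Qed.

(** Leibniz's principle for a type together with its arrow into [B]. It rests on [inj_pair2] and
    takes the place of a transport of [f] along [A = A']. *)
Lemma sig_tmap_ind (Γ Δ : S) (B : ty S Δ) (A A' : ty S Γ) (f : tmap A B) (g : tmap A' B)
    (P : forall A : ty S Γ, tmap A B -> Prop) :
  existT (fun A' => tmap A' B) A f = existT _ A' g -> P A' g -> P A f.
Proof.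
move=> e; have eA : A = A' := f_equal (@projT1 _ _) e.
by subst A'; rewrite (inj_pair2 _ (fun A' => tmap A' B) _ _ _ e).
Qed.

Context (Ssplit : is_split S).

Lemma canon_comp (Γ Δ Θ : S) (A : ty S Γ) (B : ty S Δ) (D : ty S Θ)
    (g : tmap B D) (f : tmap A B) : canon g -> canon f -> canon (tcomp g f).
Proof.
move=> hg hf; case: A f / hf => σ; case: B g / hg => τ.
by apply: sig_canon (canon_lift D (τ ∘ σ)); rewrite (proj2 Ssplit).
Qed.

(** By splitness, [tcomp g (lift B σ)] is canonical over the same map as [h], hence equal to it as a
    pair. So [A] may be taken to be [B.[σ]], and then [lift B σ] is the factor. *)
Lemma canon_factor (Γ Δ Θ : S) (A : ty S Γ) (B : ty S Δ) (D : ty S Θ)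
    (h : tmap A D) (g : tmap B D) (σ : hom Γ Δ) :
  canon h -> canon g -> tover h = tover g ∘ σ ->
  exists f : tmap A B, [/\ canon f, tover f = σ & tcomp g f = h].
Proof.
move=> hh hg e.
have : existT (fun A' => tmap A' D) A h = existT _ B.[σ] (tcomp g (lift B σ)).
  apply: canon_sig_unique => //; first exact: canon_comp hg (canon_lift _ _).
  by rewrite over_comp over_lift.
move/(sig_tmap_ind (P := fun A h => exists f : tmap A B,
  [/\ canon f, tover f = σ & tcomp g f = h])); apply; exists (lift B σ).
by split=> //; rewrite over_lift.
Qed.

Lemma canon_cancel (Γ Δ Θ : S) (A : ty S Γ) (B : ty S Δ) (D : ty S Θ)
    (g : tmap B D) (f : tmap A B) : canon g -> canon (tcomp g f) -> canon f.
Proof.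
move=> hg hgf; have [k [ck ok kK]] := canon_factor hgf hg (over_comp g f).
have [l [_ u]] := canon_cart hg (over_comp g f).
by rewrite -(u f) // (u k).
Qed.

End Canonical.

Lemma section_id (S : compcat) (Γ : S) (A : ty S Γ) (s : section A) :
  disp A ∘ sval s = idm Γ.
Proof. exact: (proj2_sig s). Qed.

Definition mk_section (S : compcat) (Γ : S) (A : ty S Γ) (s : hom Γ (ext A))
    (e : disp A ∘ s = idm Γ) : section A := exist _ s e.

Lemma cart_factor (S : compcat) (Γ Δ Θ : S) (A : ty S Γ) (B : ty S Δ) (D : ty S Θ)
    (h : tmap A D) (g : tmap B D) (σ : hom Γ Δ) :
  is_cartesian h -> is_cartesian g -> tover h = tover g ∘ σ ->
  exists f : tmap A B, [/\ is_cartesian f, tover f = σ & tcomp g f = h].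
Proof.
move=> hh hg e; exists (tfactor hg e).
by split; [exact: tfactor_cartesian|exact: over_tfactor|exact: tfactorK].
Qed.

Lemma dep_choice (J : Type) (P : J -> Type) (R : forall j, P j -> Prop) :
  (forall j, exists p, R j p) -> exists f : forall j, P j, forall j, R j (f j).
Proof.
move=> h; exists (fun j => sval (constructive_indefinite_description _ (h j))) => j.
exact: (proj2_sig (constructive_indefinite_description _ (h j))).
Qed.

(** * Lifting problems and their generic instances *)

(* A family of maps [sh_con] into a common object, all in the slice over [V]:
   the constructors of an inductive type, seen on comprehensions. *)
Record shape (S : category) (V : S) (J : Type) := Shape {
  sh_ob : S;
  sh_map : hom sh_ob V;
  sh_arg : J -> S;
  sh_con : forall j, hom (sh_arg j) sh_ob }.

Section Shapes.
Context {S : compcat}.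

(** The squares are asked to be pullbacks, with no cleaving involved, so that reindexings formed in
    different ways all qualify. *)
Definition shape_pull (V' V : S) (J : Type) (τ : hom V' V) (s' : shape V' J) (s : shape V J)
    (e : hom (sh_ob s') (sh_ob s)) (x : forall j, hom (sh_arg s' j) (sh_arg s j)) : Prop :=
  is_pullback e (sh_map s') (sh_map s) τ /\
  forall j, is_pullback (x j) (sh_map s' ∘ sh_con s' j) (sh_map s ∘ sh_con s j) τ /\
    e ∘ sh_con s' j = sh_con s j ∘ x j.

Definition shape_tame (V : S) (J : Type) (s : shape V J) : Prop :=
  is_display (sh_map s) /\ forall j, tame (sh_map s ∘ sh_con s j).

Lemma shape_pull_comp (V'' V' V : S) (J : Type) (τ : hom V' V) (σ : hom V'' V')
    (s'' : shape V'' J) (s' : shape V' J) (s : shape V J) e x e' x' :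
  @shape_pull _ _ _ τ s' s e x -> @shape_pull _ _ _ σ s'' s' e' x' ->
  shape_pull (τ ∘ σ) (e ∘ e') (fun j => x j ∘ x' j).
Proof.
move=> [h1 h2] [h1' h2']; split; first exact: pullback_paste h1 h1'.
move=> j; case: (h2 j) (h2' j) => [pb k] [pb' k'].
by split; [exact: pullback_paste pb pb'|rewrite -mcompA k' !mcompA k].
Qed.

Lemma shape_pull_factor (Γ V1 V : S) (J : Type) (τ : hom Γ V1) (u : hom V1 V)
    (s' : shape Γ J) (s1 : shape V1 J) (s : shape V J) e x e1 x1 :
  @shape_pull _ _ _ u s1 s e1 x1 -> @shape_pull _ _ _ (u ∘ τ) s' s e x ->
  exists e' x', [/\ @shape_pull _ _ _ τ s' s1 e' x', e1 ∘ e' = e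
    & forall j, x1 j ∘ x' j = x j].
Proof.
move=> [h1 h2] [h h'].
have [e' [k1 k2]] : exists e', e1 ∘ e' = e /\ sh_map s1 ∘ e' = τ ∘ sh_map s'.
  by apply: (pullback_pair h1); rewrite mcompA (proj1 h).
have /dep_choice [x' hx'] : forall j, exists x' : hom (sh_arg s' j) (sh_arg s1 j),
    x1 j ∘ x' = x j /\ (sh_map s1 ∘ sh_con s1 j) ∘ x' = τ ∘ (sh_map s' ∘ sh_con s' j).
  move=> j; apply: (pullback_pair (proj1 (h2 j))).
  by rewrite (proj1 (proj1 (h' j))) -mcompA.
exists e', x'; split=> //; last by move=> j; case: (hx' j).
split; first by apply: pullback_cancel h1 k2 _; rewrite k1.
move=> j; have [a b] := hx' j; split.
  by apply: pullback_cancel (proj1 (h2 j)) b _; rewrite a; case: (h' j).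
apply: (pullback_ext h1).
  by rewrite !mcompA k1 (proj2 (h2 j)) -mcompA a; case: (h' j).
by rewrite !mcompA k2 b mcompA.
Qed.

Lemma shape_pull_arg_ext (V' V : S) (J : Type) (τ : hom V' V) (s' : shape V' J)
    (s : shape V J) e x (j : J) (W : S) (w w' : hom W (sh_arg s' j)) :
  @shape_pull _ _ _ τ s' s e x -> x j ∘ w = x j ∘ w' ->
  sh_map s' ∘ sh_con s' j ∘ w = sh_map s' ∘ sh_con s' j ∘ w' -> w = w'.
Proof. by move=> [_ /(_ j) [pb _]]; exact: (pullback_ext pb). Qed.

Lemma shape_tame_pull (U V : S) (J : Type) (s : shape V J) (u : hom U V) : shape_tame s ->
  exists (s' : shape U J) e x, @shape_pull _ _ _ u s' s e x /\ shape_tame s'.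
Proof.
move=> [hE hX]; have [E [e [ε [pE dE]]]] := display_pullback u hE.
pose T j := {Q : S & {p : hom Q (sh_arg s j) & hom Q U}}.
have /(@dep_choice J T) [X hXX] : forall j, exists p : T j,
    is_pullback (projT1 (projT2 p)) (projT2 (projT2 p)) (sh_map s ∘ sh_con s j) u /\
    tame (projT2 (projT2 p)).
  move=> j; have [Q [p1 [p2 h]]] := tame_pullback u (hX j).
  by exists (existT _ Q (existT _ p1 p2)).
have /dep_choice [k hk] : forall j, exists k : hom (projT1 (X j)) E,
    e ∘ k = sh_con s j ∘ projT1 (projT2 (X j)) /\ ε ∘ k = projT2 (projT2 (X j)).
  move=> j; apply: (pullback_pair pE).
  by rewrite mcompA; case: (hXX j) => -[].
exists (Shape ε k), e, (fun j => projT1 (projT2 (X j))); split; split=> //= j.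
  by case: (hk j) => -> ->; case: (hXX j).
by case: (hk j) => _ ->; case: (hXX j).
Qed.

(* An elimination problem on a shape whose motive is the pullback of [T]
   along [n]. *)
Definition is_cone (V : S) (J : Type) (s : shape V J) (Θ : S) (T : ty S Θ)
    (n : hom (sh_ob s) Θ) (c : forall j, hom (sh_arg s j) (ext T)) : Prop :=
  forall j, disp T ∘ c j = n ∘ sh_con s j.

(** A representing object for the functor that sends [τ0] to the cones on the pullback of [s] along
    [τ0]; [gc_n] and [gc_c] form the universal cone. *)
Record gen_cone (V : S) (J : Type) (s : shape V J) (Θ : S) (T : ty S Θ) := GenCone {
  gc_ob : S;
  gc_map : hom gc_ob V;
  gc_shape : shape gc_ob J;
  gc_e : hom (sh_ob gc_shape) (sh_ob s);
  gc_x : forall j, hom (sh_arg gc_shape j) (sh_arg s j);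
  gc_pull : shape_pull gc_map gc_e gc_x;
  gc_n : hom (sh_ob gc_shape) Θ;
  gc_c : forall j, hom (sh_arg gc_shape j) (ext T);
  gc_cone : is_cone gc_n gc_c;
  gc_univ : forall (Γ : S) (τ0 : hom Γ V) (s' : shape Γ J) e x
    (n : hom (sh_ob s') Θ) (c : forall j, hom (sh_arg s' j) (ext T)),
    @shape_pull _ _ _ τ0 s' s e x -> is_cone n c ->
    exists! τ : hom Γ gc_ob, gc_map ∘ τ = τ0 /\
      exists e' x', [/\ @shape_pull _ _ _ τ s' gc_shape e' x', gc_e ∘ e' = e,
        forall j, gc_x j ∘ x' j = x j, gc_n ∘ e' = n & forall j, gc_c j ∘ x' j = c j] }.

Context (LF : condition_LF S).

(** Without constructors a cone is only the name of a motive, a map into [Θ]. Such maps are the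
    sections of the product projection from [sh_ob s × Θ], which (LF) exponentiates along the
    display map [sh_map s]. *)
Lemma gen_cone0 (V : S) (s : shape V Empty_set) (Θ : S) (T : ty S Θ) :
  shape_tame s -> inhabited (gen_cone s T).
Proof.
move=> hs; have [hE _] := hs; have [[_ prod] _] := LF.
have [Z [p [q pq]]] := prod (sh_ob s) Θ.
have [U [u cl]] := LF_classifier (g := p) LF (or_introl hE)
  (or_intror (conj hE (ex_intro _ _ (ex_intro _ _ pq)))).
have [s1 [e1 [x1 [h1 t1]]]] := shape_tame_pull u hs.
have [e [_ pe cle]] := cl _ _ _ (pullback_sym (proj1 h1)).
exists; apply: (@GenCone _ _ s Θ T U u s1 e1 x1 h1 (q ∘ e)
  (fun j => match j with end)); first by case.
move=> Γ τ0 s' e' x' n c pb _.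
have [z [[z1 z2] uz]] := pq _ e' n.
have [τ [[τ1 τ2] uτ]] := cle _ _ _ _ _ (pullback_sym (proj1 pb)) z z1.
exists τ; split.
  split=> //; rewrite -τ1 in pb.
  have [e'' [x'' [pb' k1 k2]]] := shape_pull_factor h1 pb.
  exists e'', x''; split=> //.
  by rewrite -mcompA (τ2 _ _ k1) // (proj1 (proj1 pb')).
move=> τ' [τ1' [e'' [x'' [pb' k1 k2 k3 _]]]]; apply: uτ; split=> // t' t1' t2'.
have -> : t' = e''.
  by apply: (pullback_ext (proj1 h1)); rewrite ?k1 // t1' -(proj1 (proj1 pb')).
by symmetry; apply: uz; rewrite !mcompA pe k1 k3.
Qed.

Definition shape_some (V : S) (J : Type) (s : shape V (option J)) : shape V J :=
  Shape (sh_map s) (fun j => sh_con s (Some j)).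

Arguments shape_some {V J} s /.

Lemma shape_pull_some (V' V : S) (J : Type) (τ : hom V' V) (s' : shape V' (option J))
    (s : shape V (option J)) e x :
  @shape_pull _ _ _ τ s' s e x ->
  @shape_pull _ _ _ τ (shape_some s') (shape_some s) e (fun j => x (Some j)).
Proof. by move=> [h1 h2]; split=> // j; exact: (h2 (Some j)). Qed.

(** A further constructor adds one case map to the generic cone of the others. Once the motive is
    named, this map is a section of the motive pulled back along that constructor, so a second
    exponential, along the argument of the constructor, represents it. *)
Lemma gen_cone_option (V : S) (J : Type) (s : shape V (option J)) (Θ : S) (T : ty S Θ) :
  shape_tame s -> inhabited (gen_cone (shape_some s) T) -> inhabited (gen_cone s T).
Proof.
move=> hs [[U1 u1 s1 e1 x1 pb1 n1 c1 cone1 univ1]].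
have [Q1 [p1 [p2 [pbQ tQ]]]] := tame_pullback u1 (proj2 hs None).
(* [k1] is the constructor [None] over [U1], which [s1] does not record because it is a shape on
   [J]. *)
have [k1 [k1e k1ε]] : exists k1, e1 ∘ k1 = sh_con s None ∘ p1 /\ sh_map s1 ∘ k1 = p2.
  by apply: (pullback_pair (proj1 pb1)); rewrite mcompA; case: pbQ.
have compat Γ (τ1 : hom Γ U1) (s' : shape Γ (option J)) e' x (y : hom (sh_arg s' None) Q1) :
    @shape_pull _ _ _ (u1 ∘ τ1) s' s (e1 ∘ e') x ->
    sh_map s1 ∘ e' = τ1 ∘ sh_map s' -> p1 ∘ y = x None ->
    p2 ∘ y = τ1 ∘ (sh_map s' ∘ sh_con s' None) -> e' ∘ sh_con s' None = k1 ∘ y.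
  move=> pb a b d; apply: (pullback_ext (proj1 pb1)).
    by rewrite !mcompA k1e -[in RHS]mcompA b; case: (proj2 pb None).
  by rewrite !mcompA k1ε d a mcompA.
have [U2 [u2 cl]] := LF_classifier (g := disp T.[n1 ∘ k1]) LF tQ
  (or_introl (display_disp _)).
have [s2 [e2 [x2 [pb2 _]]]] := shape_tame_pull (u1 ∘ u2) hs.
have [e2' [x2' [pb2' e2K x2K]]] := shape_pull_factor pb1 (shape_pull_some pb2).
have getY Γ (τ1 : hom Γ U1) (s' : shape Γ (option J)) e x :
    @shape_pull _ _ _ (u1 ∘ τ1) s' s e x ->
    exists y, [/\ p1 ∘ y = x None, p2 ∘ y = τ1 ∘ (sh_map s' ∘ sh_con s' None)
      & is_pullback y (sh_map s' ∘ sh_con s' None) p2 τ1].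
  move=> pb; have [pbx _] := proj2 pb None.
  have [y [y1 y2]] : exists y, p1 ∘ y = x None /\
      p2 ∘ y = τ1 ∘ (sh_map s' ∘ sh_con s' None).
    by apply: (pullback_pair pbQ); rewrite (proj1 pbx) -mcompA.
  by exists y; split=> //; apply: pullback_cancel pbQ y2 _; rewrite y1.
have [y [y1 y2 pby]] := getY _ _ _ _ _ pb2.
have [e [_ ey cle]] := cl _ _ _ (pullback_sym pby).
have ky : e2' ∘ sh_con s2 None = k1 ∘ y.
  by apply: compat y1 y2; [rewrite e2K; exact: pb2|case: pb2' => -[]].
pose c2 j : hom (sh_arg s2 j) (ext T) :=
  match j with Some j => c1 j ∘ x2' j | None => qmap (n1 ∘ k1) T ∘ e end.
have cone2 : is_cone (s := s2) (T := T) (n1 ∘ e2') c2.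
  case=> [j|] /=.
    by rewrite mcompA (cone1 j) -!mcompA -(proj2 (proj2 pb2' j)).
  by rewrite mcompA disp_q -!mcompA ey ky.
exists; apply: (@GenCone _ _ s Θ T U2 (u1 ∘ u2) s2 e2 x2 pb2 (n1 ∘ e2') c2 cone2).
move=> Γ τ0 s' e' x n c pb cone.
have [τ1 [[τ1e [f [x' [pb' fe x'K nf cx']]]] uτ1]] :=
  univ1 _ _ (shape_some s') _ _ n (fun j => c (Some j)) (shape_pull_some pb) (fun j => cone (Some j)).
rewrite -τ1e in pb uτ1 *; rewrite -fe in pb.
have [y' [y1' y2' pby']] := getY _ _ _ _ _ pb.
have ky' : f ∘ sh_con s' None = k1 ∘ y' by apply: compat pb _ y1' y2'; case: pb' => -[].
have ez : disp T ∘ c None = n1 ∘ k1 ∘ y' by rewrite (cone None) -nf -!mcompA ky'.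
have [τ2 [[τ2e τ2z] uτ2]] := cle _ _ _ _ _ (pullback_sym pby') (rpair ez) (disp_rpair _).
exists τ2; split; last first.
  move=> τ [τe [f2 [x2'' [pbf f2K x2''K nf2 cx2]]]].
  (* Composed with [u2], the competitor [τ] classifies the cone without [None]; this leaves only the
     second exponential to compare. *)
  have eτ1 : τ1 = u2 ∘ τ.
    apply: uτ1; split; first by rewrite mcompA.
    exists (e2' ∘ f2), (fun j => x2' j ∘ x2'' (Some j)).
    have h := shape_pull_comp pb2' (shape_pull_some pbf).
    split=> //; try move=> j; rewrite mcompA ?e2K ?x2K ?x2''K //.
    exact: (cx2 (Some j)).
  apply: uτ2; split=> // t' t1' t2'.
  have -> : t' = x2'' None.
    apply: (shape_pull_arg_ext pb2).
      by rewrite x2''K -y1 -mcompA t2' y1'.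
    by rewrite t1'; case: (proj2 pbf None) => -[].
  apply: reix_hom_ext.
    by rewrite q_rpair mcompA; exact: (cx2 None).
  rewrite disp_rpair mcompA ey.
  apply: (pullback_ext pbQ); first by rewrite mcompA y1 x2''K y1'.
  by rewrite mcompA y2 -mcompA (proj1 (proj1 (proj2 pbf None))) mcompA -eτ1 y2'.
split; first by rewrite -mcompA τ2e.
rewrite -τ2e mcompA in pb.
have [f2 [x2'' [pbf f2K x2''K]]] := shape_pull_factor pb2 pb.
exists f2, x2''; split=> //.
- by rewrite f2K fe.
- rewrite -nf -mcompA; congr (_ ∘ _); apply: (pullback_ext (proj1 pb1)).
    by rewrite mcompA e2K f2K.
  by rewrite mcompA (proj1 (proj1 pb2')) -mcompA (proj1 (proj1 pbf)) mcompA τ2e;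
    case: pb' => -[].
- case=> [j|] /=.
    rewrite -cx' -mcompA; congr (_ ∘ _); apply: (shape_pull_arg_ext pb1).
      by rewrite mcompA x2K x2''K x'K.
    rewrite mcompA (proj1 (proj1 (proj2 pb2' j))) -[in LHS]mcompA /=.
    rewrite (proj1 (proj1 (proj2 pbf (Some j)))) mcompA τ2e.
    by rewrite (proj1 (proj1 (proj2 pb' j))).
  rewrite -mcompA τ2z ?q_rpair //; first by case: (proj2 pbf None) => -[].
  apply: (pullback_ext pbQ); first by rewrite mcompA y1 x2''K y1'.
  by rewrite mcompA y2 -mcompA (proj1 (proj1 (proj2 pbf None))) mcompA τ2e y2'.
Qed.

End Shapes.

(** * Lifting properties and natural choices of solutions *)

Section Liftings.
Context {S : compcat}.

Definition lifting (V : S) (J : Type) (s : shape V J) : Prop :=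
  forall (M : ty S (sh_ob s)) (c : forall j, hom (sh_arg s j) (ext M)),
    (forall j, disp M ∘ c j = sh_con s j) ->
    exists r : section M, forall j, sval r ∘ sh_con s j = c j.

Definition stably_lifting (V : S) (J : Type) (s : shape V J) : Prop :=
  forall (Γ : S) (τ : hom Γ V) (s' : shape Γ J) e x,
    @shape_pull _ _ _ _ τ s' s e x -> lifting s'.

(** Two pullbacks along the same map are isomorphic. A motive on [s2] is reindexed along the inverse
    [e'], the problem is solved on [s1], and the section is conjugated back. *)
Lemma lifting_transfer (Γ V : S) (J : Type) (τ : hom Γ V) (s : shape V J)
    (s1 s2 : shape Γ J) e1 x1 e2 x2 :
  @shape_pull _ _ _ _ τ s1 s e1 x1 -> @shape_pull _ _ _ _ τ s2 s e2 x2 ->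
  lifting s1 -> lifting s2.
Proof.
move=> h1; rewrite -[τ in shape_pull τ _ _](comp_idr τ).
move/(shape_pull_factor h1) => [e [x [[pe px] _ _]]] l1 M c hc.
have [e' [ee' e'e]] : is_iso e := pullback_iso pe (iso_id _).
have isox j : exists x', x' ∘ x j = idm _ /\ x j ∘ x' = idm _.
  exact: pullback_iso (proj1 (px j)) (iso_id _).
case/dep_choice: isox => x' hx'.
have conE j : sh_con s2 j ∘ x' j = e' ∘ sh_con s1 j.
  rewrite -[RHS]comp_idr -(proj2 (hx' j)) mcompA -(mcompA e') -(proj2 (px j)).
  by rewrite !mcompA ee' comp_idl.
have ec j : disp M ∘ (c j ∘ x' j) = e' ∘ sh_con s1 j by rewrite mcompA hc conE.
have [r hr] := l1 M.[e'] (fun j => rpair (ec j)) (fun j => disp_rpair (ec j)).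
have er : disp M ∘ (qmap e' M ∘ sval r ∘ e) = idm _.
  by rewrite !mcompA disp_q -(mcompA e') section_id comp_idr.
exists (mk_section er) => j /=.
rewrite -mcompA (proj2 (px j)) -mcompA [sval r ∘ _]mcompA hr.
by rewrite mcompA q_rpair -mcompA (proj1 (hx' j)) comp_idr.
Qed.

Lemma stably_lifting_pull (Γ V : S) (J : Type) (τ : hom Γ V) (s : shape V J)
    (s' : shape Γ J) e x :
  @shape_pull _ _ _ _ τ s' s e x -> stably_lifting s -> stably_lifting s'.
Proof.
move=> h l Δ σ s'' e' x' h'; exact: l (shape_pull_comp h h').
Qed.

(* A choice of solutions [ρ] of the elimination problems [(n, c)] with motive
   in [T] on the pullbacks of [s], natural in the pullback. *)
Record filler (V : S) (J : Type) (s : shape V J) (Θ : S) (T : ty S Θ) := Filler {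
  fill : forall (Γ : S) (τ : hom Γ V) (s' : shape Γ J) (e : hom (sh_ob s') (sh_ob s))
    (x : forall j, hom (sh_arg s' j) (sh_arg s j)) (n : hom (sh_ob s') Θ)
    (c : forall j, hom (sh_arg s' j) (ext T)) (ρ : hom (sh_ob s') (ext T)), Prop;
  fill_ex : forall (Γ : S) (τ : hom Γ V) (s' : shape Γ J) e x n c,
    @shape_pull _ _ _ _ τ s' s e x -> is_cone (T := T) n c ->
    exists! ρ, fill τ e x n c ρ;
  fill_sound : forall (Γ : S) (τ : hom Γ V) (s' : shape Γ J) e x n c ρ,
    @fill Γ τ s' e x n c ρ -> disp T ∘ ρ = n /\ forall j, ρ ∘ sh_con s' j = c j;
  fill_reix : forall (Δ Γ : S) (τ : hom Γ V) (σ : hom Δ Γ) (s' : shape Γ J)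
      (s'' : shape Δ J) e x n c ρ e' x',
    @fill Γ τ s' e x n c ρ -> @shape_pull _ _ _ _ σ s'' s' e' x' ->
    fill (τ ∘ σ) (e ∘ e') (fun j => x j ∘ x' j) (n ∘ e') (fun j => c j ∘ x' j) (ρ ∘ e') }.

(** Only the generic cone is solved; every other solution is the restriction of that one along its
    classifying map. Naturality is then composition of classifying maps, and uniqueness of [ρ] is
    uniqueness of the classifying map. *)
Lemma filler_exists (V : S) (J : Type) (s : shape V J) (Θ : S) (T : ty S Θ) :
  gen_cone s T -> stably_lifting s -> inhabited (filler s T).
Proof.
case=> U u s1 e1 x1 pb1 n1 c1 cone1 univ1 l.
have [r hr] := l _ _ _ _ _ pb1 T.[n1] (fun j => rpair (cone1 j)) (fun j => disp_rpair (cone1 j)).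
pose F Γ (τ0 : hom Γ V) (s' : shape Γ J) e x n c (ρ : hom (sh_ob s') (ext T)) :=
  exists (τ : hom Γ U) e' x', [/\ u ∘ τ = τ0, @shape_pull _ _ _ _ τ s' s1 e' x' &
    [/\ e1 ∘ e' = e, forall j, x1 j ∘ x' j = x j, n1 ∘ e' = n, forall j, c1 j ∘ x' j = c j
      & ρ = qmap n1 T ∘ sval r ∘ e']].
exists; apply: (@Filler _ _ _ _ _ F); last 1 first.
- move=> Δ Γ τ0 σ s' s'' e x n c ρ e' x' [τ [e0 [x0 [eτ pb [k1 k2 k3 k4 ->]]]]] pb'.
  exists (τ ∘ σ), (e0 ∘ e'), (fun j => x0 j ∘ x' j).
  split; [by rewrite mcompA eτ|exact: shape_pull_comp pb pb'|].
  by split=> [|j||j|]; rewrite mcompA ?k1 ?k2 ?k3 ?k4.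
- move=> Γ τ0 s' e x n c pb cone.
  have [τ [[eτ [e' [x' [pb' k1 k2 k3 k4]]]] uτ]] := univ1 _ _ _ _ _ _ _ pb cone.
  exists (qmap n1 T ∘ sval r ∘ e'); split; first by exists τ, e', x'.
  move=> ρ' [τ' [e'' [x'' [eτ' pb'' [k1' k2' k3' k4' ->]]]]].
  congr (_ ∘ _); apply: (pullback_ext (proj1 pb1)); first by rewrite k1'.
  rewrite (proj1 (proj1 pb')) (proj1 (proj1 pb'')); congr (_ ∘ _).
  by apply: uτ; split=> //; exists e'', x''.
- move=> Γ τ0 s' e x n c ρ [τ [e' [x' [_ pb' [_ _ k3 k4 ->]]]]]; split.
    by rewrite !mcompA disp_q -(mcompA n1) section_id comp_idr.
  move=> j; rewrite -mcompA (proj2 (proj2 pb' j)) -mcompA [sval r ∘ _]mcompA hr.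
  by rewrite mcompA q_rpair k4.
Qed.

End Liftings.

Section Relations.
Context {S : compcat} (K : type_former S).

(* Unique existence replaces choice, so that stability need only be checked on
   the specifications of the data and of the solutions. *)
Lemma strictly_stable_of_relations
    (F : forall (Γ : S) (i : input K Γ), data i -> Prop)
    (E : forall (Γ : S) (i : input K Γ) (D : data i) (P : problem D), candidate P -> Prop) :
  (forall Γ (i : input K Γ), exists! D, F Γ i D) ->
  (forall Γ Δ (σ : hom Δ Γ) (i : input K Γ) (D : data i), F Γ i D ->
    F Δ (input_reix i σ) (data_reix D σ)) ->
  (forall Γ (i : input K Γ) (D : data i) (P : problem D), F Γ i D -> exists! s, E Γ i D P s) ->
  (forall Γ (i : input K Γ) (D : data i) (P : problem D) s, F Γ i D -> E Γ i D P s ->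
    solves s) ->
  (forall Γ Δ (σ : hom Δ Γ) (i : input K Γ) (D : data i) (P : problem D) s,
    F Γ i D -> E Γ i D P s ->
    E Δ (input_reix i σ) (data_reix D σ) (problem_reix P σ) (candidate_reix s σ)) ->
  exists st : strictly_stable K, forall Γ (i : input K Γ), F Γ i (form st i).
Proof.
move=> F1 Freix E1 Esound Ereix.
pose form Γ (i : input K Γ) := sval (unique_choice (F1 Γ i)).
have formF Γ (i : input K Γ) : F Γ i (form Γ i) by apply: (proj2_sig (unique_choice _)).
have F_eq Γ (i : input K Γ) (D : data i) : D = form Γ i -> F Γ i D by move=> ->.
pose elim Γ i D e P := sval (unique_choice (E1 Γ i D P (F_eq Γ i D e))).
have elimE Γ i D e P : E Γ i D P (elim Γ i D e P) by apply: (proj2_sig (unique_choice _)).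
unshelve eexists (@StrictlyStable _ _ form _ elim _ _); last exact: formF.
- move=> Γ Δ σ i; have [D [_ u]] := F1 _ (input_reix i σ).
  by rewrite -(u _ (formF _ _)) -(u _ (Freix _ _ σ _ _ (formF _ i))).
- move=> Γ i D e P; exact: Esound (F_eq _ _ _ e) (elimE _ _ _ e P).
- move=> Γ Δ σ i D e e' P.
  have [s [_ u]] := E1 _ _ _ (problem_reix P σ) (F_eq _ _ _ e').
  rewrite -(u _ (elimE _ _ _ e' _)).
  by rewrite -(u _ (Ereix _ _ σ _ _ _ _ (F_eq _ _ _ e) (elimE _ _ _ e P))).
Qed.

End Relations.

(** * Inductive type formers *)

(* The formers whose data over an input [i] are a type over the object of
   [frame i], with constructors over the maps of [frame i], and whose
   elimination rule is a dependent lifting property. *)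
Record inductive_former (S : compcat) (J : Type) := InductiveFormer {
  ind_former :> type_former S;
  frame : forall Γ : S, input ind_former Γ -> shape Γ J;
  frame_e : forall (Γ Δ : S) (i : input ind_former Γ) (σ : hom Δ Γ),
    hom (sh_ob (frame (input_reix i σ))) (sh_ob (frame i));
  frame_x : forall (Γ Δ : S) (i : input ind_former Γ) (σ : hom Δ Γ) (j : J),
    hom (sh_arg (frame (input_reix i σ)) j) (sh_arg (frame i) j);
  frame_pull : forall (Γ Δ : S) (i : input ind_former Γ) (σ : hom Δ Γ),
    shape_pull σ (frame_e i σ) (frame_x i σ);
  frame_display : forall (Γ : S) (i : input ind_former Γ) (T : ty S (sh_ob (frame i))),
    is_display (sh_map (frame i) ∘ disp T);
  frame_tame : forall (Γ : S) (i : input ind_former Γ) (j : J),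
    tame (sh_map (frame i) ∘ sh_con (frame i) j);
  dty : forall (Γ : S) (i : input ind_former Γ), data i -> ty S (sh_ob (frame i));
  dcon : forall (Γ : S) (i : input ind_former Γ) (D : data i) (j : J),
    hom (sh_arg (frame i) j) (ext (dty D));
  dcon_over : forall (Γ : S) (i : input ind_former Γ) (D : data i) (j : J),
    disp (dty D) ∘ dcon D j = sh_con (frame i) j;
  dlift : forall (Γ Δ : S) (i : input ind_former Γ) (D : data i) (σ : hom Δ Γ),
    tmap (dty (data_reix D σ)) (dty D);
  dlift_canon : forall (Γ Δ : S) (i : input ind_former Γ) (D : data i) (σ : hom Δ Γ),
    canon (dlift D σ);
  dlift_over : forall (Γ Δ : S) (i : input ind_former Γ) (D : data i) (σ : hom Δ Γ),
    tover (dlift D σ) = frame_e i σ;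
  dlift_con : forall (Γ Δ : S) (i : input ind_former Γ) (D : data i) (σ : hom Δ Γ) (j : J),
    emap (dlift D σ) ∘ dcon (data_reix D σ) j = dcon D j ∘ frame_x i σ j;
  data_over : forall (Γ : S) (i : input ind_former Γ) (Y : S) (T : ty S Y)
    (y : hom (sh_ob (frame i)) Y) (c : forall j, hom (sh_arg (frame i) j) (ext T)),
    (forall j, disp T ∘ c j = y ∘ sh_con (frame i) j) ->
    exists (D : data i) (t : tmap (dty D) T),
      [/\ canon t, tover t = y & forall j, emap t ∘ dcon D j = c j];
  data_ext : forall (Γ : S) (i : input ind_former Γ) (Y : S) (T : ty S Y) (D D' : data i)
    (t : tmap (dty D) T) (t' : tmap (dty D') T), is_cartesian t ->
    existT (fun A => tmap A T) (dty D) t = existT _ (dty D') t' ->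
    (forall j, emap t ∘ dcon D j = emap t' ∘ dcon D' j) -> D = D';
  mot : forall (Γ : S) (i : input ind_former Γ) (D : data i), problem D -> ty S (ext (dty D));
  cas : forall (Γ : S) (i : input ind_former Γ) (D : data i) (P : problem D) (j : J),
    hom (sh_arg (frame i) j) (ext (mot P));
  cas_over : forall (Γ : S) (i : input ind_former Γ) (D : data i) (P : problem D) (j : J),
    disp (mot P) ∘ cas P j = dcon D j;
  mlift : forall (Γ Δ : S) (i : input ind_former Γ) (D : data i) (P : problem D)
    (σ : hom Δ Γ), tmap (mot (problem_reix P σ)) (mot P);
  mlift_canon : forall (Γ Δ : S) (i : input ind_former Γ) (D : data i) (P : problem D)
    (σ : hom Δ Γ), canon (mlift P σ);
  mlift_over : forall (Γ Δ : S) (i : input ind_former Γ) (D : data i) (P : problem D)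
    (σ : hom Δ Γ), tover (mlift P σ) = emap (dlift D σ);
  mlift_cas : forall (Γ Δ : S) (i : input ind_former Γ) (D : data i) (P : problem D)
    (σ : hom Δ Γ) (j : J), emap (mlift P σ) ∘ cas (problem_reix P σ) j = cas P j ∘ frame_x i σ j;
  sec : forall (Γ : S) (i : input ind_former Γ) (D : data i) (P : problem D),
    candidate P -> section (mot P);
  sec_inv : forall (Γ : S) (i : input ind_former Γ) (D : data i) (P : problem D),
    section (mot P) -> candidate P;
  sec_invK : forall (Γ : S) (i : input ind_former Γ) (D : data i) (P : problem D)
    (s : section (mot P)), sec (sec_inv s) = s;
  secK : forall (Γ : S) (i : input ind_former Γ) (D : data i) (P : problem D)
    (s : candidate P), sec_inv (sec s) = s;
  sec_reix : forall (Γ Δ : S) (i : input ind_former Γ) (D : data i) (P : problem D)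
    (s : candidate P) (σ : hom Δ Γ),
    emap (mlift P σ) ∘ sval (sec (candidate_reix s σ)) = sval (sec s) ∘ emap (dlift D σ);
  solves_sec : forall (Γ : S) (i : input ind_former Γ) (D : data i) (P : problem D)
    (s : candidate P), (forall j, sval (sec s) ∘ dcon D j = cas P j) -> solves s;
  problem_lifting : forall (Γ : S) (i : input ind_former Γ) (D : data i),
    (forall P : problem D, exists s : candidate P, solves s) ->
    lifting (Shape (sh_map (frame i) ∘ disp (dty D)) (dcon D)) }.

Arguments dcon {S J} i {Γ i0} D j : rename.
Arguments frame {S J} i {Γ} i0 : rename.
Arguments cas {S J} i {Γ i0 D} P j : rename.

Section InductiveShapes.
Context {S : compcat} {J : Type} (K : inductive_former S J).

Definition dshape (Γ : S) (i : input K Γ) (D : data i) : shape Γ J :=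
  Shape (sh_map (frame K i) ∘ disp (dty D)) (dcon K D).

Lemma dshape_pull (Γ Δ : S) (τ : hom Δ Γ) (i : input K Γ) (i' : input K Δ)
    (D : data i) (D' : data i') (y : hom (sh_ob (frame K i')) (sh_ob (frame K i)))
    (x : forall j, hom (sh_arg (frame K i') j) (sh_arg (frame K i) j))
    (t : tmap (dty D') (dty D)) :
  shape_pull τ y x -> is_cartesian t -> tover t = y ->
  (forall j, emap t ∘ dcon K D' j = dcon K D j ∘ x j) ->
  @shape_pull _ _ _ _ τ (dshape D') (dshape D) (emap t) x.
Proof.
move=> [h1 h2] ct ot hx; split=> [|j] /=.
  apply/pullback_sym/(pullback_paste (pullback_sym h1))/pullback_sym.
  exact: cart_pullback.
by rewrite -!mcompA !dcon_over hx; split; first case: (h2 j).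
Qed.

Lemma dshape_tame (Γ : S) (i : input K Γ) (D : data i) : shape_tame (dshape D).
Proof.
split=> [|j] /=; first exact: frame_display.
by rewrite -mcompA dcon_over; apply: frame_tame.
Qed.

(** Weak stability concerns the reindexings given by the cleaving; [lifting_transfer] extends it to
    all pullbacks, such as the one that carries a generic cone. *)
Lemma weakly_stable_lifting : weakly_stable K ->
  forall (Γ : S) (i : input K Γ), exists D : data i, stably_lifting (dshape D).
Proof.
move=> wK Γ i; have [D hD] := wK Γ i; exists D => Δ τ s' e x pb.
apply: (lifting_transfer _ pb (problem_lifting (hD Δ τ))).
exact: dshape_pull (frame_pull i τ) (canon_cart (dlift_canon D τ)) (dlift_over D τ)
  (dlift_con D τ).
Qed.

End InductiveShapes.

(* In the split replacement, [univ], [gen] and the map of [named] are the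
   components (V, E, n) of a type. *)
Record local_universes (S : compcat) := LocalUniverses {
  code : Type;
  univ : code -> S;
  gen : forall k : code, ty S (univ k);
  named : forall (Γ : S) (A : ty S Γ), exists! p : {k : code & hom Γ (univ k)},
    exists f : tmap A (gen (projT1 p)), canon f /\ tover f = projT2 p }.

(** * Generic inputs and strict stability of inductive formers *)

Section Generic.
Context {S : compcat} {J : Type} (K : inductive_former S J).

Section Location.
Context (Idx : Type) (V : Idx -> S) (gin : forall k, input K (V k)).

Record location (Γ : S) (i : input K Γ) := Location {
  loc_k : Idx;
  loc_map : hom Γ (V loc_k);
  loc_y : hom (sh_ob (frame K i)) (sh_ob (frame K (gin loc_k)));
  loc_x : forall j, hom (sh_arg (frame K i) j) (sh_arg (frame K (gin loc_k)) j) }.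

Definition location_reix (Γ Δ : S) (i : input K Γ) (l : location i) (σ : hom Δ Γ) :
    location (input_reix i σ) :=
  @Location _ (input_reix i σ) (loc_k l) (loc_map l ∘ σ) (loc_y l ∘ frame_e i σ)
    (fun j => loc_x l j ∘ frame_x i σ j).

End Location.

(** Locating an input includes the comparison maps of the frames, and is a relation instead of an
    equation between [i] and a reindexing of [gi_in]: such an equation would force transports on
    everything that depends on [i]. *)
Record generic_inputs := GenericInputs {
  gi_idx : Type;
  gi_ob : gi_idx -> S;
  gi_in : forall k, input K (gi_ob k);
  located : forall (Γ : S) (i : input K Γ), location gi_in i -> Prop;
  located_pull : forall (Γ : S) (i : input K Γ) (l : location gi_in i),
    located l -> shape_pull (loc_map l) (loc_y l) (loc_x l);
  located_unique : forall (Γ : S) (i : input K Γ), exists! l : location gi_in i, located l;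
  located_reix : forall (Γ Δ : S) (i : input K Γ) (l : location gi_in i) (σ : hom Δ Γ),
    located l -> located (location_reix l σ) }.

End Generic.

Arguments gi_ob {S J K} g k : rename.
Arguments gi_in {S J K} g k : rename.

Section InductiveTheorem.
Context {S : compcat} (Ssplit : is_split S) (LF : condition_LF S) (U : local_universes S).
Context {J : Type} (K : inductive_former S J) (G : generic_inputs K).
Context (cones : forall (V : S) (s : shape V J) (Θ : S) (T : ty S Θ),
  shape_tame s -> inhabited (gen_cone s T)).

Lemma fill_eq (V : S) (s : shape V J) (Θ : S) (T : ty S Θ) (R : filler s T) (Γ : S)
    (τ : hom Γ V) (s' : shape Γ J) e e' x x' n n' c c' ρ ρ' :
  fill R τ (s' := s') e x n c ρ -> e = e' -> (forall j, x j = x' j) -> n = n' ->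
  (forall j, c j = c' j) -> ρ = ρ' -> fill R τ e' x' n' c' ρ'.
Proof.
move=> h <- ex <- ec <-.
by rewrite -(functional_extensionality_dep _ _ ex) -(functional_extensionality_dep _ _ ec).
Qed.

Lemma inductive_strictly_stable :
  (forall (Γ : S) (i : input K Γ), exists D : data i, stably_lifting (dshape D)) ->
  inhabited (strictly_stable K).
Proof.
move=> hD.
(* All genuine choices are made here: data for each generic input, then a filler for each generic
   input and code of motives. The rest is unique existence. *)
have /dep_choice [gD gDl] : forall k, exists D : data (gi_in G k), stably_lifting (dshape D).
  by move=> k; apply: hD.
have R k m : filler (dshape (gD k)) (gen (l := U) m).
  suff h : inhabited (filler (dshape (gD k)) (gen m)) by apply: (epsilon h (fun=> True)).
  have [g] := cones (gen m) (dshape_tame (gD k)).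
  exact: filler_exists g (gDl k).
pose over Γ (i : input K Γ) (D : data i) (l : location (gi_in G) i)
    (t : tmap (dty D) (dty (gD (loc_k l)))) := located l /\
  [/\ canon t, tover t = loc_y l &
    forall j, emap t ∘ dcon K D j = dcon K (gD (loc_k l)) j ∘ loc_x l j].
pose F Γ (i : input K Γ) (D : data i) := exists l t, over Γ i D l t.
(* The solution is specified after composition with [f], inside the comprehension of the generic
   type that names the motive: that object is common to all contexts, so solutions over different
   contexts can be compared there. *)
pose E Γ (i : input K Γ) (D : data i) (P : problem D) (s : candidate P) :=
  exists l t, over Γ i D l t /\
  exists (p : {k : code U & hom (ext (dty D)) (univ k)})
    (f : tmap (mot P) (gen (projT1 p))), [/\ canon f, tover f = projT2 p &
    @fill _ _ _ _ _ _ (R (loc_k l) (projT1 p)) Γ (loc_map l) (dshape D) (emap t) (loc_x l) (projT2 p)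
      (fun j => emap f ∘ cas K P j) (emap f ∘ sval (sec s))].
have over_pull Γ i D l t : over Γ i D l t ->
    @shape_pull _ _ _ _ (loc_map l) (dshape D) (dshape (gD (loc_k l))) (emap t) (loc_x l).
  move=> [hl [ct ot kt]].
  exact: dshape_pull (located_pull hl) (canon_cart ct) ot kt.
have over_reix Γ Δ (σ : hom Δ Γ) i D l t : over Γ i D l t ->
    over Δ (input_reix i σ) (data_reix D σ) (location_reix l σ) (tcomp t (dlift D σ)).
  move=> [hl [ct ot kt]]; split; first exact: located_reix.
  split=> [||j]; first exact: canon_comp ct (dlift_canon D σ).
    by rewrite over_comp ot dlift_over.
  by rewrite emap_comp -mcompA dlift_con mcompA kt -mcompA.
have dlift_pull Γ Δ (σ : hom Δ Γ) (i : input K Γ) (D : data i) :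
    @shape_pull _ _ _ _ σ (dshape (data_reix D σ)) (dshape D) (emap (dlift D σ)) (frame_x i σ).
  exact: dshape_pull (frame_pull i σ) (canon_cart (dlift_canon D σ)) (dlift_over D σ)
    (dlift_con D σ).
have [||||| st _] := @strictly_stable_of_relations S K F E; last by exists.
- move=> Γ i; have [l [hl ul]] := located_unique G i.
  have [j|D [t [ct ot kt]]] := @data_over _ _ K _ i _ (dty (gD (loc_k l))) (loc_y l)
      (fun j => dcon K (gD (loc_k l)) j ∘ loc_x l j).
    by rewrite mcompA dcon_over (proj2 (proj2 (located_pull hl) j)).
  exists D; split; first by exists l, t.
  move=> D' [l' [t' [hl' [ct' ot' kt']]]]; have el := ul _ hl'.
  case: l' / el t' ct' ot' kt' {hl'} => t' ct' ot' kt'.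
  apply: (data_ext (t' := t') (canon_cart ct)); first by apply: canon_sig_unique; rewrite ?ot ?ot'.
  by move=> j; rewrite kt kt'.
- move=> Γ Δ σ i D [l [t h]]; exists (location_reix l σ), (tcomp t (dlift D σ)).
  exact: over_reix.
- move=> Γ i D P [l [t h]].
  have [p [[f [cf of_]] up]] := named U (mot P).
  have cone : is_cone (s := dshape D) (T := gen (projT1 p)) (projT2 p)
      (fun j => emap f ∘ cas K P j).
    by move=> j /=; rewrite mcompA disp_emap of_ -mcompA cas_over.
  have [ρ [hρ uρ]] := fill_ex (R (loc_k l) (projT1 p)) (over_pull _ _ _ _ _ h) cone.
  have [ρn ρc] := fill_sound hρ.
  have es : disp (gen (projT1 p)) ∘ ρ = tover f ∘ idm _ by rewrite comp_idr of_.
  exists (sec_inv (mk_section (disp_cpair (canon_cart cf) es))); split.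
    exists l, t; split=> //; exists p, f; split=> //.
    by rewrite sec_invK /= emap_cpair.
  move=> s [l' [t' [h' [p' [f' [cf' of' hs]]]]]].
  have [l0 [_ ul]] := located_unique G i.
  have el : l = l' by rewrite -(ul _ (proj1 h)) (ul _ (proj1 h')).
  case: l' / el t' h' hs => t' h' hs.
  have et : t = t'.
    case: h h' => _ [ct ot _] [_ [ct' ot' _]].
    by apply: canon_unique; rewrite ?ot ?ot'.
  case: t' / et h' hs => _ hs.
  have ep : p = p' by apply: up; exists f'.
  case: p' / ep f' cf' of' hs => f' cf' of' hs.
  have ef : f = f' by apply: canon_unique; rewrite ?of_ ?of'.
  case: f' / ef cf' of' hs => _ _ hs.
  rewrite -[s]secK; congr sec_inv; apply: sig_ext.
  apply: (cart_hom_ext (canon_cart cf)); last by rewrite /= disp_cpair section_id.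
  by rewrite /= emap_cpair (uρ _ hs).
- move=> Γ i D P s _ [l [t [h [p [f [cf of_ hs]]]]]].
  apply: solves_sec => j; have [_ hc] := fill_sound hs.
  apply: (cart_hom_ext (canon_cart cf)); first by rewrite mcompA (hc j).
  by rewrite mcompA section_id comp_idl cas_over.
- move=> Γ Δ σ i D P s _ [l [t [h [p [f [cf of_ hs]]]]]].
exists (location_reix l σ), (tcomp t (dlift D σ)); split; first exact: over_reix.
exists (existT _ (projT1 p) (projT2 p ∘ emap (dlift D σ))), (tcomp f (mlift P σ)).
split; [exact: canon_comp cf (mlift_canon P σ)|by rewrite over_comp of_ mlift_over|].
have h' := fill_reix hs (dlift_pull _ _ σ i D).
apply: (fill_eq h') => //= [|j|].
    by rewrite emap_comp.
  by rewrite emap_comp -!mcompA mlift_cas.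
by rewrite emap_comp -!mcompA sec_reix.
Qed.

End InductiveTheorem.

(** * Sum, zero, unit, Σ- and identity types as inductive formers *)

Definition fam0 (P : Empty_set -> Type) : forall j, P j := fun j => match j with end.

Definition fam1 (P : option Empty_set -> Type) (a : P None) : forall j, P j :=
  fun j => match j with None => a | Some e => match e with end end.

(** Constructors are indexed by iterated options of [Empty_set], to match the recursion from
    [gen_cone0] through [gen_cone_option]. *)
Definition fam2 (P : option (option Empty_set) -> Type) (a : P None) (b : P (Some None)) :
    forall j, P j :=
  fun j => match j with
  | None => a
  | Some None => b
  | Some (Some e) => match e with end
  end.

Lemma id_pullback (S : category) (X Y : S) (σ : hom X Y) :
  is_pullback σ (idm X) (idm Y) σ.
Proof.
split=> [|W u v e]; first by rewrite comp_idl comp_idr.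
exists v; split; first by rewrite -e !comp_idl.
by move=> w [_ <-]; rewrite comp_idl.
Qed.

Lemma id_display (S : compcat) (Γ : S) (T : ty S Γ) : is_display (idm Γ ∘ disp T).
Proof. by rewrite comp_idl; apply: display_disp. Qed.

Section Formers.
Context (S : compcat).

Definition sum_inductive : inductive_former S (option (option Empty_set)).
Proof.
refine (@InductiveFormer S _ (sum_former S)
  (fun Γ i => @Shape S Γ _ Γ (idm Γ) (fam2 (P := fun=> S) (ext (fst i)) (ext (snd i)))
    (fam2 (P := fun j => hom (fam2 (P := fun=> S) _ _ j) Γ) (disp (fst i)) (disp (snd i))))
  (fun Γ Δ i σ => σ)
  (fun Γ Δ i σ => fam2 (P := fun j => hom (fam2 (P := fun=> S) _ _ j) (fam2 (P := fun=> S) _ _ j))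
    (qmap σ (fst i)) (qmap σ (snd i)))
  _ _ _ (fun Γ i D => sum_ty D)
  (fun Γ i D => fam2 (P := fun j => hom (fam2 (P := fun=> S) _ _ j) _) (sum_inl D) (sum_inr D))
  _ (fun Γ Δ i D σ => lift (sum_ty D) σ) _ _ _ _ _ (fun Γ i D P => sum_mot P)
  (fun Γ i D P => fam2 (P := fun j => hom (fam2 (P := fun=> S) _ _ j) _)
    (sum_casel P) (sum_caser P))
  _ (fun Γ Δ i D P σ => lift (sum_mot P) (qmap σ (sum_ty D))) _ _ _
  (fun Γ i D P s => s) (fun Γ i D P s => s) _ _ _ _ _).
- move=> Γ Δ i σ; split; first exact: id_pullback.
  case=> [[[]|]|] /=; rewrite !comp_idl.
    by split; [exact: reix_pullback|rewrite disp_q].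
  by split; [exact: reix_pullback|rewrite disp_q].
- by move=> Γ i T; apply: id_display.
- by move=> Γ i [[[]|]|]; left; apply: id_display.
- move=> Γ i D [[[]|]|] /=; [exact: sum_inr_over|exact: sum_inl_over].
- by move=> *; apply: canon_lift.
- by move=> *; apply: over_lift.
- by move=> Γ Δ i D σ [[[]|]|]; apply: q_rpair.
- move=> Γ i Y T y c h; have hl := h None; have hr := h (Some None).
  exists (SumData (A := fst i) (B := snd i) (disp_rpair hl) (disp_rpair hr)), (lift T y).
  split; [exact: canon_lift|exact: over_lift|].
  by case=> [[[]|]|]; apply: q_rpair.
- move=> Γ i Y T [A l r el er] [A' l' r' el' er'] /= t t' ct e h.
  have eA : A = A' := f_equal (@projT1 _ _) e; subst A'.
  have et := inj_pair2 _ (fun A => tmap A _) _ _ _ e; subst t'.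
  have eql : l = l' by apply: (cart_hom_ext ct (h None)); rewrite el el'.
  have eqr : r = r' by apply: (cart_hom_ext ct (h (Some None))); rewrite er er'.
  subst l' r'.
  by rewrite (proof_irrelevance _ el el') (proof_irrelevance _ er er').
- move=> Γ i D P [[[]|]|] /=; [exact: sum_caser_over|exact: sum_casel_over].
- by move=> *; apply: canon_lift.
- by move=> *; apply: over_lift.
- by move=> Γ Δ i D P σ [[[]|]|]; apply: q_rpair.
- by [].
- by [].
- by move=> Γ Δ i D P s σ; apply: q_reix_section.
- by move=> Γ i D P s h; split; [exact: (h None)|exact: (h (Some None))].
- move=> Γ i D hD M c h.
  have [s [sl sr]] := hD (SumProblem (D := D) (h None) (h (Some None))).
  by exists s; case=> [[[]|]|].
Defined.

Definition zero_inductive : inductive_former S Empty_set.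
Proof.
refine (@InductiveFormer S _ (zero_former S)
  (fun Γ i => @Shape S Γ Empty_set Γ (idm Γ) (fun j => match j with end)
     (fun j => match j with end))
  (fun Γ Δ i σ => σ) (fun Γ Δ i σ j => match j with end)
  _ _ _ (fun Γ i D => D) (fun Γ i D j => match j with end)
  _ (fun Γ Δ i D σ => lift D σ) _ _ _ _ _ (fun Γ i D P => P)
  (fun Γ i D P j => match j with end)
  _ (fun Γ Δ i D P σ => lift P (qmap σ D)) _ _ _
  (fun Γ i D P s => s) (fun Γ i D P s => s) _ _ _ _ _).
- by move=> Γ Δ i σ; split=> [|[]]; exact: id_pullback.
- by move=> Γ i T; apply: id_display.
- by move=> Γ i [].
- by move=> Γ i D [].
- by move=> *; apply: canon_lift.
- by move=> *; apply: over_lift.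
- by move=> Γ Δ i D σ [].
- move=> Γ i Y T y c h; exists T.[y], (lift T y).
  by split; [exact: canon_lift|exact: over_lift|case].
- by move=> Γ i Y T A A' t t' _ e _; apply: (f_equal (@projT1 _ _) e).
- by move=> Γ i D P [].
- by move=> *; apply: canon_lift.
- by move=> *; apply: over_lift.
- by move=> Γ Δ i D P σ [].
- by [].
- by [].
- by move=> Γ Δ i D P s σ; apply: q_reix_section.
- by [].
- by move=> Γ i D hD M c _; have [s _] := hD M; exists s; case.
Defined.

Definition unit_inductive : inductive_former S (option Empty_set).
Proof.
refine (@InductiveFormer S _ (unit_former S)
  (fun Γ i => @Shape S Γ _ Γ (idm Γ) (fam1 (P := fun=> S) Γ)
    (fam1 (P := fun j => hom (fam1 (P := fun=> S) _ j) Γ) (idm Γ)))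
  (fun Γ Δ i σ => σ)
  (fun Γ Δ i σ => fam1 (P := fun j => hom (fam1 (P := fun=> S) _ j) (fam1 (P := fun=> S) _ j)) σ)
  _ _ _ (fun Γ i D => unit_ty D)
  (fun Γ i D => fam1 (P := fun j => hom (fam1 (P := fun=> S) _ j) _) (sval (unit_star D)))
  _ (fun Γ Δ i D σ => lift (unit_ty D) σ) _ _ _ _ _ (fun Γ i D P => unit_mot P)
  (fun Γ i D P => fam1 (P := fun j => hom (fam1 (P := fun=> S) _ j) _) (unit_case P))
  _ (fun Γ Δ i D P σ => lift (unit_mot P) (qmap σ (unit_ty D))) _ _ _
  (fun Γ i D P s => s) (fun Γ i D P s => s) _ _ _ _ _).
- move=> Γ Δ i σ; split; first exact: id_pullback.
  case=> [[]|] /=; rewrite !comp_idl comp_idr.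
  by split=> //; apply: id_pullback.
- by move=> Γ i T; apply: id_display.
(* The argument of the constructor is the context itself, whose identity need not be a display map;
   it is tame as an isomorphism. *)
- by move=> Γ i [[]|]; right; rewrite /= comp_idl; apply: iso_id.
- move=> Γ i D [[]|] /=; exact: section_id.
- by move=> *; apply: canon_lift.
- by move=> *; apply: over_lift.
- by move=> Γ Δ i D σ [[]|]; apply: q_reix_section.
- move=> Γ i Y T y c h; have h0 := h None.
  exists (UnitData (mk_section (disp_rpair h0))), (lift T y).
  split; [exact: canon_lift|exact: over_lift|].
  by case=> [[]|]; apply: q_rpair.
- move=> Γ i Y T [A s] [A' s'] /= t t' ct e h.
  have eA : A = A' := f_equal (@projT1 _ _) e; subst A'.
  have et := inj_pair2 _ (fun A => tmap A _) _ _ _ e; subst t'.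
  congr UnitData; apply: sig_ext.
  by apply: (cart_hom_ext ct (h None)); rewrite !section_id.
- move=> Γ i D P [[]|] /=; exact: unit_case_over.
- by move=> *; apply: canon_lift.
- by move=> *; apply: over_lift.
- by move=> Γ Δ i D P σ [[]|]; apply: q_rpair.
- by [].
- by [].
- by move=> Γ Δ i D P s σ; apply: q_reix_section.
- by move=> Γ i D P s h; exact: (h None).
- move=> Γ i D hD M c h.
  have [s hs] := hD (UnitProblem (D := D) (h None)).
  by exists s; case=> [[]|].
Defined.

Lemma disp2_pullback (Γ Δ : S) (σ : hom Δ Γ) (A : ty S Γ) (B : ty S (ext A)) :
  is_pullback (qmap (qmap σ A) B) (disp A.[σ] ∘ disp B.[qmap σ A]) (disp A ∘ disp B) σ.
Proof.
exact/pullback_sym/(pullback_paste (pullback_sym (reix_pullback _ _)))/pullback_sym/reix_pullback.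
Qed.

Definition sig_inductive : inductive_former S (option Empty_set).
Proof.
refine (@InductiveFormer S _ (sig_former S)
  (fun Γ i => @Shape S Γ _ Γ (idm Γ) (fam1 (P := fun=> S) (ext (projT2 i)))
    (fam1 (P := fun j => hom (fam1 (P := fun=> S) _ j) Γ) (disp (projT1 i) ∘ disp (projT2 i))))
  (fun Γ Δ i σ => σ)
  (fun Γ Δ i σ => fam1 (P := fun j => hom (fam1 (P := fun=> S) _ j) (fam1 (P := fun=> S) _ j))
    (qmap (qmap σ (projT1 i)) (projT2 i)))
  _ _ _ (fun Γ i D => sig_ty D)
  (fun Γ i D => fam1 (P := fun j => hom (fam1 (P := fun=> S) _ j) _) (sig_pair D))
  _ (fun Γ Δ i D σ => lift (sig_ty D) σ) _ _ _ _ _ (fun Γ i D P => sig_mot P)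
  (fun Γ i D P => fam1 (P := fun j => hom (fam1 (P := fun=> S) _ j) _) (sig_case P))
  _ (fun Γ Δ i D P σ => lift (sig_mot P) (qmap σ (sig_ty D))) _ _ _
  (fun Γ i D P s => s) (fun Γ i D P s => s) _ _ _ _ _).
- move=> Γ Δ i σ; split; first exact: id_pullback.
  case=> [[]|] /=; rewrite !comp_idl disp2_q.
  by split=> //; apply: disp2_pullback.
- by move=> Γ i T; apply: id_display.
- move=> Γ i [[]|]; left; rewrite /= comp_idl.
  by apply: display_comp; apply: display_disp.
- move=> Γ i D [[]|] /=; exact: sig_pair_over.
- by move=> *; apply: canon_lift.
- by move=> *; apply: over_lift.
- by move=> Γ Δ i D σ [[]|]; apply: q_rpair.
- move=> Γ i Y T y c h; have h0 := h None.
  exists (SigData (B := projT2 i) (disp_rpair h0)), (lift T y).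
  split; [exact: canon_lift|exact: over_lift|].
  by case=> [[]|]; apply: q_rpair.
- move=> Γ i Y T [A s es] [A' s' es'] /= t t' ct e h.
  have eA : A = A' := f_equal (@projT1 _ _) e; subst A'.
  have et := inj_pair2 _ (fun A => tmap A _) _ _ _ e; subst t'.
  have eqs : s = s' by apply: (cart_hom_ext ct (h None)); rewrite es es'.
  by subst s'; rewrite (proof_irrelevance _ es es').
- move=> Γ i D P [[]|] /=; exact: sig_case_over.
- by move=> *; apply: canon_lift.
- by move=> *; apply: over_lift.
- by move=> Γ Δ i D P σ [[]|]; apply: q_rpair.
- by [].
- by [].
- by move=> Γ Δ i D P s σ; apply: q_reix_section.
- by move=> Γ i D P s h; exact: (h None).
- move=> Γ i D hD M c h.
  have [s hs] := hD (SigProblem (D := D) (h None)).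
  by exists s; case=> [[]|].
Defined.

Lemma wkmap_pullback (Γ Δ : S) (σ : hom Δ Γ) (A B : ty S Γ) :
  is_pullback (wkmap σ A B) (disp A.[σ] ∘ disp B.[σ].[disp A.[σ]]) (disp A ∘ disp B.[disp A]) σ.
Proof.
have pA := reix_pullback A σ; have pB := reix_pullback B σ.
apply/pullback_sym/(pullback_paste (pullback_sym pA))/pullback_sym.
apply: (pullback_cancel (reix_pullback B (disp A))); first exact: disp_rpair.
rewrite /wkmap q_rpair disp_q.
exact: pullback_paste pB (reix_pullback _ _).
Qed.

(** The identity type lives over Γ.A.A, so that object, and not [Γ], carries the frame. Its
    constructor is the diagonal, whose composite down to [Γ] is again [disp A]. *)
Definition id_inductive : inductive_former S (option Empty_set).
Proof.
refine (@InductiveFormer S _ (id_former S)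
  (fun Γ A => @Shape S Γ _ (ext A.[disp A]) (disp A ∘ disp A.[disp A]) (fam1 (P := fun=> S) (ext A))
    (fam1 (P := fun j => hom (fam1 (P := fun=> S) _ j) _) (diag A)))
  (fun Γ Δ A σ => wkmap σ A A)
  (fun Γ Δ A σ => fam1 (P := fun j => hom (fam1 (P := fun=> S) _ j) (fam1 (P := fun=> S) _ j))
    (qmap σ A))
  _ _ _ (fun Γ i D => id_ty D)
  (fun Γ i D => fam1 (P := fun j => hom (fam1 (P := fun=> S) _ j) _) (id_refl D))
  _ (fun Γ Δ i D σ => lift (id_ty D) (wkmap σ i i)) _ _ _ _ _ (fun Γ i D P => id_mot P)
  (fun Γ i D P => fam1 (P := fun j => hom (fam1 (P := fun=> S) _ j) _) (id_case P))
  _ (fun Γ Δ i D P σ => lift (id_mot P) (qmap (wkmap σ i i) (id_ty D))) _ _ _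
  (fun Γ i D P s => s) (fun Γ i D P s => s) _ _ _ _ _).
- move=> Γ Δ A σ; split; first exact: wkmap_pullback.
  case=> [[]|] /=; rewrite diag_wkmap; split=> //.
  rewrite -!mcompA /diag !disp_rpair !comp_idr.
  exact: reix_pullback.
- by move=> Γ A T; apply: display_comp; first apply: display_comp; apply: display_disp.
- move=> Γ A [[]|]; left; rewrite /= -mcompA disp_rpair comp_idr.
  exact: display_disp.
- move=> Γ i D [[]|] /=; exact: id_refl_over.
- by move=> *; apply: canon_lift.
- by move=> *; apply: over_lift.
- by move=> Γ Δ i D σ [[]|]; apply: q_rpair.
- move=> Γ i Y T y c h; have h0 := h None.
  exists (IdData (A := i) (disp_rpair h0)), (lift T y).
  split; [exact: canon_lift|exact: over_lift|].
  by case=> [[]|]; apply: q_rpair.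
- move=> Γ i Y T [A s es] [A' s' es'] /= t t' ct e h.
  have eA : A = A' := f_equal (@projT1 _ _) e; subst A'.
  have et := inj_pair2 _ (fun A => tmap A _) _ _ _ e; subst t'.
  have eqs : s = s' by apply: (cart_hom_ext ct (h None)); rewrite es es'.
  by subst s'; rewrite (proof_irrelevance _ es es').
- move=> Γ i D P [[]|] /=; exact: id_case_over.
- by move=> *; apply: canon_lift.
- by move=> *; apply: over_lift.
- by move=> Γ Δ i D P σ [[]|]; apply: q_rpair.
- by [].
- by [].
- by move=> Γ Δ i D P s σ; apply: q_reix_section.
- by move=> Γ i D P s h; exact: (h None).
- move=> Γ i D hD M c h.
  have [s hs] := hD (IdProblem (D := D) (h None)).
  by exists s; case=> [[]|].
Defined.

End Formers.

(** * Universes classifying families of types *)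

Record family_universes (S : compcat) := FamilyUniverses {
  fcode : Type;
  funiv : fcode -> S;
  fgenA : forall k : fcode, ty S (funiv k);
  fgenB : forall k : fcode, ty S (ext (fgenA k));
  fnamed : forall (Γ : S) (A : ty S Γ) (B : ty S (ext A)),
    exists! p : {k : fcode & hom Γ (funiv k)},
    exists (a : tmap A (fgenA (projT1 p))) (b : tmap B (fgenB (projT1 p))),
      [/\ canon a, canon b, tover a = projT2 p & tover b = emap a] }.

(* The generic map into [Θ] out of the reindexings of [A]. *)
Record generic_name (S : compcat) (V : S) (A : ty S V) (Θ : S) := GenericName {
  gn_ob : S;
  gn_map : hom gn_ob V;
  gn_name : hom (ext A.[gn_map]) Θ;
  gn_univ : forall (Γ : S) (X : ty S Γ) (f : tmap X A), is_cartesian f ->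
    forall m : hom (ext X) Θ, exists! τ : hom Γ gn_ob, gn_map ∘ τ = tover f /\
      forall e, qmap gn_map A ∘ e = emap f -> disp A.[gn_map] ∘ e = τ ∘ disp X ->
      gn_name ∘ e = m }.

(** As in [gen_cone0], maps from the comprehension into [Θ] are sections of a product projection,
    here exponentiated along [disp A]. *)
Lemma generic_name_exists (S : compcat) (LF : condition_LF S) (V : S) (A : ty S V) (Θ : S) :
  inhabited (generic_name A Θ).
Proof.
have dA := display_disp A; have [[_ prod] _] := LF.
have [Z [p [q pq]]] := prod (ext A) Θ.
have [U [u cl]] := LF_classifier (g := p) LF (or_introl dA)
  (or_intror (conj dA (ex_intro _ _ (ex_intro _ _ pq)))).
have [e [_ pe cle]] := cl _ _ _ (pullback_sym (reix_pullback A u)).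
exists; exists U u (q ∘ e) => Γ X f cf m.
have [z [[z1 z2] uz]] := pq _ (emap f) m.
have [τ [[τ1 τ2] uτ]] := cle _ _ _ _ _ (pullback_sym (cartesian_pullback cf)) z z1.
exists τ; split.
  by split=> // e' k1 k2; rewrite -mcompA τ2.
move=> τ' [τ1' h]; apply: uτ; split=> // t' k1 k2.
by symmetry; apply: uz; rewrite !mcompA pe k2 h.
Qed.

Lemma named_unique (S : compcat) (U : local_universes S) (Γ : S) (A : ty S Γ) (k k' : code U)
    (f : tmap A (gen k)) (f' : tmap A (gen k')) : canon f -> canon f' ->
  existT (fun k => hom Γ (univ k)) k (tover f) = existT _ k' (tover f').
Proof.
move=> cf cf'; have [p [_ up]] := named U A.
transitivity p; last by apply: up; exists f'.
by symmetry; apply: up; exists f.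
Qed.

Section Generics.
Context {S : compcat} (Ssplit : is_split S) (LF : condition_LF S) (U : local_universes S).

(** A family is named by a name of the base type together with a name of the dependent type on its
    comprehension. For fixed codes of both, [generic_name] represents such pairs; the code of the
    family is the pair of codes. *)
Lemma family_universes_exist : inhabited (family_universes S).
Proof.
have R (p : code U * code U) : generic_name (gen (fst p)) (univ (snd p)).
  suff h : inhabited (generic_name (gen (fst p)) (univ (snd p))).
    by apply: (epsilon h (fun=> True)).
  exact: generic_name_exists.
pose A p := (gen (fst p)).[gn_map (R p)].
exists; apply: (@FamilyUniverses S (code U * code U) (fun p => gn_ob (R p)) A
  (fun p => (gen (snd p)).[gn_name (R p)])) => Γ X Y.
have lc Δ Θ Ξ (M : ty S Δ) (σ : hom Θ Ξ) (L : ty S Ξ) (f : tmap M L.[σ]) :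
  canon f -> canon (tcomp (lift L σ) f) by move=> cf; apply: canon_comp.
(* The codes and the two names are forced by [named_unique]; it remains to see that they determine
   the map into [gn_ob], which is the uniqueness in [gn_univ]. *)
have uniq (p p' : code U * code U) (τ : hom Γ (gn_ob (R p))) (τ' : hom Γ (gn_ob (R p')))
    (α : tmap X (A p)) (β : tmap Y ((gen (snd p)).[gn_name (R p)]))
    (α' : tmap X (A p')) (β' : tmap Y ((gen (snd p')).[gn_name (R p')])) :
    [/\ canon α, canon β, tover α = τ & tover β = emap α] ->
    [/\ canon α', canon β', tover α' = τ' & tover β' = emap α'] ->
    existT (fun p => hom Γ (gn_ob (R p))) p τ = existT _ p' τ'.
  move=> [ca cb oa ob] [ca' cb' oa' ob'].
  have e1 := named_unique (lc _ _ _ _ _ _ _ ca) (lc _ _ _ _ _ _ _ ca').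
  have e2 := named_unique (lc _ _ _ _ _ _ _ cb) (lc _ _ _ _ _ _ _ cb').
  rewrite !over_comp !over_lift oa oa' in e1; rewrite !over_comp !over_lift ob ob' in e2.
  have ep : p = p'.
    rewrite (surjective_pairing p) (surjective_pairing p').
    congr pair; [exact: (f_equal (@projT1 _ _) e1)|exact: (f_equal (@projT1 _ _) e2)].
  subst p'; have {}e1 := inj_pair2 _ _ _ _ _ e1; have {}e2 := inj_pair2 _ _ _ _ _ e2.
  have eα : tcomp (lift _ _) α = tcomp (lift _ _) α'.
    by apply: canon_unique; [exact: lc|exact: lc|rewrite !over_comp !over_lift oa oa'].
  congr existT; have cα := canon_cart (lc _ _ _ _ _ _ _ ca).
  have [t [_ ut]] := gn_univ (R p) cα (gn_name (R p) ∘ emap α).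
  have key (γ : tmap X (A p)) : tcomp (lift _ _) γ = tcomp (lift _ _) α ->
      gn_name (R p) ∘ emap γ = gn_name (R p) ∘ emap α -> t = tover γ.
    move=> eγ nγ; apply: ut; split; first by rewrite -eγ over_comp over_lift.
    move=> e k1 k2; rewrite -nγ; congr (_ ∘ _).
    by apply: reix_hom_ext; rewrite ?k1 ?k2 -?eγ ?emap_comp // disp_emap.
  by rewrite -oa -oa' -(key α) // -(key α').
have [[a τ0] [[fA [cA /= oA]] _]] := named U X.
have [[b n] [[fB [cB /= oB]] _]] := named U Y.
pose p := (a, b).
have [τ [[eτ en] _]] := gn_univ (R p) (canon_cart cA) n.
have [α [cα oα αK]] : exists α : tmap X (A p),
    [/\ canon α, tover α = τ & tcomp (lift _ _) α = fA].
  by apply: canon_factor => //; rewrite over_lift.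
have [β [cβ oβ _]] : exists β : tmap Y ((gen b).[gn_name (R p)]),
    [/\ canon β, tover β = emap α & tcomp (lift _ _) β = fB].
  apply: canon_factor => //; rewrite oB over_lift en //; first by rewrite -αK emap_comp.
  by rewrite disp_emap oα.
exists (existT _ p τ); split; first by exists α, β.
by move=> [p' τ'] [α' [β' h]]; exact: (uniq _ _ _ _ _ _ _ _ (And4 cα cβ oα oβ) h).
Qed.

End Generics.

Section Weakening.
Context {S : compcat}.

Lemma cart_wk_pullback (Γ Δ : S) (A T : ty S Γ) (A' T' : ty S Δ) (a : tmap A' A) (t : tmap T' T)
    (e : tover t = tover a) : is_cartesian a -> is_cartesian t ->
  is_pullback (rpair (cart_wk_eq e)) (disp A' ∘ disp T'.[disp A']) (disp A ∘ disp T.[disp A])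
    (tover a).
Proof.
move=> ca ct; have pA := cartesian_pullback ca.
apply/pullback_sym/(pullback_paste (pullback_sym pA))/pullback_sym.
apply: (pullback_cancel (reix_pullback T (disp A))); first exact: disp_rpair.
rewrite q_rpair disp_emap -e.
exact: pullback_paste (cartesian_pullback ct) (reix_pullback _ _).
Qed.

Lemma cart_wk_diag (Γ Δ : S) (A : ty S Γ) (A' : ty S Δ) (a : tmap A' A)
    (e : tover a = tover a) : rpair (cart_wk_eq e) ∘ diag A' = diag A ∘ emap a.
Proof.
apply: reix_hom_ext.
  by rewrite !mcompA !q_rpair -mcompA q_rpair comp_idl comp_idr.
by rewrite !mcompA !disp_rpair -mcompA disp_rpair comp_idl comp_idr.
Qed.

Lemma cart_wk_lift (Γ Δ Θ : S) (A T : ty S Γ) (A' T' : ty S Δ) (a : tmap A' A) (t : tmap T' T)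
    (σ : hom Θ Δ) (e : tover t = tover a)
    (e' : tover (tcomp t (lift T' σ)) = tover (tcomp a (lift A' σ))) :
  rpair (cart_wk_eq e) ∘ wkmap σ A' T' = rpair (cart_wk_eq e').
Proof.
apply: reix_hom_ext.
  by rewrite mcompA !q_rpair -mcompA q_rpair emap_comp -mcompA.
by rewrite mcompA !disp_rpair -mcompA disp_rpair emap_comp -mcompA.
Qed.

End Weakening.

(** * Generic inputs of the inductive formers *)

Section GenericInputs.
Context {S : compcat} (Ssplit : is_split S) (LF : condition_LF S) (U : local_universes S).

Lemma type_unique (Γ : S) (A : ty S Γ) (k k' : code U) (τ : hom Γ (univ k))
    (τ' : hom Γ (univ k')) (f : tmap A (gen k)) (f' : tmap A (gen k')) :
  canon f -> tover f = τ -> canon f' -> tover f' = τ' ->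
  existT (fun k => hom Γ (univ k)) k τ = existT _ k' τ'.
Proof. by move=> cf <- cf' <-; apply: named_unique. Qed.

Lemma family_unique (F : family_universes S) (Γ : S) (A : ty S Γ) (B : ty S (ext A))
    (k k' : fcode F) (τ : hom Γ (funiv k)) (τ' : hom Γ (funiv k'))
    (a : tmap A (fgenA k)) (b : tmap B (fgenB k)) (a' : tmap A (fgenA k')) (b' : tmap B (fgenB k')) :
  canon a -> canon b -> tover a = τ -> tover b = emap a ->
  canon a' -> canon b' -> tover a' = τ' -> tover b' = emap a' ->
  existT (fun k => hom Γ (funiv k)) k τ = existT _ k' τ'.
Proof.
move=> ca cb oa ob ca' cb' oa' ob'; have [p [_ up]] := fnamed F B.
transitivity p; last by apply: up; exists a', b'.
by symmetry; apply: up; exists a, b.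
Qed.

(** A former without inputs has its generic input over the terminal object, where the classifying
    map is unique for lack of alternatives. *)
Lemma zero_inputs : inhabited (generic_inputs (zero_inductive S)).
Proof.
have [[[T hT] _] _] := LF.
pose gin (k : unit) : input (zero_inductive S) T := tt.
pose R Γ (i : input (zero_inductive S) Γ) (l : location gin i) := loc_y l = loc_map l.
exists; apply: (@GenericInputs _ _ (zero_inductive S) _ _ gin R).
- rewrite /R => Γ i [k τ y x] /= ->; split=> [|[]].
  exact: id_pullback.
- rewrite /R => Γ []; have [τ [_ uτ]] := hT Γ.
  exists (@Location _ _ (zero_inductive S) _ _ gin _ tt tt τ τ (fam0 _)); split=> //.
  move=> [[] τ' y' x'] /= ->; rewrite -(uτ τ' I); congr Location.
  by apply: functional_extensionality_dep; case.
- by rewrite /R => Γ Δ i [k τ y x] σ /= ->.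
Qed.

Lemma unit_inputs : inhabited (generic_inputs (unit_inductive S)).
Proof.
have [[[T hT] _] _] := LF.
pose gin (k : unit) : input (unit_inductive S) T := tt.
pose R Γ (i : input (unit_inductive S) Γ) (l : location gin i) := loc_y l = loc_map l /\
  loc_x l = fam1 (P := fun j => hom (fam1 (P := fun=> S) _ j) (fam1 (P := fun=> S) _ j)) (loc_map l).
exists; apply: (@GenericInputs _ _ (unit_inductive S) _ _ gin R).
- rewrite /R => Γ i [k τ y x] /= [-> ->]; split=> [|[[]|]] /=.
    exact: id_pullback.
  by rewrite !comp_idl comp_idr; split=> //; exact: id_pullback.
- rewrite /R => Γ []; have [τ [_ uτ]] := hT Γ.
  exists (@Location _ _ (unit_inductive S) _ _ gin _ tt tt τ τ
    (fam1 (P := fun j => hom (fam1 (P := fun=> S) _ j) (fam1 (P := fun=> S) _ j)) τ)); split=> //.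
  by move=> [[] τ' y' x'] /= [-> ->]; rewrite -(uτ τ' I).
- rewrite /R => Γ Δ i [k τ y x] σ /= [ey ex]; subst y x; split=> //=.
  by apply: functional_extensionality_dep; case=> [[]|].
Qed.

(** A pair of types is classified by a map into the product of their universes, to which both
    generic types are pulled back along the projections. *)
Lemma sum_inputs : inhabited (generic_inputs (sum_inductive S)).
Proof.
have [[_ prod] _] := LF.
pose Pr (p : code U * code U) := {Z : S & (hom Z (univ (fst p)) * hom Z (univ (snd p)))%type}.
have /(@dep_choice _ Pr) [V hV] : forall p, exists Z : Pr p,
    is_product (fst (projT2 Z)) (snd (projT2 Z)).
  move=> p; have [Z [u [v h]]] := prod (univ (fst p)) (univ (snd p)).
  by exists (existT _ Z (u, v)).
pose gin k : input (sum_inductive S) (projT1 (V k)) :=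
  ((gen (fst k)).[fst (projT2 (V k))], (gen (snd k)).[snd (projT2 (V k))]).
pose R Γ (i : input (sum_inductive S) Γ) (l : location gin i) :=
  exists (a : tmap (fst i) (fst (gin (loc_k l)))) (b : tmap (snd i) (snd (gin (loc_k l)))),
  [/\ canon a, canon b, tover a = loc_map l & tover b = loc_map l] /\
  [/\ loc_y l = loc_map l & loc_x l =
    fam2 (P := fun j => hom (fam2 (P := fun=> S) _ _ j) (fam2 (P := fun=> S) _ _ j)) (emap a) (emap b)].
have lc Δ Θ Ξ (M : ty S Δ) (σ : hom Θ Ξ) (L : ty S Ξ) (f : tmap M L.[σ]) :
  canon f -> canon (tcomp (lift L σ) f) by move=> cf; apply: canon_comp.
exists; apply: (@GenericInputs _ _ (sum_inductive S) _ _ gin R).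
- rewrite /R => Γ [A B] [k τ y x] /= [a [b [[ca cb oa ob] [-> ->]]]]; split=> [|[[[]|]|]] /=.
    exact: id_pullback.
    rewrite !comp_idl disp_emap ob; split=> //.
    exact: cart_pullback (canon_cart cb) ob.
  rewrite !comp_idl disp_emap oa; split=> //.
  exact: cart_pullback (canon_cart ca) oa.
- rewrite /R => Γ [A B].
  have [[ka τa] [[fa [ca /= oa]] _]] := named U A.
  have [[kb τb] [[fb [cb /= ob]] _]] := named U B.
  have [τ [[τ1 τ2] uτ]] := hV (ka, kb) _ τa τb.
  have [α [cα oα αK]] : exists α : tmap A (fst (gin (ka, kb))),
      [/\ canon α, tover α = τ & tcomp (lift _ _) α = fa].
    by apply: canon_factor => //; rewrite oa over_lift τ1.
  have [β [cβ oβ βK]] : exists β : tmap B (snd (gin (ka, kb))),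
      [/\ canon β, tover β = τ & tcomp (lift _ _) β = fb].
    by apply: canon_factor => //; rewrite ob over_lift τ2.
  exists (@Location _ _ (sum_inductive S) _ _ gin _ (A, B) (ka, kb) τ τ
    (fam2 (P := fun j => hom (fam2 (P := fun=> S) _ _ j) (fam2 (P := fun=> S) _ _ j)) (emap α) (emap β))).
  split; first by exists α, β.
  move=> [[ka' kb'] τ' y' x'] /= [α' [β' [[cα' cβ' oα' oβ'] [ey ex]]]]; subst y' x'.
  have ea : existT (fun k => hom Γ (univ k)) ka τa = existT _ ka' (fst (projT2 (V (ka', kb'))) ∘ τ').
    by apply: (type_unique ca oa (lc _ _ _ _ _ _ _ cα')); rewrite over_comp over_lift oα'.
  have eb : existT (fun k => hom Γ (univ k)) kb τb = existT _ kb' (snd (projT2 (V (ka', kb'))) ∘ τ').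
    by apply: (type_unique cb ob (lc _ _ _ _ _ _ _ cβ')); rewrite over_comp over_lift oβ'.
  have eka : ka = ka' := f_equal (@projT1 _ _) ea; have ekb : kb = kb' := f_equal (@projT1 _ _) eb.
  subst ka' kb'; have {}ea := inj_pair2 _ _ _ _ _ ea; have {}eb := inj_pair2 _ _ _ _ _ eb.
  have eτ : τ = τ' by apply: uτ; rewrite ea eb.
  subst τ'; have eα : α' = α by apply: canon_unique; rewrite ?oα ?oα'.
  have eβ : β' = β by apply: canon_unique; rewrite ?oβ ?oβ' ?oα.
  by subst α' β'; rewrite oα.
- rewrite /R => Γ Δ [A B] [k τ y x] σ /= [a [b [[ca cb oa ob] [ey ex]]]]; subst y x.
  exists (tcomp a (lift A σ)), (tcomp b (lift B σ)); split.
    by rewrite !over_comp !over_lift oa ob; split=> //; apply: canon_comp.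
  split=> //; apply: functional_extensionality_dep.
  by case=> [[[]|]|] /=; rewrite emap_comp.
Qed.

Lemma id_inputs : inhabited (generic_inputs (id_inductive S)).
Proof.
pose gin (k : code U) : input (id_inductive S) (univ k) := gen k.
pose R Γ (i : input (id_inductive S) Γ) (l : location gin i) :=
  exists (a : tmap (i : ty S Γ) (gen (loc_k l))),
  [/\ canon a, tover a = loc_map l, loc_y l = rpair (cart_wk_eq (erefl (tover a))) & loc_x l =
    fam1 (P := fun j => hom (fam1 (P := fun=> S) _ j) (fam1 (P := fun=> S) _ j)) (emap a)].
exists; apply: (@GenericInputs _ _ (id_inductive S) _ _ gin R).
- rewrite /R => Γ A [k τ y x] /= [a [ca oa -> ->]]; split=> [|[[]|]] /=.
    by rewrite -oa; apply: cart_wk_pullback; apply: canon_cart.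
  rewrite cart_wk_diag -!mcompA /diag !disp_rpair !comp_idr; split=> //.
  exact: cart_pullback (canon_cart ca) oa.
- rewrite /R => Γ A; have [[k τ] [/= [a [ca oa]] _]] := named U A.
  exists (@Location _ _ (id_inductive S) _ _ gin _ A k τ (rpair (cart_wk_eq (erefl (tover a))))
    (fam1 (P := fun j => hom (fam1 (P := fun=> S) _ j) (fam1 (P := fun=> S) _ j)) (emap a))).
  split; first by exists a.
  move=> [k' τ' y' x'] /= [a' [ca' oa' ey ex]]; subst y' x'.
  have e := type_unique ca oa ca' oa'.
  have ek : k = k' := f_equal (@projT1 _ _) e; subst k'.
  have {}e := inj_pair2 _ _ _ _ _ e; subst τ'.
  have ea : a' = a by apply: canon_unique; rewrite ?oa.
  by subst a' τ.
- rewrite /R => Γ Δ A [k τ y x] σ /= [a [ca oa ey ex]]; subst y x.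
  exists (tcomp a (lift A σ)).
  split=> /=; [by apply: canon_comp|by rewrite over_comp over_lift oa|exact: cart_wk_lift|].
  apply: functional_extensionality_dep.
  by case=> [[]|] /=; rewrite emap_comp.
Qed.

Lemma sig_inputs : inhabited (generic_inputs (sig_inductive S)).
Proof.
have [F] := family_universes_exist Ssplit LF U.
pose gin (k : fcode F) : input (sig_inductive S) (funiv k) := existT _ (fgenA k) (fgenB k).
pose R Γ (i : input (sig_inductive S) Γ) (l : location gin i) :=
  exists (a : tmap (projT1 i) (fgenA (loc_k l))) (b : tmap (projT2 i) (fgenB (loc_k l))),
  [/\ canon a, canon b, tover a = loc_map l & tover b = emap a] /\
  [/\ loc_y l = loc_map l & loc_x l =
    fam1 (P := fun j => hom (fam1 (P := fun=> S) _ j) (fam1 (P := fun=> S) _ j)) (emap b)].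
exists; apply: (@GenericInputs _ _ (sig_inductive S) _ _ gin R).
- rewrite /R => Γ [A B] [k τ y x] /= [a [b [[ca cb oa ob] [-> ->]]]]; split=> [|[[]|]] /=.
    exact: id_pullback.
  rewrite !comp_idl -mcompA disp_emap ob !mcompA disp_emap oa; split=> //.
  apply/pullback_sym/(pullback_paste (pullback_sym (cart_pullback (canon_cart ca) oa))).
  exact/pullback_sym/(cart_pullback (canon_cart cb)).
- rewrite /R => Γ [A B]; have [[k τ] [/= [a [b [ca cb oa ob]]] _]] := fnamed F B.
  exists (@Location _ _ (sig_inductive S) _ _ gin _ (existT _ A B) k τ τ
    (fam1 (P := fun j => hom (fam1 (P := fun=> S) _ j) (fam1 (P := fun=> S) _ j)) (emap b))).
  split; first by exists a, b.
  move=> [k' τ' y' x'] /= [a' [b' [[ca' cb' oa' ob'] [ey ex]]]]; subst y' x'.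
  have e := family_unique ca cb oa ob ca' cb' oa' ob'.
  have ek : k = k' := f_equal (@projT1 _ _) e; subst k'.
  have {}e := inj_pair2 _ _ _ _ _ e; subst τ'.
  have ea : a' = a by apply: canon_unique; rewrite ?oa.
  by subst a'; have eb : b' = b by [apply: canon_unique; rewrite ?ob]; subst b'; rewrite oa.
- rewrite /R => Γ Δ [A B] [k τ y x] σ /= [a [b [[ca cb oa ob] [ey ex]]]]; subst y x.
  exists (tcomp a (lift A σ)), (tcomp b (lift B (qmap σ A))); split.
    rewrite !over_comp !over_lift oa ob; split=> //; try exact: canon_comp.
    by rewrite emap_comp.
  split=> //; apply: functional_extensionality_dep.
  by case=> [[]|] /=; rewrite emap_comp.
Qed.

End GenericInputs.

(** * The split replacement *)

Section Replacement.
Context (C : compcat).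

Local Notation "C '!'" := (split_replacement C) (at level 1, format "C '!'").

(** Once [V] and [E] agree, an equation between types of the replacement is one between names; the
    arrows then agree because the cartesian [h] can be cancelled. *)
Lemma lu_sig_eq (Γ Δ V : C) (E : ty C V) (m m' : hom Γ V) (B : ty C Δ)
    (f : tmap E.[m] B) (g : tmap E.[m'] B) (h : tmap B E) :
  m = m' -> is_cartesian h -> tcomp h f = lift E m -> tcomp h g = lift E m' ->
  tover f = tover g ->
  existT (fun A : lu_ty Γ => tmap (lu_val A) B) (LuTy E m) f = existT _ (LuTy E m') g.
Proof.
move=> em; case: m' / em g => g ch hf hg o; congr existT.
have e : tover (lift E m) = tover h ∘ tover f by rewrite -hf over_comp.
have [k [_ u]] := ch _ _ _ _ e.
by rewrite -(u f) // (u g).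
Qed.

Lemma lu_liftK (Γ Δ : C) (A : lu_ty Γ) (σ : hom Δ Γ) :
  tcomp (lift (lu_fam A) (lu_name A)) (lu_lift A σ) = lift (lu_fam A) (lu_name A ∘ σ).
Proof. exact: tfactorK. Qed.

Lemma replacement_split : is_split C!.
Proof.
split=> [Γ [V E n]|Γ Δ Θ [V E n] σ τ]; apply: (lu_sig_eq (h := lift E n)).
- by rewrite comp_idr.
- exact: lift_cartesian.
- exact: (lu_liftK (LuTy E n)).
- exact: tcomp_idr.
- exact: etrans (over_lu_lift (LuTy E n) _) (esym (over_id _)).
- by rewrite mcompA.
- exact: lift_cartesian.
- exact: (lu_liftK (LuTy E n)).
- exact: etrans (tcompA _ _ _) (etrans (f_equal (fun f => tcomp f _) (lu_liftK (LuTy E n) σ))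
    (lu_liftK (LuTy E (n ∘ σ)) τ)).
- have o (X Y : C) (A : lu_ty Y) (ρ : hom X Y) := over_lift (c := C!) A ρ.
  have oc := over_comp (lift (c := C!) (LuTy E n : ty C! Γ) σ) (lift (LuTy E n : ty C! Γ).[σ] τ).
  by rewrite !o in oc; exact: etrans (o _ _ (LuTy E n) (σ ∘ τ)) (esym oc).
Qed.

Lemma replacement_full : is_full C -> is_full C!.
Proof. by move=> h Γ Δ A B σ u; apply: h. Qed.

Lemma replacement_display (X Y : C) (f : hom X Y) :
  is_display (S := C!) f -> is_display f.
Proof.
elim=> [Γ A|X' Y' Z' g f' _ hg _ hf]; first exact: (display_disp (lu_val A)).
exact: (display_comp hg hf).
Qed.

Lemma replacement_LF : condition_LF C -> condition_LF C!.
Proof.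
move=> [P LF]; split=> // X Y Z f g /replacement_display hf hg.
by apply: LF => //; case: hg => [/replacement_display|]; auto.
Qed.

(** Uniqueness holds because the components can be read off from a type: the generic type reindexed
    along [n] has the name [idm V ∘ n], which is [n]. *)
Lemma replacement_universes : local_universes C!.
Proof.
pose g (k : {V : C & ty C V}) : ty C! (projT1 k) := LuTy (projT2 k) (idm (projT1 k)).
apply: (@LocalUniverses C! _ (@projT1 _ _) g) => Γ [V E n].
exists (existT _ (existT _ V E) n); split.
  have e := f_equal (fun m => LuTy E m) (comp_idl n).
  suff : exists f : tmap (t := Defs.total C!) (reix (c := C!) (g (existT _ V E)) n) (g (existT _ V E)),
      canon f /\ tover f = n by rewrite {1}/reix /= /lu_reix /= e.
  exists (lift (c := C!) (g (existT _ V E)) n).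
  by split; [exact: canon_lift|exact: (over_lift (c := C!))].
move=> [[V' E'] n'] [f [cf /= of_]].
have e : LuTy E n = LuTy E' (idm V' ∘ n') := etrans (f_equal (@projT1 _ _) (canon_sig cf))
  (f_equal (reix (c := C!) (g (existT _ V' E'))) of_).
have := f_equal (fun A : @lu_ty C Γ => existT (fun k : {V : C & ty C V} => hom Γ (projT1 k))
  (existT (fun V : C => ty C V) (lu_base A) (lu_fam A)) (lu_name A)) e.
by rewrite /= comp_idl.
Qed.

(** A type of the replacement has the comprehension of its value, so its lifting problems are
    literally problems in [C]. *)
Lemma replacement_lifting (V : C) (J : Type) (s : shape V J) :
  stably_lifting (S := C) s -> stably_lifting (S := C!) s.
Proof. by move=> h Γ τ s' e x pb M c hc; apply: (h Γ τ s' e x pb (lu_val M) c hc). Qed.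

(** The type of [D] becomes a type of the replacement named by an identity. Its value is E[id]
    instead of E, so the constructors are corrected by the inverse [j] of the comparison. The frames
    may also differ by an isomorphism [y], as they do for identity types. *)
Lemma replacement_data (J : Type) (K : inductive_former C J) (K' : inductive_former C! J)
    (Γ : C) (i : input K Γ) (i' : input K' Γ) y x :
  @shape_pull C _ _ _ (idm Γ) (frame K' i') (frame K i) y x ->
  (exists D : data i, stably_lifting (dshape D)) ->
  exists D : data i', stably_lifting (dshape D).
Proof.
move=> pb [D hD]; set T := dty D.
have [j [j1 j2]] : is_iso (emap (lift T (idm _))).
  apply: (pullback_iso (cart_pullback (lift_cartesian _ _) (over_lift _ _))); exact: iso_id.
pose T' : ty C! (sh_ob (frame K i)) := LuTy T (idm _).
have [k|D' [t [ct ot ht]]] := @data_over _ _ K' _ i' _ T' y (fun k => j ∘ (dcon K D k ∘ x k)).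
  have -> : disp T' ∘ (j ∘ (dcon K D k ∘ x k)) = disp T ∘ (emap (lift T (idm _)) ∘ j ∘ (dcon K D k ∘ x k)).
    by rewrite !mcompA disp_emap over_lift comp_idl.
  by rewrite j2 comp_idl mcompA dcon_over (proj2 (proj2 pb k)).
exists D'.
apply: (@stably_lifting_pull C! Γ Γ J (idm Γ) (dshape D) (dshape D')
  (emap (lift T (idm _)) ∘ emap (c := C!) t) x); last exact: replacement_lifting.
split=> [|k] /=.
  have p1 := cart_pullback (canon_cart ct) ot.
  have p2 := cart_pullback (lift_cartesian T (idm _)) (over_lift _ _).
  have p3 := pullback_paste p2 p1; rewrite comp_idl in p3.
  exact/pullback_sym/(pullback_paste (pullback_sym (proj1 pb)))/pullback_sym.
have o : disp (lu_val (dty D')) ∘ dcon K' D' k = sh_con (frame K' i') k := dcon_over D' k.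
have e : emap (c := C) t ∘ dcon K' D' k = j ∘ (dcon K D k ∘ x k) := ht k.
rewrite -!mcompA o dcon_over; split; first by case: (proj2 pb k).
by rewrite e mcompA j2 comp_idl.
Qed.

Lemma shape_pull_id (V : C) (J : Type) (s : shape V J) :
  @shape_pull C _ _ _ (idm V) s s (idm _) (fun j => idm _).
Proof.
split=> [|j]; first exact/pullback_sym/id_pullback.
by rewrite comp_idl comp_idr; split=> //; exact/pullback_sym/id_pullback.
Qed.
End Replacement.

(** * Inductive formers in the split replacement *)

Section InductiveModels.
Context (C : compcat) (C_full : is_full C) (LF : condition_LF C).

Local Notation "C '!'" := (split_replacement C) (at level 1, format "C '!'").

Lemma inductive_models (J : Type) (K : inductive_former C J) (K' : inductive_former C! J) :
  (forall (V : C!) (s : shape V J) (Θ : C!) (T : ty C! Θ), shape_tame (S := C!) s ->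
    inhabited (gen_cone s T)) ->
  inhabited (generic_inputs K') ->
  (forall (Γ : C) (i' : input K' Γ), exists (i : input K Γ) y x,
    @shape_pull C _ _ _ (idm Γ) (frame K' i') (frame K i) y x) ->
  weakly_stable K -> models_with K'.
Proof.
move=> cones [G] frames wK; split.
- exact: replacement_full.
- exact: replacement_split.
- by case: LF => -[].
- apply: (inductive_strictly_stable (@replacement_split C) (replacement_universes C) G cones).
  move=> Γ i'; have [i [y [x pb]]] := frames Γ i'.
  exact: replacement_data pb (weakly_stable_lifting wK i).
Qed.

Let LF' := replacement_LF LF.
Let split' := @replacement_split C.
Let univ' := replacement_universes C.

Let cones1 (V : C!) (s : shape V (option Empty_set)) (Θ : C!) (T : ty C! Θ) :
  shape_tame (S := C!) s -> inhabited (gen_cone s T).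
Proof.
move=> h; apply: (gen_cone_option LF') => //; apply: (gen_cone0 LF').
by case: h => h1 h2; split=> // -[].
Qed.

Let cones2 (V : C!) (s : shape V (option (option Empty_set))) (Θ : C!) (T : ty C! Θ) :
  shape_tame (S := C!) s -> inhabited (gen_cone s T).
Proof.
move=> h; apply: (gen_cone_option LF') => //; apply: cones1.
by case: h => h1 h2; split=> // j; exact: (h2 (Some j)).
Qed.

Lemma sum_models : weakly_stable (sum_former C) -> models_with (sum_former C!).
Proof.
apply: (inductive_models (K := sum_inductive C) (K' := sum_inductive C!) cones2).
  exact: sum_inputs.
move=> Γ [A B]; exists (lu_val A, lu_val B), (idm _), (fun j => idm _).
exact: shape_pull_id.
Qed.

Lemma zero_models : weakly_stable (zero_former C) -> models_with (zero_former C!).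
Proof.
apply: (inductive_models (K := zero_inductive C) (K' := zero_inductive C!) (gen_cone0 LF')).
  exact: zero_inputs.
by move=> Γ []; exists tt, (idm _), (fun j => idm _); exact: shape_pull_id.
Qed.

Lemma unit_models : weakly_stable (unit_former C) -> models_with (unit_former C!).
Proof.
apply: (inductive_models (K := unit_inductive C) (K' := unit_inductive C!) cones1).
  exact: unit_inputs.
by move=> Γ []; exists tt, (idm _), (fun j => idm _); exact: shape_pull_id.
Qed.

Lemma sig_models : weakly_stable (sig_former C) -> models_with (sig_former C!).
Proof.
apply: (inductive_models (K := sig_inductive C) (K' := sig_inductive C!) cones1).
  exact: sig_inputs.
move=> Γ [A B].
exists (existT (fun A => ty C (ext A)) (lu_val A) (lu_val B)), (idm _), (fun j => idm _).
exact: shape_pull_id.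
Qed.

(** Reindexing in the replacement yields E[n ∘ σ], reindexing the value yields E[n][σ]; both are
    cartesian over the same map, hence isomorphic. The two frames of the identity type differ by
    this comparison. *)
Lemma lu_weaken (Γ Δ : C) (T : lu_ty Γ) (σ : hom Δ Γ) :
  exists t : tmap (lu_val (lu_reix T σ)) (lu_val T).[σ],
    [/\ is_cartesian t, tover t = idm Δ & tcomp (lift (lu_val T) σ) t = lu_lift T σ].
Proof.
apply: cart_factor; [exact: lu_lift_cartesian|exact: lift_cartesian|].
by rewrite over_lu_lift over_lift comp_idr.
Qed.

Lemma id_models : weakly_stable (id_former C) -> models_with (id_former C!).
Proof.
apply: (inductive_models (K := id_inductive C) (K' := id_inductive C!) cones1).
  exact: id_inputs.
move=> Γ A; have [t [ct ot tK]] := lu_weaken A (disp (lu_val A)).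
have pb : is_pullback (emap t) (disp (lu_val (lu_reix A (disp (lu_val A)))))
  (disp (lu_val A).[disp (lu_val A)]) (idm _) by apply: cart_pullback.
have dK : disp (lu_val A) ∘ (disp (lu_val (lu_reix A (disp (lu_val A)))) ∘ diag (S := C!) A)
    = disp (lu_val A).
  by rewrite /diag (disp_rpair (S := C!)) comp_idr.
exists (lu_val A), (emap t), (fun j => idm _); split=> [|[[]|]] /=.
  exact/pullback_sym/(pullback_paste (id_pullback (disp (lu_val A))))/pullback_sym.
split.
  by rewrite -!mcompA dK /diag disp_rpair comp_idr; exact/pullback_sym/id_pullback.
rewrite comp_idr; apply: reix_hom_ext.
  rewrite mcompA -emap_comp tK /diag q_rpair; exact: (q_rpair (S := C!)).
rewrite mcompA (proj1 pb) comp_idl /diag disp_rpair; exact: (disp_rpair (S := C!)).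
Qed.

End InductiveModels.

(** * Π-types *)

Lemma cart_id (S : compcat) (Γ : S) (A : ty S Γ) : is_cartesian (tid A).
Proof.
move=> Θ X g τ; rewrite over_id comp_idl => e.
exists g; split; first by rewrite tcomp_idl.
by move=> k [_]; rewrite tcomp_idl.
Qed.

Lemma cart_iso (S : compcat) (Γ : S) (A B : ty S Γ) (f : tmap A B) :
  is_cartesian f -> tover f = idm Γ -> is_iso (emap f).
Proof. by move=> cf of_; apply: pullback_iso (cart_pullback cf of_) (iso_id _). Qed.

Section Application.
Context {S : compcat}.

(* [papp] is application in an arbitrary context, in which the choice of the
   weakening [pi_ty.[disp A]] no longer appears. *)
Definition papp (Γ : S) (A : ty S Γ) (B : ty S (ext A)) (D : pi_data B) (X : S)
    (x : hom X (ext A)) (f : hom X (ext (pi_ty D))) (e : disp (pi_ty D) ∘ f = disp A ∘ x) :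
    hom X (ext B) :=
  pi_app D ∘ rpair e.

Lemma disp_papp (Γ : S) (A : ty S Γ) (B : ty S (ext A)) (D : pi_data B) (X : S)
    (x : hom X (ext A)) (f : hom X (ext (pi_ty D))) (e : disp (pi_ty D) ∘ f = disp A ∘ x) :
  disp B ∘ papp e = x.
Proof. by rewrite mcompA pi_app_over disp_rpair. Qed.

Lemma papp_comp (Γ : S) (A : ty S Γ) (B : ty S (ext A)) (D : pi_data B) (X Y : S)
    (h : hom Y X) (x : hom X (ext A)) (f : hom X (ext (pi_ty D)))
    (x' : hom Y (ext A)) (f' : hom Y (ext (pi_ty D)))
    (e : disp (pi_ty D) ∘ f = disp A ∘ x) (e' : disp (pi_ty D) ∘ f' = disp A ∘ x') :
  x ∘ h = x' -> f ∘ h = f' -> papp e ∘ h = papp e'.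
Proof.
move=> ex ef; rewrite /papp -mcompA; congr (_ ∘ _); apply: reix_hom_ext.
  by rewrite mcompA !q_rpair.
by rewrite mcompA !disp_rpair.
Qed.

Lemma papp_eq (Γ : S) (A : ty S Γ) (B : ty S (ext A)) (D : pi_data B) (X : S)
    (x x' : hom X (ext A)) (f f' : hom X (ext (pi_ty D)))
    (e : disp (pi_ty D) ∘ f = disp A ∘ x) (e' : disp (pi_ty D) ∘ f' = disp A ∘ x') :
  x = x' -> f = f' -> papp e = papp e'.
Proof. by move=> ex ef; rewrite -[papp e]comp_idr; apply: papp_comp; rewrite comp_idr. Qed.

Lemma papp_app (Γ : S) (A : ty S Γ) (B : ty S (ext A)) (D : pi_data B) :
  papp (disp_q (disp A) (pi_ty D)) = pi_app D.
Proof.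
rewrite /papp -[RHS]comp_idr; congr (_ ∘ _); apply: reix_hom_ext.
  by rewrite q_rpair comp_idr.
by rewrite disp_rpair comp_idr.
Qed.

Lemma abs_eq (Γ : S) (A P : ty S Γ) (s : section P) (X : S) (x : hom X (ext A)) :
  disp P ∘ (sval s ∘ (disp A ∘ x)) = disp A ∘ x.
Proof. by rewrite mcompA section_id comp_idl. Qed.

Lemma abstractionP (Γ : S) (A : ty S Γ) (B : ty S (ext A)) (D : pi_data B) (b : section B)
    (s : section (pi_ty D)) :
  is_abstraction b s <-> papp (abs_eq s (idm (ext A))) = sval b.
Proof.
suff -> : papp (abs_eq s (idm (ext A))) = pi_app D ∘ sval (reix_section s (disp A)) by [].
congr (_ ∘ _); apply: reix_hom_ext.
  by rewrite q_rpair q_reix_section comp_idr.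
by rewrite disp_rpair section_id.
Qed.

(** Preservation of application, stated on generalized elements so that the weakenings of the two
    Π-types, which depend on the cleaving, stay hidden. *)
Definition app_compat (Γ Δ : S) (A' : ty S Δ) (B' : ty S (ext A')) (D' : pi_data B')
    (A : ty S Γ) (B : ty S (ext A)) (D : pi_data B)
    (a : tmap A' A) (b : tmap B' B) (p : tmap (pi_ty D') (pi_ty D)) : Prop :=
  forall (X : S) (x : hom X (ext A')) (f : hom X (ext (pi_ty D')))
    (e' : disp (pi_ty D') ∘ f = disp A' ∘ x)
    (e : disp (pi_ty D) ∘ (emap p ∘ f) = disp A ∘ (emap a ∘ x)),
  emap b ∘ papp e' = papp e.

Section Compat.
Context {Γ Δ : S} {A' : ty S Δ} {B' : ty S (ext A')} {D' : pi_data B'}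
  {A : ty S Γ} {B : ty S (ext A)} {D : pi_data B}
  {a : tmap A' A} {b : tmap B' B} {p : tmap (pi_ty D') (pi_ty D)} (e : tover p = tover a).

Lemma compat_eq (X : S) (x : hom X (ext A')) (f : hom X (ext (pi_ty D'))) :
  disp (pi_ty D') ∘ f = disp A' ∘ x ->
  disp (pi_ty D) ∘ (emap p ∘ f) = disp A ∘ (emap a ∘ x).
Proof. by move=> h; rewrite !mcompA !disp_emap e -!mcompA h. Qed.

Lemma app_compatP :
  app_compat a b p <-> emap b ∘ pi_app D' = pi_app D ∘ rpair (cart_wk_eq e).
Proof.
split=> h.
  by rewrite -papp_app (h _ _ _ _ (compat_eq (disp_q _ _))); apply: papp_eq.
move=> X x f e1 e2; rewrite /papp mcompA h -mcompA; congr (_ ∘ _); apply: reix_hom_ext.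
  by rewrite mcompA !q_rpair -mcompA q_rpair.
by rewrite mcompA !disp_rpair -mcompA disp_rpair.
Qed.

Lemma compat_abs_eq (s' : section (pi_ty D')) (s : section (pi_ty D)) :
  app_compat a b p -> emap p ∘ sval s' = sval s ∘ tover a ->
  emap b ∘ papp (abs_eq s' (idm (ext A'))) = papp (abs_eq s (idm (ext A))) ∘ emap a.
Proof.
move=> h es; rewrite (h _ _ _ _ (compat_eq (abs_eq _ _))).
symmetry; apply: papp_comp; first by rewrite comp_idl comp_idr.
by rewrite !comp_idr mcompA es -!mcompA disp_emap.
Qed.

Lemma abstraction_pull (b' : section B') (s' : section (pi_ty D')) (b0 : section B)
    (s : section (pi_ty D)) : app_compat a b p -> is_cartesian b ->
  emap b ∘ sval b' = sval b0 ∘ emap a -> emap p ∘ sval s' = sval s ∘ tover a ->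
  is_abstraction b0 s -> is_abstraction b' s'.
Proof.
move=> h cb eb es /abstractionP ab; apply/abstractionP; apply: (cart_hom_ext cb).
  by rewrite (compat_abs_eq h es) ab eb.
by rewrite disp_papp section_id.
Qed.

(** The β-law for [s] is obtained only after composition with [emap a], so this direction needs
    [emap a] to be epi. *)
Lemma abstraction_push (b' : section B') (s' : section (pi_ty D')) (b0 : section B)
    (s : section (pi_ty D)) : app_compat a b p -> is_iso (emap a) ->
  emap b ∘ sval b' = sval b0 ∘ emap a -> emap p ∘ sval s' = sval s ∘ tover a ->
  is_abstraction b' s' -> is_abstraction b0 s.
Proof.
move=> h ia eb es /abstractionP ab; apply/abstractionP; apply: (iso_epi ia).
by rewrite -(compat_abs_eq h es) ab.
Qed.

End Compat.

Lemma app_compat_comp (Γ Δ Θ : S) (A'' : ty S Θ) (B'' : ty S (ext A'')) (D'' : pi_data B'')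
    (A' : ty S Δ) (B' : ty S (ext A')) (D' : pi_data B')
    (A : ty S Γ) (B : ty S (ext A)) (D : pi_data B)
    (a : tmap A' A) (b : tmap B' B) (p : tmap (pi_ty D') (pi_ty D))
    (a' : tmap A'' A') (b' : tmap B'' B') (p' : tmap (pi_ty D'') (pi_ty D')) :
  tover p' = tover a' -> app_compat a b p -> app_compat a' b' p' ->
  app_compat (tcomp a a') (tcomp b b') (tcomp p p').
Proof.
move=> op h h' X x f e' e.
have e2 : disp (pi_ty D) ∘ (emap p ∘ (emap p' ∘ f)) = disp A ∘ (emap a ∘ (emap a' ∘ x)).
  by move: e; rewrite !emap_comp -!mcompA.
rewrite emap_comp -mcompA (h' _ _ _ _ (compat_eq op e')) (h _ _ _ _ e2).
by apply: papp_eq; rewrite emap_comp mcompA.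
Qed.

Lemma app_compat_cancel (Γ Δ Θ : S) (A'' : ty S Θ) (B'' : ty S (ext A'')) (D'' : pi_data B'')
    (A' : ty S Δ) (B' : ty S (ext A')) (D' : pi_data B')
    (A : ty S Γ) (B : ty S (ext A)) (D : pi_data B)
    (a : tmap A' A) (b : tmap B' B) (p : tmap (pi_ty D') (pi_ty D))
    (a' : tmap A'' A') (b' : tmap B'' B') (p' : tmap (pi_ty D'') (pi_ty D')) :
  is_cartesian b -> tover p = tover a -> tover p' = tover a' -> tover b' = emap a' ->
  app_compat a b p -> app_compat (tcomp a a') (tcomp b b') (tcomp p p') ->
  app_compat a' b' p'.
Proof.
move=> cb op op' ob' h h2 X x f e' e; apply: (cart_hom_ext cb).
  have e2 := compat_eq op e; rewrite (h _ _ _ _ e2) mcompA -emap_comp.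
  have e3 : disp (pi_ty D) ∘ (emap (tcomp p p') ∘ f) = disp A ∘ (emap (tcomp a a') ∘ x).
    by rewrite !emap_comp -!mcompA.
  by rewrite (h2 _ _ _ _ e3); apply: papp_eq; rewrite emap_comp mcompA.
by rewrite disp_papp mcompA disp_emap ob' -mcompA disp_papp.
Qed.

Lemma app_compat_reix (Γ Δ : S) (A : ty S Γ) (B : ty S (ext A)) (D : pi_data B) (σ : hom Δ Γ) :
  app_compat (D' := pi_data_reix D σ) (lift A σ) (lift B (qmap σ A)) (lift (pi_ty D) σ).
Proof.
have e : tover (lift (pi_ty D) σ) = tover (lift A σ) by rewrite !over_lift.
apply/(app_compatP (D' := pi_data_reix D σ) e) => /=.
rewrite [LHS]q_rpair; congr (_ ∘ _); apply: reix_hom_ext.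
  by rewrite !q_rpair.
by rewrite !disp_rpair.
Qed.

Lemma app_compat_id (Γ : S) (A : ty S Γ) (B : ty S (ext A)) (D : pi_data B) :
  app_compat (tid A) (tid B) (tid (pi_ty D)).
Proof.
by move=> X x f e' e; rewrite emap_id comp_idl; apply: papp_eq; rewrite emap_id comp_idl.
Qed.

Lemma pi_reindexingP (Γ Δ : S) (σ : hom Δ Γ) (A' : ty S Δ) (B' : ty S (ext A')) (D' : pi_data B')
    (A : ty S Γ) (B : ty S (ext A)) (D : pi_data B) :
  pi_reindexing σ D' D <-> exists (a : tmap A' A) (b : tmap B' B) (p : tmap (pi_ty D') (pi_ty D)),
    [/\ is_cartesian a, is_cartesian b & is_cartesian p] /\
    [/\ tover a = σ, tover b = emap a, tover p = tover a & app_compat a b p].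
Proof.
split=> [[a [b [p [e [h [oa ob k]]]]]]|[a [b [p [h [oa ob e k]]]]]].
  by exists a, b, p; split=> //; split=> //; apply/(app_compatP e).
by exists a, b, p, e; split=> //; split=> //; apply/(app_compatP e).
Qed.

Lemma pi_reindexing_comp (Γ Δ Θ : S) (σ : hom Δ Γ) (τ : hom Θ Δ)
    (A'' : ty S Θ) (B'' : ty S (ext A'')) (D'' : pi_data B'')
    (A' : ty S Δ) (B' : ty S (ext A')) (D' : pi_data B')
    (A : ty S Γ) (B : ty S (ext A)) (D : pi_data B) :
  pi_reindexing σ D' D -> pi_reindexing τ D'' D' -> pi_reindexing (σ ∘ τ) D'' D.
Proof.
move=> /pi_reindexingP [a [b [p [[ca cb cp] [oa ob op h]]]]].
move=> /pi_reindexingP [a' [b' [p' [[ca' cb' cp'] [oa' ob' op' h']]]]].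
apply/pi_reindexingP; exists (tcomp a a'), (tcomp b b'), (tcomp p p').
split; first by split; apply: tcomp_cartesian.
split; last exact: app_compat_comp.
- by rewrite over_comp oa oa'.
- by rewrite over_comp emap_comp ob ob'.
- by rewrite !over_comp op op'.
Qed.

Lemma pi_reindexing_id (Γ : S) (A : ty S Γ) (B : ty S (ext A)) (D : pi_data B) :
  pi_reindexing (idm Γ) D D.
Proof.
apply/pi_reindexingP; exists (tid A), (tid B), (tid (pi_ty D)).
split; first by split; apply: cart_id.
by split; rewrite ?over_id ?emap_id //; apply: app_compat_id.
Qed.

Lemma pi_reindexing_reix (Γ Δ : S) (A : ty S Γ) (B : ty S (ext A)) (D : pi_data B)
    (σ : hom Δ Γ) : pi_reindexing σ (pi_data_reix D σ) D.
Proof.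
apply/pi_reindexingP; exists (lift A σ), (lift B (qmap σ A)), (lift (pi_ty D) σ).
split; first by split; apply: lift_cartesian.
by split; rewrite ?over_lift //; apply: app_compat_reix.
Qed.

Lemma pi_reindexing_factor (Γ Δ : S) (σ : hom Δ Γ)
    (A1 : ty S Δ) (B1 : ty S (ext A1)) (D1 : pi_data B1)
    (A2 : ty S Δ) (B2 : ty S (ext A2)) (D2 : pi_data B2)
    (A : ty S Γ) (B : ty S (ext A)) (D : pi_data B) :
  pi_reindexing σ D1 D -> pi_reindexing σ D2 D -> pi_reindexing (idm Δ) D1 D2.
Proof.
move=> /pi_reindexingP [a [b [p [[ca cb cp] [oa ob op h]]]]].
move=> /pi_reindexingP [a' [b' [p' [[ca' cb' cp'] [oa' ob' op' h']]]]].
have [|a1 [ca1 oa1 a1K]] := cart_factor (σ := idm Δ) ca ca'; first by rewrite comp_idr oa.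
have [|b1 [cb1 ob1 b1K]] := cart_factor (σ := emap a1) cb cb'.
  by rewrite ob ob' -emap_comp a1K.
have [|p1 [cp1 op1 p1K]] := cart_factor (σ := idm Δ) cp cp'.
  by rewrite comp_idr op op' oa.
apply/pi_reindexingP; exists a1, b1, p1; split; first by split.
split=> //; first by rewrite op1.
apply: (app_compat_cancel cb' op') => //; first by rewrite op1.
by rewrite a1K b1K p1K.
Qed.

(** The class consists of all Π-data whose reindexings, along any cartesian arrows, admit
    λ-abstractions; it is closed under reindexing by construction. Thanks to it [strict_pi] serves
    both Π-types and W-types. *)
Lemma weakly_stable_pi_class : weakly_stable (pi_former S) ->
  exists Cl : pi_class S, stable_pi_class Cl.
Proof.
move=> w.
exists (fun Γ A B D => forall (Δ : S) (σ : hom Δ Γ) (A' : ty S Δ) (B' : ty S (ext A'))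
  (D' : pi_data B'), pi_reindexing σ D' D ->
  forall b : section B', exists s : section (pi_ty D'), is_abstraction b s).
split=> [Γ A B D h b|Γ Δ σ A' B' D' A B D r h Θ τ A'' B'' D'' r'|Γ A B].
- exact: h (pi_reindexing_id D) b.
- exact: h (pi_reindexing_comp r r').
- have [D hD] := w Γ (existT _ A B); exists D => Δ σ A' B' D' r b.
  (* Weak stability solves the problem for the reindexing given by the cleaving, which is isomorphic
     to [D'] over the identity. *)
  have /pi_reindexingP [a [b1 [p [[ca cb cp] [oa ob op h]]]]] :=
    pi_reindexing_factor (pi_reindexing_reix D σ) r.
  have [s hs] := hD Δ σ (pull_section cb b).
  have es : disp (pi_ty D') ∘ (emap p ∘ sval s) = idm Δ.
    by rewrite mcompA disp_emap -mcompA section_id op oa comp_idl.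
  exists (mk_section es).
  apply: (abstraction_push op (s' := s) h _ _ _ hs).
    exact: cart_iso.
  by rewrite /= emap_cpair ob.
  by rewrite /= oa comp_idr.
Qed.

End Application.

Arguments app_compat_reix {S Γ Δ A B} D σ.
Arguments app_compat_id {S Γ A B} D.

(** * Strict Π-types in a split comprehension category *)

Section StrictPi.
Context {S : compcat} (Ssplit : is_split S) (LF : condition_LF S) (F : family_universes S).
Context {Cl : pi_class S} (hCl : stable_pi_class Cl).

(* The generic section of [B] over the contexts above [Γ], and an abstraction
   of it. *)
Record generic_section (Γ : S) (A : ty S Γ) (B : ty S (ext A)) (D : pi_data B) :=
  GenericSection {
  gs_ob : S;
  gs_map : hom gs_ob Γ;
  gs_sec : hom (ext A.[gs_map]) (ext B);
  gs_lam : hom gs_ob (ext (pi_ty D));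
  gs_lam_over : disp (pi_ty D) ∘ gs_lam = gs_map;
  gs_beta : forall (e : disp (pi_ty D) ∘ (gs_lam ∘ disp A.[gs_map]) = disp A ∘ qmap gs_map A),
    papp e = gs_sec;
  gs_univ : forall (Δ : S) (A' : ty S Δ) (a : tmap A' A), is_cartesian a ->
    forall b : hom (ext A') (ext B), disp B ∘ b = emap a ->
    exists! τ : hom Δ gs_ob, gs_map ∘ τ = tover a /\
      forall t, qmap gs_map A ∘ t = emap a -> disp A.[gs_map] ∘ t = τ ∘ disp A' ->
      gs_sec ∘ t = b }.

(** The exponential of [disp B] along [disp A] carries the universal section of [B]. Without η its
    λ-abstraction is not determined by it, so one is picked here, in the Π-type reindexed to the
    exponential, for all sections to restrict. *)
Lemma generic_section_exists (Γ : S) (A : ty S Γ) (B : ty S (ext A)) (D : pi_data B) :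
  Cl D -> inhabited (generic_section D).
Proof.
move=> hD.
have [U [u cl]] := LF_classifier (g := disp B) LF (or_introl (display_disp A))
  (or_introl (display_disp B)).
have [e [_ ed cle]] := cl _ _ _ (pullback_sym (reix_pullback A u)).
have es : disp B ∘ e = qmap u A ∘ idm _ by rewrite comp_idr.
have hDu := spc_reix hCl (pi_reindexing_reix D u) hD.
have [s hs] := spc_pi hCl hDu (mk_section (disp_rpair es)).
have eo : disp (pi_ty D) ∘ (qmap u (pi_ty D) ∘ sval s) = u.
  by rewrite mcompA disp_q -mcompA section_id comp_idr.
exists; apply: (GenericSection (gs_sec := e) eo).
  move=> e1; move/abstractionP: hs => /= hs.
  have := f_equal (mcomp (qmap (qmap u A) B)) hs; rewrite /= q_rpair => <-.
  have hc := app_compat_reix D u _ _ _ (abs_eq s (idm (ext A.[u]))).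
  have e2 : disp (pi_ty D) ∘ (qmap u (pi_ty D) ∘ (sval s ∘ (disp A.[u] ∘ idm (ext A.[u]))))
      = disp A ∘ (qmap u A ∘ idm (ext A.[u])).
    by rewrite !comp_idr -e1 !mcompA.
  by rewrite [RHS](hc e2); apply: papp_eq; rewrite ?comp_idr ?mcompA.
move=> Δ A' a ca b eb.
have [τ [[τ1 τ2] uτ]] := cle _ _ _ _ _ (pullback_sym (cartesian_pullback ca)) b eb.
exists τ; split; first by split=> // t t1 t2; apply: τ2.
by move=> τ' [τ1' τ2']; apply: uτ; split=> // t t1 t2; apply: τ2'.
Qed.

(** A canonical arrow fixes the Π-type, and a cartesian [b] fixes its evaluation map. *)
Lemma pi_data_ext (Γ Δ : S) (A : ty S Γ) (B : ty S (ext A)) (D D' : pi_data B)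
    (A0 : ty S Δ) (B0 : ty S (ext A0)) (D0 : pi_data B0) (a : tmap A A0) (b : tmap B B0)
    (p : tmap (pi_ty D) (pi_ty D0)) (p' : tmap (pi_ty D') (pi_ty D0)) :
  is_cartesian b -> canon p -> canon p' -> tover p = tover a -> tover p' = tover a ->
  app_compat a b p -> app_compat a b p' -> D = D'.
Proof.
move=> cb cp cp' op op'; have e : tover p = tover p' by rewrite op.
have := canon_sig_unique cp cp' e; case: D p op cp e => T app ov /= p op cp _.
case: D' p' op' cp' => T' app' ov' /= p' op' _ es.
have eT : T = T' := f_equal (@projT1 _ _) es; subst T'.
have ep := inj_pair2 _ (fun A => tmap A _) _ _ _ es; subst p' => h h'.
have ea : app = app'.
  apply: (cart_hom_ext cb); last by rewrite ov ov'.
  have := proj1 (app_compatP (D' := PiData ov) op) h.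
  by have := proj1 (app_compatP (D' := PiData ov') op) h' => /= -> ->.
by subst app'; rewrite (proof_irrelevance _ ov ov').
Qed.

(* [a], [b] locate [B] as the reindexing of the generic family [q]. *)
Definition family_at (Γ : S) (A : ty S Γ) (B : ty S (ext A)) (q : {k : fcode F & hom Γ (funiv k)})
    (a : tmap A (fgenA (projT1 q))) (b : tmap B (fgenB (projT1 q))) : Prop :=
  [/\ canon a, canon b, tover a = projT2 q & tover b = emap a].

(** Uniqueness in elimination form: a property of one location passes to any other, so that the
    dependent equations between codes, names and arrows are dealt with once. *)
Lemma family_at_unique (Γ : S) (A : ty S Γ) (B : ty S (ext A))
    (q q' : {k : fcode F & hom Γ (funiv k)}) (a : tmap A (fgenA (projT1 q)))
    (b : tmap B (fgenB (projT1 q))) (a' : tmap A (fgenA (projT1 q')))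
    (b' : tmap B (fgenB (projT1 q'))) (P : forall q (a : tmap A (fgenA (projT1 q)))
      (b : tmap B (fgenB (projT1 q))), Prop) :
  family_at a b -> family_at a' b' -> P q a b -> P q' a' b'.
Proof.
move=> h h'; have [q0 [_ uq]] := fnamed F B.
have eq : q = q'.
  by transitivity q0; [symmetry; apply: uq; exists a, b|apply: uq; exists a', b'].
case: q' / eq a' b' h' => a' b' h'; case: h => ca cb oa ob; case: h' => ca' cb' oa' ob'.
have ea : a = a' by apply: canon_unique; rewrite ?oa.
case: a' / ea ca' oa' ob' => _ _ ob'.
by have -> : b' = b by apply: canon_unique; rewrite ?ob'.
Qed.

Definition family_at_reix (Γ Δ : S) (q : {k : fcode F & hom Γ (funiv k)}) (σ : hom Δ Γ) :
  {k : fcode F & hom Δ (funiv k)} := existT _ (projT1 q) (projT2 q ∘ σ).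

Lemma family_at_comp (Γ Δ : S) (σ : hom Δ Γ) (A : ty S Γ) (B : ty S (ext A))
    (A' : ty S Δ) (B' : ty S (ext A')) (a' : tmap A' A) (b' : tmap B' B)
    (q : {k : fcode F & hom Γ (funiv k)})
    (a : tmap A (fgenA (projT1 q))) (b : tmap B (fgenB (projT1 q))) :
  canon a' -> canon b' -> tover a' = σ -> tover b' = emap a' -> family_at a b ->
  family_at (q := family_at_reix q σ) (tcomp a a') (tcomp b b').
Proof.
move=> ca' cb' oa' ob' [ca cb oa ob]; split; try exact: canon_comp.
  by rewrite over_comp oa oa'.
by rewrite over_comp ob ob' emap_comp.
Qed.

Lemma strict_pi : exists st : strictly_stable (pi_former S),
  forall (Γ : S) (A : ty S Γ) (B : ty S (ext A)), Cl (pi_form st B).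
Proof.
have /dep_choice [D0 hD0] := fun k => spc_exists hCl (fgenB (f := F) k).
have gs k : generic_section (D0 k).
  exact: (epsilon (generic_section_exists (hD0 k)) (fun=> True)).
pose over Γ (A : ty S Γ) (B : ty S (ext A)) (D : pi_data B) q a b
    (p : tmap (pi_ty D) (pi_ty (D0 (projT1 q)))) := family_at (B := B) (q := q) a b /\
  [/\ canon p, tover p = tover a & app_compat a b p].
pose FF Γ (i : input (pi_former S) Γ) (D : data i) :=
  exists q a b p, over Γ (projT1 i) (projT2 i) D q a b p.
(* [τ] classifies the section [b]; its abstraction is the generic one restricted along [τ]. *)
pose EE Γ (i : input (pi_former S) Γ) (D : data i) (b : section (projT2 i))
    (s : section (pi_ty D)) :=
  exists q a β p, over Γ (projT1 i) (projT2 i) D q a β p /\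
  exists τ : hom Γ (gs_ob (gs (projT1 q))), [/\ gs_map (gs (projT1 q)) ∘ τ = tover a,
    forall t, qmap _ _ ∘ t = emap a -> disp _ ∘ t = τ ∘ disp _ ->
      gs_sec (gs (projT1 q)) ∘ t = emap β ∘ sval b
    & emap p ∘ sval s = gs_lam (gs (projT1 q)) ∘ τ].
have over_reix Γ Δ (σ : hom Δ Γ) A B D q a b p : over Γ A B D q a b p ->
    over Δ A.[σ] B.[qmap σ A] (pi_data_reix D σ) (family_at_reix q σ)
      (tcomp a (lift A σ)) (tcomp b (lift B (qmap σ A))) (tcomp p (lift (pi_ty D) σ)).
  move=> [h [cp op k]]; split.
    by apply: family_at_comp h; rewrite ?over_lift.
  split; first exact: canon_comp.
    by rewrite !over_comp op !over_lift.
  have e : tover (lift (pi_ty D) σ) = tover (lift A σ) by rewrite !over_lift.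
  exact: (app_compat_comp (D'' := pi_data_reix D σ) e k (app_compat_reix D σ)).
have [|||||st hst] := @strictly_stable_of_relations S (pi_former S) FF EE; last 1 first.
- exists st => Γ A B.
  have [q [a [b [p [[ca cb oa ob] [cp op k]]]]]] := hst Γ (existT (fun A => ty S (ext A)) A B).
  apply: (spc_reix hCl _ (hD0 (projT1 q))).
  apply/pi_reindexingP; exists a, b, p; split; first by split; exact: canon_cart.
  by split.
- move=> Γ [A B]; have [q [[a [b hab]] _]] := fnamed F B.
  have [ca cb oa ob] := hab.
  pose T := (pi_ty (D0 (projT1 q))).[tover a].
  have ep : disp (pi_ty (D0 (projT1 q))) ∘ (qmap _ _ ∘ qmap (disp A) T) =
      disp (fgenA (projT1 q)) ∘ (emap a ∘ disp T.[disp A]).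
    by rewrite !mcompA disp_q disp_emap -!mcompA disp_q.
  have ec : disp (fgenB (projT1 q)) ∘ papp ep = tover b ∘ disp T.[disp A].
    by rewrite disp_papp ob.
  pose D := PiData (pi_ty := T) (disp_cpair (canon_cart cb) ec).
  have cD : app_compat (D' := D) a b (lift _ (tover a)).
    apply/(app_compatP (D' := D) (over_lift _ _)); rewrite /= emap_cpair.
    by rewrite /papp; congr (_ ∘ _); apply: reix_hom_ext; rewrite ?q_rpair ?disp_rpair.
  exists D; split.
    exists q, a, b, (lift _ _); split=> //; split=> //; exact: over_lift.
  move=> D' [q' [a' [b' [p' [hab']]]]].
  move: q' a' b' hab' p' => q' a' b' hab'.
  apply: (family_at_unique (P := fun q a b => forall p' : tmap (pi_ty D') (pi_ty (D0 (projT1 q))),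
    [/\ canon p', tover p' = tover a & app_compat a b p'] -> D = D') hab hab') => p' [cp' op' k'].
  by apply: (pi_data_ext (D := D) (canon_cart cb) (canon_lift _ _) cp' (over_lift _ _) op' cD k').
- move=> Γ Δ σ [A B] D [q [a [b [p h]]]].
  by have := over_reix _ _ σ _ _ _ _ _ _ _ h; do 4!eexists; eassumption.
- move=> Γ [A B] D b [q [a [β [p h]]]]; have [[ca cβ oa oβ] [cp op k]] := h.
  have eb : disp (fgenB (projT1 q)) ∘ (emap β ∘ sval b) = emap a.
    by rewrite mcompA disp_emap -mcompA section_id oβ comp_idr.
  have [τ [[τ1 τ2] uτ]] := gs_univ (gs (projT1 q)) (canon_cart ca) eb.
  have es : disp (pi_ty (D0 (projT1 q))) ∘ (gs_lam (gs (projT1 q)) ∘ τ) = tover p ∘ idm _.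
    by rewrite mcompA gs_lam_over τ1 op comp_idr.
  pose s := mk_section (disp_cpair (canon_cart cp) es).
  have sE : emap p ∘ sval s = gs_lam (gs (projT1 q)) ∘ τ by exact: emap_cpair.
  exists s; split; first by exists q, a, β, p; split=> //; exists τ.
  move=> s' [q' [a' [β' [p' [[hab' [cp' op' k']] [τ' [τ1' τ2' sE']]]]]]].
  apply: (family_at_unique (P := fun q a β => forall (p' : tmap (pi_ty D) (pi_ty (D0 (projT1 q))))
    (τ' : hom Γ (gs_ob (gs (projT1 q)))), [/\ canon p', tover p' = tover a &
      gs_map (gs (projT1 q)) ∘ τ' = tover a] ->
    (forall t, qmap _ _ ∘ t = emap a -> disp _ ∘ t = τ' ∘ disp _ ->
      gs_sec (gs (projT1 q)) ∘ t = emap β ∘ sval b) ->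
    emap p' ∘ sval s' = gs_lam (gs (projT1 q)) ∘ τ' -> s = s')
    (proj1 h) hab' _ p' τ' (And3 cp' op' τ1') τ2' sE').
  move=> p2 ρ [cp2 op2 τ2e] τ2c sE2.
  have ep : p = p2 by apply: canon_unique; rewrite ?op.
  subst p2; apply: sig_ext; apply: (cart_hom_ext (canon_cart cp)).
    by rewrite sE sE2 (uτ ρ).
  by rewrite !section_id.
- move=> Γ [A B] D b s _ [q [a [β [p [[[ca cβ oa oβ] [cp op k]] [τ [τ1 τ2 sE]]]]]]].
  apply/abstractionP; apply: (cart_hom_ext (canon_cart cβ)); last first.
    by rewrite disp_papp section_id.
  have et : disp (fgenA (projT1 q)) ∘ emap a = gs_map (gs (projT1 q)) ∘ (τ ∘ disp A).
    by rewrite disp_emap mcompA τ1.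
  rewrite (k _ _ _ _ (compat_eq op (abs_eq _ _))).
  (* This replaces [b] by a restriction of the generic section, for which the β-law is [gs_beta]. *)
  rewrite -(τ2 (rpair et) (q_rpair et) (disp_rpair et)).
  have e1 : disp (pi_ty (D0 (projT1 q))) ∘ (gs_lam (gs (projT1 q)) ∘ disp _)
      = disp (fgenA (projT1 q)) ∘ qmap (gs_map (gs (projT1 q))) _.
    by rewrite mcompA gs_lam_over disp_q.
  rewrite -(gs_beta e1); symmetry; apply: papp_comp; first by rewrite q_rpair comp_idr.
  by rewrite -mcompA disp_rpair !comp_idr [RHS]mcompA sE mcompA.
- move=> Γ Δ σ [A B] D b s _ [q [a [β [p [h [τ [τ1 τ2 sE]]]]]]].
  exists (family_at_reix q σ), (tcomp a (lift A σ)), (tcomp β (lift B (qmap σ A))),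
    (tcomp p (lift (pi_ty D) σ)); split; first exact: over_reix.
  have [[ca cβ oa oβ] [cp op k]] := h.
  exists (τ ∘ σ); split=> /=.
  + by rewrite mcompA τ1 over_comp over_lift.
  + move=> t t1 t2.
    have et : disp (fgenA (projT1 q)) ∘ emap a = gs_map (gs (projT1 q)) ∘ (τ ∘ disp A).
      by rewrite disp_emap mcompA τ1.
    have -> : t = rpair et ∘ qmap σ A.
      apply: reix_hom_ext; first by rewrite mcompA q_rpair t1 emap_comp.
      by rewrite mcompA disp_rpair t2 -!mcompA disp_q.
    rewrite mcompA (τ2 (rpair et) (q_rpair et) (disp_rpair et)).
    by rewrite emap_comp -!mcompA; congr (_ ∘ _); rewrite emap_cpair over_lift.
  + rewrite mcompA -sE emap_comp -!mcompA; congr (_ ∘ _).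
    exact: q_reix_section.
Qed.

End StrictPi.

(** * Π-types in the split replacement *)

Section PiReplacement.
Context (C : compcat).

Local Notation "C '!'" := (split_replacement C) (at level 1, format "C '!'").

(** The weakening of the Π-type need not be the same object in [C] as in the replacement, so the
    evaluation map cannot be reused as it stands; it is rebuilt from application to generalized
    elements. *)
Definition pi_forget (Γ : C) (A : lu_ty Γ) (B : lu_ty (ext (lu_val A)))
    (D : pi_data (S := C!) (A := A) B) : pi_data (lu_val B) :=
  @PiData C Γ (lu_val A) (lu_val B) (lu_val (pi_ty D))
    (papp (S := C!) (D := D) (disp_q (disp (lu_val A)) (lu_val (pi_ty D))))
    (disp_papp (S := C!) (disp_q (disp (lu_val A)) (lu_val (pi_ty D)))).

Lemma papp_forget (Γ : C) (A : lu_ty Γ) (B : lu_ty (ext (lu_val A)))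
    (D : pi_data (S := C!) (A := A) B) (X : C) (x : hom X (ext (lu_val A)))
    (f : hom X (ext (lu_val (pi_ty D))))
    (e : disp (lu_val (pi_ty D)) ∘ f = disp (lu_val A) ∘ x) :
  papp (D := pi_forget D) e = papp (S := C!) (D := D) e.
Proof.
apply: (papp_comp (S := C!) (D := D) (h := rpair (S := C) e)); first exact: (disp_rpair (S := C) e).
exact: (q_rpair (S := C) e).
Qed.

Lemma abstraction_forget (Γ : C) (A : lu_ty Γ) (B : lu_ty (ext (lu_val A)))
    (D : pi_data (S := C!) (A := A) B) (b : section (lu_val B)) (s : section (lu_val (pi_ty D))) :
  is_abstraction (D := pi_forget D) b s <->
  is_abstraction (S := C!) (A := A) (B := B) (D := D) b s.
Proof.
have e : papp (D := pi_forget D) (abs_eq s (idm (ext (lu_val A)))) =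
    papp (S := C!) (D := D) (abs_eq (S := C!) (P := pi_ty D) s (idm _)).
  by rewrite papp_forget; apply: (papp_eq (S := C!) (D := D)).
split=> /abstractionP h; apply/abstractionP; first exact: (etrans (esym e) h).
exact: (etrans e h).
Qed.

Lemma compat_forget (Γ Δ : C) (A' : lu_ty Δ) (B' : lu_ty (ext (lu_val A')))
    (D' : pi_data (S := C!) (A := A') B') (A : lu_ty Γ) (B : lu_ty (ext (lu_val A)))
    (D : pi_data (S := C!) (A := A) B) a b p :
  app_compat (S := C!) (D' := D') (D := D) a b p ->
  app_compat (D' := pi_forget D') (D := pi_forget D) a b p.
Proof. by move=> h X x f e' e; rewrite !papp_forget; apply: h. Qed.

Lemma reindexing_forget (Γ Δ : C) (σ : hom Δ Γ) (A' : lu_ty Δ) (B' : lu_ty (ext (lu_val A')))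
    (D' : pi_data (S := C!) (A := A') B') (A : lu_ty Γ) (B : lu_ty (ext (lu_val A)))
    (D : pi_data (S := C!) (A := A) B) :
  pi_reindexing (S := C!) σ D' D -> pi_reindexing σ (pi_forget D') (pi_forget D).
Proof.
move=> /pi_reindexingP [a [b [p [[ca cb cp] [oa ob op h]]]]].
apply/pi_reindexingP; exists a, b, p; split; first by split; exact: lu_cartesian.
by split=> //; apply: compat_forget.
Qed.

Context (Cl : pi_class C) (hCl : stable_pi_class Cl).

Definition lu_class : pi_class C! :=
  fun Γ A B D => Cl (pi_forget (A := A) (B := B) D).

Lemma lu_class_stable : stable_pi_class lu_class.
Proof.
split=> [Γ A B D h b|Γ Δ σ A' B' D' A B D r h|Γ A B].
- have [s hs] := spc_pi hCl h b.
  by exists s; apply/abstraction_forget.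
- exact: (spc_reix hCl (reindexing_forget r) h).
- have [D hD] := spc_exists hCl (lu_val B : ty C (ext (lu_val A))).
  (* Naming the Π-type of [C] by an identity changes its value to [(pi_ty D).[idm Γ]]; [i] is the
     comparison back. *)
  pose T : ty C! Γ := LuTy (pi_ty D) (idm Γ); pose i := lift (pi_ty D) (idm Γ).
  have oi : tover i = idm Γ := over_lift _ _.
  have e : disp (pi_ty D) ∘ (emap i ∘ qmap (S := C!) (disp A) T)
      = disp (lu_val A) ∘ disp T.[disp A].
    rewrite mcompA disp_emap oi comp_idl; exact: (disp_q (S := C!) (disp A) T).
  pose D' : pi_data (S := C!) B := @PiData C! Γ A B T (papp e) (disp_papp e).
  exists D'; apply: (spc_reix hCl _ hD); apply/pi_reindexingP; exists (tid _), (tid _), i.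
  split; first by split; [exact: cart_id|exact: cart_id|exact: lift_cartesian].
  split; rewrite ?over_id ?emap_id //.
  move=> X x f e' e2; rewrite [emap (tid (lu_val B))]emap_id comp_idl papp_forget.
  apply: (papp_comp (S := C) (D := D) (h := rpair (S := C!) e')).
    by rewrite emap_id comp_idl; exact: (disp_rpair (S := C!) e').
  by rewrite -mcompA; congr (_ ∘ _); exact: (q_rpair (S := C!) e').
Qed.

Lemma replacement_pi (LF : condition_LF C) :
  exists st : strictly_stable (pi_former C!),
    forall (Γ : C!) (A : ty C! Γ) (B : ty C! (ext A)), lu_class (pi_form st B).
Proof.
have LF' := replacement_LF LF; have s' := @replacement_split C.
have [F] := family_universes_exist s' LF' (replacement_universes C).
exact: (@strict_pi C! s' LF' F lu_class lu_class_stable).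
Qed.

End PiReplacement.

Lemma pi_models (C : compcat) (C_full : is_full C) (LF : condition_LF C) :
  weakly_stable (pi_former C) -> models_with (pi_former (split_replacement C)).
Proof.
move=> /weakly_stable_pi_class [Cl hCl]; split.
- exact: replacement_full.
- exact: replacement_split.
- by case: LF => -[].
- by have [st _] := replacement_pi hCl LF; exists.
Qed.

(** * W-types *)

Lemma cart_unique (S : compcat) (Γ Δ Θ : S) (A : ty S Γ) (B : ty S Δ) (X : ty S Θ)
    (f : tmap A B) (g h : tmap X A) :
  is_cartesian f -> tover g = tover h -> tcomp f g = tcomp f h -> g = h.
Proof.
move=> cf o e; have [k [_ u]] := cf _ _ _ _ (over_comp f g).
by rewrite -(u g) // -(u h).
Qed.

Arguments w_subterm {S Γ A B} D {B' b} hb.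
Arguments w_dom_cart {S Γ A B D} w.
Arguments w_cod_cart {S Γ A B D} w.
Arguments w_arr_cart {S Γ A B W} w.

(** * Morphisms of W-data and of recursion problems *)

Section WMaps.
Context {S : compcat}.

Definition w_pi (Γ : S) (A : ty S Γ) (B : ty S (ext A)) (D : w_data B) : ty S (ext A) :=
  pi_ty (w_fun (w_ar D)).

(** The counterpart of [shape_pull] for W-types. Arities and inductive hypotheses are themselves
    Π-types, so a recursion problem is no cone on a shape, and the arrows between all components
    have to be recorded. *)
Record w_map (Γ' Γ : S) (A' : ty S Γ') (B' : ty S (ext A')) (D' : w_data B')
    (A : ty S Γ) (B : ty S (ext A)) (D : w_data B) := WMap {
  wm_a : tmap A' A;
  wm_b : tmap B' B;
  wm_w : tmap (w_ty D') (w_ty D);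
  wm_fam : tmap (w_fam (w_ar D')) (w_fam (w_ar D));
  wm_pi : tmap (w_pi D') (w_pi D);
  wm_b_over : tover wm_b = emap wm_a;
  wm_w_over : tover wm_w = tover wm_a;
  wm_fam_over : tover wm_fam = emap wm_b;
  wm_pi_over : tover wm_pi = tover wm_b;
  wm_arr : tcomp (w_arr (w_ar D)) wm_fam = tcomp wm_w (w_arr (w_ar D'));
  wm_app : app_compat (D' := w_fun (w_ar D')) (D := w_fun (w_ar D)) wm_b wm_fam wm_pi;
  wm_sup : emap wm_w ∘ w_sup D' = w_sup D ∘ emap wm_pi }.

Definition w_cart (Γ' Γ : S) (A' : ty S Γ') (B' : ty S (ext A')) (D' : w_data B')
    (A : ty S Γ) (B : ty S (ext A)) (D : w_data B) (m : w_map D' D) : Prop :=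
  [/\ is_cartesian (wm_a m), is_cartesian (wm_b m), is_cartesian (wm_w m),
    is_cartesian (wm_fam m) & is_cartesian (wm_pi m)].

Section Maps.
Context {Γ' Γ : S} {A' : ty S Γ'} {B' : ty S (ext A')} {D' : w_data B'}
  {A : ty S Γ} {B : ty S (ext A)} {D : w_data B} (m : w_map D' D).

Lemma w_subterm_map (X' : ty S (ext (w_pi D'))) (d' : tmap X' B') (o' : tover d' = disp (w_pi D'))
    (X : ty S (ext (w_pi D))) (d : tmap X B) (o : tover d = disp (w_pi D)) (δ : tmap X' X) :
  tover δ = emap (wm_pi m) -> tcomp d δ = tcomp (wm_b m) d' ->
  w_subterm D o ∘ emap δ = emap (wm_w m) ∘ w_subterm D' o'.
Proof.
move=> oδ eδ; rewrite /w_subterm [RHS]mcompA -[in RHS]emap_comp -wm_arr emap_comp -!mcompA.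
congr (_ ∘ _).
have e := wm_pi_over m.
rewrite -[pi_app _ ∘ rpair (w_fun_arg_eq o')]/(papp (w_fun_arg_eq o')).
rewrite (wm_app (w_fun_arg_eq o') (compat_eq e (w_fun_arg_eq o'))) mcompA.
rewrite -[pi_app _ ∘ rpair (w_fun_arg_eq o)]/(papp (w_fun_arg_eq o)).
apply: papp_comp; first by rewrite -!emap_comp eδ.
by rewrite disp_emap oδ.
Qed.

Record wp_map (P' : w_problem D') (P : w_problem D) := WPMap {
  wp_mot : tmap (w_mot P') (w_mot P);
  wp_dom : tmap (w_dom P') (w_dom P);
  wp_cod : tmap (w_cod P') (w_cod P);
  wp_hyp : tmap (pi_ty (w_hyp P')) (pi_ty (w_hyp P));
  wp_mot_over : tover wp_mot = emap (wm_w m);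
  wp_dom_over : tover wp_dom = emap (wm_pi m);
  wp_cod_over : tover wp_cod = emap wp_dom;
  wp_hyp_over : tover wp_hyp = tover wp_dom;
  wp_dom_arr : tcomp (w_dom_arr P) wp_dom = tcomp (wm_b m) (w_dom_arr P');
  wp_cod_arr : tcomp (w_cod_arr P) wp_cod = tcomp wp_mot (w_cod_arr P');
  wp_app : app_compat (D' := w_hyp P') (D := w_hyp P) wp_dom wp_cod wp_hyp;
  wp_rec : emap wp_mot ∘ w_rec P' = w_rec P ∘ emap wp_hyp }.

Definition wp_cart (P' : w_problem D') (P : w_problem D) (q : wp_map P' P) : Prop :=
  [/\ is_cartesian (wp_mot q), is_cartesian (wp_dom q), is_cartesian (wp_cod q)
    & is_cartesian (wp_hyp q)].

Section Problems.
Context {P' : w_problem D'} {P : w_problem D} (q : wp_map P' P).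

Lemma wp_class (Cl : pi_class S) (hCl : stable_pi_class Cl) :
  wp_cart q -> Cl _ _ _ (w_hyp P) -> Cl _ _ _ (w_hyp P').
Proof.
move=> [_ c1 c2 c3]; apply: (spc_reix hCl); apply/pi_reindexingP.
exists (wp_dom q), (wp_cod q), (wp_hyp q); split=> //.
by split; [|exact: wp_cod_over|exact: wp_hyp_over|exact: wp_app].
Qed.

(** The recursion equation mentions a λ-abstraction, and without η abstractions need not agree along
    [q] merely because their bodies do. Agreement is therefore a separate hypothesis. *)
Definition lam_compat (Λ' : abstraction_op (w_hyp P')) (Λ : abstraction_op (w_hyp P)) : Prop :=
  forall (b' : section (w_cod P')) (b : section (w_cod P)),
    emap (wp_cod q) ∘ sval b' = sval b ∘ emap (wp_dom q) ->
    emap (wp_hyp q) ∘ sval (sval (Λ' b')) = sval (sval (Λ b)) ∘ emap (wm_pi m).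

Context (Λ' : abstraction_op (w_hyp P')) (Λ : abstraction_op (w_hyp P)) (hΛ : lam_compat Λ' Λ).
Context (r' : section (w_mot P')) (r : section (w_mot P))
  (hr : emap (wp_mot q) ∘ sval r' = sval r ∘ emap (wm_w m)).

Lemma wp_section : emap (wp_cod q) ∘ sval (pull_section (w_cod_cart P') r')
  = sval (pull_section (w_cod_cart P) r) ∘ emap (wp_dom q).
Proof.
apply: (cart_hom_ext (w_cod_cart P)).
  rewrite /= [RHS]mcompA emap_cpair mcompA -emap_comp wp_cod_arr emap_comp -mcompA emap_cpair.
  rewrite mcompA hr -!mcompA; congr (_ ∘ _); rewrite !w_cod_over.
  by rewrite (w_subterm_map (w_dom_over P') (w_dom_over P) (wp_dom_over q) (wp_dom_arr q)).
rewrite mcompA disp_emap -mcompA section_id comp_idr.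
by rewrite [RHS]mcompA section_id comp_idl wp_cod_over.
Qed.

(** Both sides of the recursion equation are intertwined by the same two maps. The equation then
    passes to [P'] when [wp_mot q] is cartesian, and to [P] when [emap (wm_pi m)] is an
    isomorphism. *)
Lemma wp_solves_eq :
  emap (wp_mot q) ∘ (sval r' ∘ w_sup D') = sval r ∘ w_sup D ∘ emap (wm_pi m) /\
  emap (wp_mot q) ∘ (w_rec P' ∘ sval (sval (Λ' (pull_section (w_cod_cart P') r'))))
  = w_rec P ∘ sval (sval (Λ (pull_section (w_cod_cart P) r))) ∘ emap (wm_pi m).
Proof.
split; first by rewrite mcompA hr -!mcompA wm_sup.
by rewrite mcompA wp_rec -!mcompA (hΛ wp_section).
Qed.

Lemma wp_solves_pull : is_cartesian (wp_mot q) -> w_solves Λ r -> w_solves Λ' r'.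
Proof.
move=> cμ h; have [e1 e2] := wp_solves_eq; apply: (cart_hom_ext cμ).
  by rewrite e1 e2 h.
by rewrite !mcompA section_id comp_idl w_rec_over -mcompA section_id comp_idr.
Qed.

Lemma wp_solves_push : is_iso (emap (wm_pi m)) -> w_solves Λ' r' -> w_solves Λ r.
Proof.
move=> i h; have [e1 e2] := wp_solves_eq; apply: (iso_epi i).
by rewrite -e1 -e2 h.
Qed.

End Problems.

Lemma wp_pull (P : w_problem D) : w_cart m ->
  exists (P' : w_problem D') (q : wp_map P' P), wp_cart q.
Proof.
move=> [ca cb cw cf cp].
pose δ := lift (w_dom P) (emap (wm_pi m)).
have ed : tover (tcomp (w_dom_arr P) δ) = tover (wm_b m) ∘ disp (w_pi D').
  by rewrite over_comp Defs.w_dom_over over_lift disp_emap wm_pi_over.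
pose d := tfactor cb ed.
have cd : is_cartesian d by apply: tfactor_cartesian; apply: tcomp_cartesian (w_dom_cart P) (lift_cartesian _ _).
have od : tover d = disp (w_pi D') := over_tfactor _ _.
have eδ : tcomp (w_dom_arr P) δ = tcomp (wm_b m) d by rewrite tfactorK.
pose γ := lift (w_cod P) (emap δ); pose μ := lift (w_mot P) (emap (wm_w m)).
have ec : tover (tcomp (w_cod_arr P) γ) = tover μ ∘ w_subterm D' od.
  rewrite over_comp Defs.w_cod_over !over_lift.
  exact: w_subterm_map (over_lift _ _) eδ.
pose c := tfactor (lift_cartesian _ _ : is_cartesian μ) ec.
have cc : is_cartesian c by apply: tfactor_cartesian; apply: tcomp_cartesian (w_cod_cart P) (lift_cartesian _ _).
have oc : tover c = w_subterm D' od := over_tfactor _ _.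
pose H := pi_data_reix (w_hyp P) (emap (wm_pi m)).
pose η := lift (pi_ty (w_hyp P)) (emap (wm_pi m)).
have er : disp (w_mot P) ∘ (w_rec P ∘ emap η) = emap (wm_w m) ∘ (w_sup D' ∘ disp (pi_ty H)).
  by rewrite mcompA w_rec_over -mcompA disp_emap over_lift !mcompA -wm_sup.
pose P' := @WProblem _ _ _ _ D' _ _ d cd od _ c cc oc H (rpair er) (disp_rpair er).
have o1 : tover η = tover δ by rewrite !over_lift.
exists P'.
exists (@WPMap P' P μ δ γ η (over_lift _ _) (over_lift _ _) (over_lift _ _) o1 eδ
  (esym (tfactorK _ _)) (app_compat_reix (w_hyp P) (emap (wm_pi m))) (q_rpair er)).
by split; apply: lift_cartesian.
Qed.

(* Over an isomorphism, λ-abstractions and recursive functions can be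
   transported in both directions. *)
Lemma w_push (P : w_problem D) (Cl : pi_class S) : stable_pi_class Cl ->
  w_cart m -> is_iso (tover (wm_a m)) ->
  (forall P' : w_problem D', Cl _ _ _ (w_hyp P') -> forall Λ' : abstraction_op (w_hyp P'),
    exists r', w_solves Λ' r') ->
  Cl _ _ _ (w_hyp P) -> forall Λ : abstraction_op (w_hyp P), exists r, w_solves Λ r.
Proof.
move=> hCl cm ia solve hP Λ; have [ca cb cw cf cp] := cm.
have isoC Δ Δ' (X : ty S Δ) (Y : ty S Δ') (f : tmap X Y) :
    is_cartesian f -> is_iso (tover f) -> is_iso (emap f).
  by move=> c i; apply: pullback_iso (cartesian_pullback c) i.
have [P' [q cq]] := wp_pull P cm; have [cμ cδ cγ cη] := cq.
have iA := isoC _ _ _ _ _ ca ia.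
have iB : is_iso (emap (wm_b m)) by apply: isoC => //; rewrite wm_b_over.
have iF : is_iso (emap (wm_pi m)) by apply: isoC => //; rewrite wm_pi_over wm_b_over.
have iW : is_iso (emap (wm_w m)) by apply: isoC => //; rewrite wm_w_over.
have iδ : is_iso (emap (wp_dom q)) by apply: isoC => //; rewrite wp_dom_over.
have push Δ Δ' (X : ty S Δ) (Y : ty S Δ') (f : tmap X Y) (s : section X) :
    is_iso (tover f) -> exists t : section Y, emap f ∘ sval s = sval t ∘ tover f.
  move=> [g [g1 g2]].
  have e : disp Y ∘ (emap f ∘ sval s ∘ g) = idm _.
    by rewrite !mcompA disp_emap -(mcompA (tover f)) section_id comp_idr.
  by exists (mk_section e) => /=; rewrite -mcompA g1 comp_idr.
(* [Λ'] is made to correspond to the given [Λ]: a section [b'] is pushed forward, abstracted by [Λ],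
   and the result is pulled back. This is why [solve] has to accept every abstraction operation. *)
have [|Λ' hΛ'] := @dep_choice (section (w_cod P'))
    (fun b' => {s : section (pi_ty (w_hyp P')) | is_abstraction b' s})
    (fun b' s => exists b : section (w_cod P), emap (wp_cod q) ∘ sval b' = sval b ∘ emap (wp_dom q)
      /\ emap (wp_hyp q) ∘ sval (sval s) = sval (sval (Λ b)) ∘ emap (wm_pi m)).
  move=> b'; have [|b eb] := push _ _ _ _ (wp_cod q) b'; first by rewrite wp_cod_over.
  rewrite wp_cod_over in eb.
  have es : emap (wp_hyp q) ∘ sval (pull_section cη (sval (Λ b)))
      = sval (sval (Λ b)) ∘ tover (wp_dom q) by rewrite -wp_hyp_over /= emap_cpair.
  have ab : is_abstraction b' (pull_section cη (sval (Λ b))).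
    exact: (abstraction_pull (wp_hyp_over q) (@wp_app _ _ q) cγ eb es (proj2_sig (Λ b))).
  exists (exist _ _ ab), b; split=> //=.
  by rewrite -(wp_dom_over q) -es.
have [r' hr'] := solve P' (wp_class hCl cq hP) Λ'.
have [|r er] := push _ _ _ _ (wp_mot q) r'; first by rewrite wp_mot_over.
rewrite wp_mot_over in er; exists r.
apply: (wp_solves_push (q := q) (Λ' := Λ') _ er iF hr').
move=> b' b eb; have [b0 [eb0 ->]] := hΛ' b'.
suff -> : b = b0 by [].
by apply: sig_ext; apply: (iso_epi iδ); rewrite -eb -eb0.
Qed.

End Maps.

Lemma w_map_ext (Γ' Γ : S) (A' : ty S Γ') (B' : ty S (ext A')) (D' : w_data B')
    (A : ty S Γ) (B : ty S (ext A)) (D : w_data B) (m m' : w_map D' D) :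
  wm_a m = wm_a m' -> wm_b m = wm_b m' -> wm_w m = wm_w m' -> wm_fam m = wm_fam m' ->
  wm_pi m = wm_pi m' -> m = m'.
Proof.
case: m => a b w f p h1 h2 h3 h4 h5 h6 h7; case: m' => a' b' w' f' p' h1' h2' h3' h4' h5' h6' h7'.
move=> /= ea eb ew ef ep; subst a' b' w' f' p'.
by congr WMap; apply: proof_irrelevance.
Qed.

Section Comp.
Context {Γ2 Γ1 Γ : S} {A2 : ty S Γ2} {B2 : ty S (ext A2)} {D2 : w_data B2}
    {A1 : ty S Γ1} {B1 : ty S (ext A1)} {D1 : w_data B1}
    {A : ty S Γ} {B : ty S (ext A)} {D : w_data B} (m1 : w_map D1 D) (m2 : w_map D2 D1).

Definition w_comp : w_map D2 D.
Proof.
apply: (@WMap _ _ _ _ D2 _ _ D (tcomp (wm_a m1) (wm_a m2)) (tcomp (wm_b m1) (wm_b m2))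
  (tcomp (wm_w m1) (wm_w m2)) (tcomp (wm_fam m1) (wm_fam m2)) (tcomp (wm_pi m1) (wm_pi m2))).
- by rewrite over_comp emap_comp !wm_b_over.
- by rewrite !over_comp !wm_w_over.
- by rewrite over_comp emap_comp !wm_fam_over.
- by rewrite !over_comp !wm_pi_over.
- by rewrite tcompA wm_arr -!tcompA wm_arr.
- exact: app_compat_comp (wm_pi_over m2) (wm_app (w := m1)) (wm_app (w := m2)).
- by rewrite !emap_comp -mcompA wm_sup !mcompA wm_sup.
Defined.

Lemma w_comp_cart : w_cart m1 -> w_cart m2 -> w_cart w_comp.
Proof.
by move=> [ca cb cw cf cp] [ca' cb' cw' cf' cp']; split; apply: tcomp_cartesian.
Qed.

Definition wp_comp (P2 : w_problem D2) (P1 : w_problem D1) (P : w_problem D)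
    (q1 : wp_map m1 P1 P) (q2 : wp_map m2 P2 P1) : wp_map w_comp P2 P.
Proof.
apply: (@WPMap _ _ _ _ _ _ _ _ w_comp P2 P (tcomp (wp_mot q1) (wp_mot q2))
  (tcomp (wp_dom q1) (wp_dom q2)) (tcomp (wp_cod q1) (wp_cod q2)) (tcomp (wp_hyp q1) (wp_hyp q2))).
- by rewrite /= over_comp emap_comp !wp_mot_over.
- by rewrite /= over_comp emap_comp !wp_dom_over.
- by rewrite over_comp emap_comp !wp_cod_over.
- by rewrite !over_comp !wp_hyp_over.
- by rewrite /= tcompA wp_dom_arr -!tcompA wp_dom_arr.
- by rewrite tcompA wp_cod_arr -!tcompA wp_cod_arr.
- exact: app_compat_comp (wp_hyp_over q2) (wp_app (w := q1)) (wp_app (w := q2)).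
- by rewrite !emap_comp -mcompA wp_rec !mcompA wp_rec.
Defined.

End Comp.

Lemma w_map_factor (Γ1 Γ2 Γ : S) (τ : hom Γ1 Γ2) (A1 : ty S Γ1) (B1 : ty S (ext A1))
    (D1 : w_data B1) (A2 : ty S Γ2) (B2 : ty S (ext A2)) (D2 : w_data B2)
    (A : ty S Γ) (B : ty S (ext A)) (D : w_data B) (m1 : w_map D1 D) (m2 : w_map D2 D) :
  w_cart m1 -> w_cart m2 -> tover (wm_a m1) = tover (wm_a m2) ∘ τ ->
  exists m : w_map D1 D2, [/\ w_cart m, tover (wm_a m) = τ & w_comp m2 m = m1].
Proof.
move=> [ca1 cb1 cw1 cf1 cp1] [ca2 cb2 cw2 cf2 cp2] o.
have [a [ca oa aK]] := cart_factor (σ := τ) ca1 ca2 o.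
have [|b [cb ob bK]] := cart_factor (σ := emap a) cb1 cb2.
  by rewrite !wm_b_over -aK emap_comp.
have [|w [cw ow wK]] := cart_factor (σ := τ) cw1 cw2; first by rewrite !wm_w_over.
have [|f [cf of_ fK]] := cart_factor (σ := emap b) cf1 cf2.
  by rewrite !wm_fam_over -bK emap_comp.
have [|p [cp op pK]] := cart_factor (σ := emap a) cp1 cp2.
  by rewrite !wm_pi_over !wm_b_over -aK emap_comp.
have arr : tcomp (w_arr (w_ar D2)) f = tcomp w (w_arr (w_ar D1)).
  apply: (cart_unique cw2).
    by rewrite !over_comp of_ ow !w_arr_over -mcompA disp_emap ob !mcompA disp_emap oa.
  by rewrite tcompA -wm_arr -tcompA fK tcompA wK wm_arr.
have app : app_compat (D' := w_fun (w_ar D1)) (D := w_fun (w_ar D2)) b f p.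
  apply: (app_compat_cancel cf2 (wm_pi_over m2)) => //; first by rewrite op.
    exact: wm_app.
  by rewrite bK fK pK; apply: wm_app.
have sup : emap w ∘ w_sup D1 = w_sup D2 ∘ emap p.
  apply: (cart_hom_ext cw2).
    by rewrite mcompA -emap_comp wK wm_sup mcompA wm_sup -mcompA -emap_comp pK.
  rewrite mcompA disp_emap ow -mcompA w_sup_over !mcompA w_sup_over -oa -disp_emap.
  by rewrite -!mcompA disp_emap op.
have op' : tover p = tover b by rewrite op.
have ow' : tover w = tover a by rewrite ow oa.
by exists (WMap ob ow' of_ op' arr app sup); split=> //; apply: w_map_ext.
Qed.

Lemma w_reix_w_over (Γ Δ : S) (σ : hom Δ Γ) (A W : ty S Γ) :
  tover (lift W σ) = tover (lift A σ).
Proof. by rewrite !over_lift. Qed.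

Definition w_reix_map (Γ Δ : S) (σ : hom Δ Γ) (A : ty S Γ) (B : ty S (ext A)) (D : w_data B) :
    w_map (w_data_reix D σ) D :=
  @WMap _ _ _ _ (w_data_reix D σ) _ _ D (lift A σ) (lift B (qmap σ A)) (lift (w_ty D) σ)
    (lift (w_fam (w_ar D)) (qmap (qmap σ A) B)) (lift (w_pi D) (qmap σ A))
    (over_lift _ _) (w_reix_w_over _ _ _) (over_lift _ _) (w_reix_w_over _ _ _)
    (esym (tfactorK _ _)) (app_compat_reix (w_fun (w_ar D)) (qmap σ A)) (q_rpair _).

(** Solvability after every cartesian change of base, independent of the cleaving. In this form it
    can be moved between [C] and its replacement and applied to generic problems. *)
Definition w_robust (Cl : pi_class S) (Γ : S) (A : ty S Γ) (B : ty S (ext A)) (D : w_data B) :=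
  forall (Δ : S) (A' : ty S Δ) (B' : ty S (ext A')) (D' : w_data B') (m : w_map D' D),
    w_cart m -> forall P : w_problem D', Cl _ _ _ (w_hyp P) ->
    forall Λ : abstraction_op (w_hyp P), exists r, w_solves Λ r.

(** Any cartesian reindexing receives a cartesian map over the identity from the one given by the
    cleaving, and [w_push] carries solutions along it. *)
Lemma weakly_stable_W_robust (Cl : pi_class S) : stable_pi_class Cl -> weakly_stable_W Cl ->
  forall (Γ : S) (A : ty S Γ) (B : ty S (ext A)),
  exists W : ty S Γ, forall R : w_arity B W, Cl _ _ _ (w_fun R) ->
  exists (sup : hom (ext (pi_ty (w_fun R))) (ext W))
    (e : disp W ∘ sup = disp A ∘ disp (pi_ty (w_fun R))), w_robust Cl (WData e).
Proof.
move=> hCl hW Γ A B; have [W hR] := hW Γ A B; exists W => R /hR [sup [e h]].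
exists sup, e => Δ A' B' D' m cm P.
pose m0 := w_reix_map (tover (wm_a m)) (WData e).
have cm0 : w_cart m0 by split; apply: lift_cartesian.
have [|m1 [cm1 om1 _]] := w_map_factor (τ := idm Δ) cm0 cm; first by rewrite /= over_lift comp_idr.
apply: (w_push (m := m1) hCl cm1); last exact: h.
by rewrite om1; apply: iso_id.
Qed.

Definition wp_reix_map (Γ Δ : S) (σ : hom Δ Γ) (A : ty S Γ) (B : ty S (ext A)) (D : w_data B)
    (P : w_problem D) : wp_map (w_reix_map σ D) (w_problem_reix P σ) P :=
  @WPMap _ _ _ _ (w_data_reix D σ) _ _ D (w_reix_map σ D) (w_problem_reix P σ) P
    (lift (w_mot P) (qmap σ (w_ty D))) (lift (w_dom P) (qmap (qmap σ A) (w_pi D)))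
    (lift (w_cod P) (qmap (qmap (qmap σ A) (w_pi D)) (w_dom P)))
    (lift (pi_ty (w_hyp P)) (qmap (qmap σ A) (w_pi D)))
    (over_lift _ _) (over_lift _ _) (over_lift _ _) (w_reix_w_over _ _ _)
    (esym (tfactorK _ _)) (esym (tfactorK _ _))
    (app_compat_reix (w_hyp P) (qmap (qmap σ A) (w_pi D))) (q_rpair _).

End WMaps.

(** * W-types in the split replacement *)

Section WReplacement.
Context (C : compcat).

Local Notation "C '!'" := (split_replacement C) (at level 1, format "C '!'").

Definition w_arity_forget (Γ : C) (A : lu_ty Γ) (B : lu_ty (ext (lu_val A))) (W : lu_ty Γ)
    (R : w_arity (S := C!) (A := A) B W) : w_arity (lu_val B) (lu_val W) :=
  @WArity C Γ (lu_val A) (lu_val B) (lu_val W) (lu_val (w_fam R)) (w_arr R)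
    (@lu_cartesian C _ _ (w_fam R) W (w_arr R) (w_arr_cart (S := C!) R)) (w_arr_over (S := C!) R) (pi_forget (w_fun R)).

Definition w_forget (Γ : C) (A : lu_ty Γ) (B : lu_ty (ext (lu_val A)))
    (D : w_data (S := C!) (A := A) B) : w_data (lu_val B) :=
  @WData C Γ (lu_val A) (lu_val B) (lu_val (w_ty D)) (w_arity_forget (w_ar D)) (w_sup D)
    (w_sup_over (S := C!) D).

Lemma w_subterm_forget (Γ : C) (A : lu_ty Γ) (B : lu_ty (ext (lu_val A)))
    (D : w_data (S := C!) (A := A) B) (X : lu_ty (ext (lu_val (w_pi (S := C!) D))))
    (d : tmap (lu_val X) (lu_val B)) (o : tover d = disp (lu_val (w_pi (S := C!) D))) :
  w_subterm (w_forget D) o = w_subterm (S := C!) D (B' := X) (b := d) o.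
Proof.
rewrite /w_subterm; congr (_ ∘ _).
apply: etrans (papp_forget (D := w_fun (w_ar D)) (w_fun_arg_eq (D := w_forget D) o)) _.
exact: (papp_eq (S := C!) (D := w_fun (w_ar D))).
Qed.

Definition wp_forget (Γ : C) (A : lu_ty Γ) (B : lu_ty (ext (lu_val A)))
    (D : w_data (S := C!) (A := A) B) (P : w_problem (S := C!) D) : w_problem (w_forget D) :=
  @WProblem C Γ (lu_val A) (lu_val B) (w_forget D) (lu_val (w_mot P)) (lu_val (w_dom P))
    (w_dom_arr P) (@lu_cartesian C _ _ (w_dom P) B (w_dom_arr P) (w_dom_cart (S := C!) P)) (w_dom_over (S := C!) P)
    (lu_val (w_cod P)) (w_cod_arr P) (@lu_cartesian C _ _ (w_cod P) (w_mot P) (w_cod_arr P) (w_cod_cart (S := C!) P))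
    (etrans (w_cod_over (S := C!) P) (esym (w_subterm_forget _)))
    (pi_forget (w_hyp P)) (w_rec P) (w_rec_over (S := C!) P).

Lemma w_map_forget (Γ' Γ : C) (A' : lu_ty Γ') (B' : lu_ty (ext (lu_val A')))
    (D' : w_data (S := C!) (A := A') B') (A : lu_ty Γ) (B : lu_ty (ext (lu_val A)))
    (D : w_data (S := C!) (A := A) B) (m : w_map D' D) : w_cart m ->
  exists m' : w_map (w_forget D') (w_forget D), w_cart m'.
Proof.
case: m => a b w f p ob ow of_ op arr app sup [/= ca cb cw cf cp].
exists (@WMap C _ _ _ _ (w_forget D') _ _ (w_forget D) a b w f p ob ow of_ op arr
  (compat_forget (D' := w_fun (w_ar D')) (D := w_fun (w_ar D)) app) sup).
by split; exact: lu_cartesian.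
Qed.

Context (Cl : pi_class C) (hCl : stable_pi_class Cl).

(** Sections and λ-abstractions are the same in both categories, so a problem in the replacement is
    solved by the section that solves its image in [C]; the two recursion equations differ only in
    how the pulled back section is formed. *)
Lemma w_robust_forget (Γ : C) (A : lu_ty Γ) (B : lu_ty (ext (lu_val A)))
    (D : w_data (S := C!) (A := A) B) :
  w_robust Cl (w_forget D) -> w_robust (lu_class Cl) D.
Proof.
move=> h Δ A' B' D' m cm P hP Λ.
have [m' cm'] := w_map_forget cm.
pose Λ' : abstraction_op (w_hyp (wp_forget P)) := fun b =>
  exist (is_abstraction (D := w_hyp (wp_forget P)) b) (sval (Λ b))
      (proj2 (abstraction_forget (A := w_dom P) (B := w_cod P) (D := w_hyp P) b (sval (Λ b)))
        (proj2_sig (Λ b))).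
have [r hr] := h _ _ _ _ m' cm' (wp_forget P) hP Λ'; exists r.
rewrite /w_solves in hr *.
have e : pull_section (w_cod_cart (wp_forget P)) r = pull_section (w_cod_cart P) r.
  apply: sig_ext; apply: (cart_hom_ext (w_cod_cart (wp_forget P))).
    rewrite [LHS]emap_cpair; symmetry; exact: (emap_cpair (S := C!)).
  rewrite section_id; symmetry; exact: (section_id (S := C!)).
by rewrite e in hr.
Qed.

Lemma w_robust_comp (S : compcat) (K : pi_class S) (Γ' Γ : S) (A' : ty S Γ') (B' : ty S (ext A'))
    (D' : w_data B') (A : ty S Γ) (B : ty S (ext A)) (D : w_data B) (m : w_map D' D) :
  w_cart m -> w_robust K D -> w_robust K D'.
Proof.
by move=> cm h Δ A'' B'' D'' m' cm'; apply: (h _ _ _ _ (w_comp m m')); apply: w_comp_cart.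
Qed.

(** [W] is named by an identity. An arity of the resulting type becomes one of [W] in [C] by
    composition with [i], which the free choice of cartesian arrow in [w_arity] permits, and [sup]
    is corrected by the inverse [j]. *)
Lemma replacement_W : weakly_stable_W Cl ->
  forall (Γ : C!) (A : ty C! Γ) (B : ty C! (ext A)),
  exists W : ty C! Γ, forall R : w_arity B W, lu_class Cl (w_fun R) ->
  exists (sup : hom (ext (pi_ty (w_fun R))) (ext W))
    (e : disp W ∘ sup = disp A ∘ disp (pi_ty (w_fun R))), w_robust (lu_class Cl) (WData e).
Proof.
move=> hW Γ A B.
have [W hR] := weakly_stable_W_robust hCl hW (lu_val B : ty C (ext (lu_val A))).
pose i := lift W (idm Γ); have oi : tover i = idm Γ := over_lift _ _.
have ci : is_cartesian i := lift_cartesian _ _.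
have [j [j1 j2]] : is_iso (emap i) by apply: cart_iso.
exists (LuTy W (idm Γ)) => R hRC.
pose RC := w_arity_forget R.
have oa : tover (tcomp i (w_arr RC)) = disp (lu_val A) ∘ disp (lu_val B).
  by rewrite over_comp oi comp_idl; exact: (w_arr_over RC).
pose R0 : w_arity (lu_val B) W := @WArity C Γ (lu_val A) (lu_val B) W (w_fam RC)
  (tcomp i (w_arr RC)) (tcomp_cartesian ci (w_arr_cart RC)) oa (w_fun RC).
have [sup [e rob]] := hR R0 hRC.
have dj : disp W.[idm Γ] ∘ j = disp W.
  by rewrite -[RHS]comp_idr -j2 mcompA disp_emap oi comp_idl.
have e' : disp (c := C!) (LuTy W (idm Γ) : ty C! Γ) ∘ (j ∘ sup)
    = disp A ∘ disp (pi_ty (w_fun R)) by rewrite [LHS]mcompA [_ ∘ j]dj; exact: e.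
exists (j ∘ sup), e'; apply: w_robust_forget.
have oid (Δ : C) (X : ty C Δ) : tover (tid X) = idm Δ := over_id X.
have o1 : tover (tid (lu_val B)) = emap (tid (lu_val A)) by rewrite over_id emap_id.
have o2 : tover i = tover (tid (lu_val A)) by rewrite oi over_id.
have o3 : tover (tid (w_fam RC)) = emap (tid (lu_val B)) by rewrite over_id emap_id.
have o4 : tover (tid (pi_ty (w_fun RC))) = tover (tid (lu_val B)) by rewrite !over_id.
have arr : tcomp (w_arr R0) (tid (w_fam RC)) = tcomp i (w_arr RC) by rewrite tcomp_idr.
have s : emap i ∘ (j ∘ sup) = sup ∘ emap (tid (pi_ty (w_fun RC))).
  by rewrite mcompA j2 emap_id comp_idl comp_idr.
apply: (w_robust_comp (m := @WMap C _ _ _ _ (w_forget (WData e')) _ _ (WData (w_ar := R0) e)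
  (tid _) (tid _) i (tid _) (tid _) o1 o2 o3 o4 arr (app_compat_id (w_fun RC)) s) _ rob).
by split=> //=; apply: cart_id.
Qed.

End WReplacement.

(** * Chosen W-data and chosen recursion problems in a split category *)

Section CanonicalPi.
Context {S : compcat} (Ssplit : is_split S) (pi : strictly_stable (pi_former S)).

Lemma pi_form_reix (Γ Δ : S) (σ : hom Δ Γ) (A : ty S Γ) (B : ty S (ext A)) :
  pi_form pi B.[qmap σ A] = pi_data_reix (pi_form pi B) σ.
Proof. exact: (form_reix pi σ (existT (fun A => ty S (ext A)) A B)). Qed.

(* Up to equality, a canonical family over [B] is [B.[qmap σ A]]. *)
Lemma canon_family_ind (Γ Δ : S) (A : ty S Γ) (B : ty S (ext A))
    (P : forall (σ : hom Δ Γ) (A' : ty S Δ) (a : tmap A' A) (B' : ty S (ext A')),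
      tmap B' B -> Prop) :
  (forall σ, P σ A.[σ] (lift A σ) B.[qmap σ A] (lift B (qmap σ A))) ->
  forall (A' : ty S Δ) (a : tmap A' A) (B' : ty S (ext A')) (b : tmap B' B),
  canon a -> canon b -> tover b = emap a -> P (tover a) A' a B' b.
Proof.
move=> h A' a B' b ca; case: A' a / ca B' b => σ B' b cb ob; rewrite over_lift.
have := canon_sig cb; rewrite ob => e.
exact: (sig_tmap_ind (P := fun B' b => P σ A.[σ] (lift A σ) B' b) e (h σ)).
Qed.

Lemma pi_form_canon (Γ Δ : S) (A : ty S Γ) (B : ty S (ext A)) (A' : ty S Δ) (B' : ty S (ext A'))
    (a : tmap A' A) (b : tmap B' B) : canon a -> canon b -> tover b = emap a ->
  exists p : tmap (pi_ty (pi_form pi B')) (pi_ty (pi_form pi B)),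
    [/\ canon p, tover p = tover a & app_compat a b p].
Proof.
move: A' a B' b; apply: (canon_family_ind (P := fun σ A' a B' b =>
  exists p : tmap (pi_ty (pi_form pi B')) (pi_ty (pi_form pi B)),
    [/\ canon p, tover p = tover a & app_compat a b p])) => σ.
rewrite pi_form_reix; exists (lift _ σ); split; first exact: canon_lift.
  by rewrite !over_lift.
exact: app_compat_reix.
Qed.

(** Strict stability of λ-abstraction is stated for the cleaving; [canon_family_ind] extends it to
    all canonical arrows. *)
Lemma pi_lam_canon (Γ Δ : S) (A : ty S Γ) (B : ty S (ext A)) (D : pi_data B)
    (A' : ty S Δ) (B' : ty S (ext A')) (D' : pi_data B') (a : tmap A' A) (b : tmap B' B)
    (p : tmap (pi_ty D') (pi_ty D)) (e : D = pi_form pi B) (e' : D' = pi_form pi B')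
    (s' : section B') (s : section B) :
  canon a -> canon b -> tover b = emap a -> canon p -> tover p = tover a -> app_compat a b p ->
  emap b ∘ sval s' = sval s ∘ emap a ->
  emap p ∘ sval (sval (pi_lam e' s')) = sval (sval (pi_lam e s)) ∘ tover a.
Proof.
move=> ca cb ob; move: A' a B' b ca cb ob D' e' s' p.
apply: (canon_family_ind (P := fun σ A' a B' b =>
  forall (D' : pi_data B') (e' : D' = pi_form pi B') (s' : section B')
    (p : tmap (pi_ty D') (pi_ty D)), canon p -> tover p = tover a -> app_compat a b p ->
  emap b ∘ sval s' = sval s ∘ emap a ->
  emap p ∘ sval (sval (pi_lam e' s')) = sval (sval (pi_lam e s)) ∘ tover a)) => σ D' e' s' p.
have eD : D' = pi_data_reix D σ by rewrite e' e pi_form_reix.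
move: e' p; rewrite eD => e' p cp; rewrite over_lift => op _ es.
have -> : p = lift (pi_ty D) σ by apply: canon_unique; rewrite ?over_lift.
have -> : s' = reix_section s (qmap σ A).
  apply: sig_ext; apply: reix_hom_ext; first by rewrite es q_reix_section.
  by rewrite !section_id.
have := @elim_reix _ _ pi _ _ σ (existT (fun A => ty S (ext A)) A B) D e e' s.
rewrite /= => ->; exact: q_reix_section.
Qed.

End CanonicalPi.

Section ChosenW.
Context {S : compcat} (Ssplit : is_split S) (pi : strictly_stable (pi_former S)).

Definition w_canon (Γ' Γ : S) (A' : ty S Γ') (B' : ty S (ext A')) (D' : w_data B')
    (A : ty S Γ) (B : ty S (ext A)) (D : w_data B) (m : w_map D' D) : Prop :=
  [/\ canon (wm_a m), canon (wm_b m), canon (wm_w m), canon (wm_fam m) & canon (wm_pi m)].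

Lemma w_canon_cart (Γ' Γ : S) (A' : ty S Γ') (B' : ty S (ext A')) (D' : w_data B')
    (A : ty S Γ) (B : ty S (ext A)) (D : w_data B) (m : w_map D' D) : w_canon m -> w_cart m.
Proof. by move=> [ca cb cw cf cp]; split; apply: canon_cart. Qed.

Lemma w_canon_unique (Γ' Γ : S) (A' : ty S Γ') (B' : ty S (ext A')) (D' : w_data B')
    (A : ty S Γ) (B : ty S (ext A)) (D : w_data B) (m m' : w_map D' D) :
  w_canon m -> w_canon m' -> tover (wm_a m) = tover (wm_a m') -> m = m'.
Proof.
move=> [ca cb cw cf cp] [ca' cb' cw' cf' cp'] o.
have ea : wm_a m = wm_a m' by apply: canon_unique.
have eb : wm_b m = wm_b m' by apply: canon_unique; rewrite // !wm_b_over ea.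
apply: w_map_ext => //; apply: canon_unique => //.
- by rewrite !wm_w_over.
- by rewrite !wm_fam_over eb.
- by rewrite !wm_pi_over eb.
Qed.

Lemma w_reix_canon (Γ Δ : S) (σ : hom Δ Γ) (A : ty S Γ) (B : ty S (ext A)) (D : w_data B) :
  w_canon (w_reix_map σ D).
Proof. by split; apply: canon_lift. Qed.

Section Comp.
Context {Γ2 Γ1 Γ : S} {A2 : ty S Γ2} {B2 : ty S (ext A2)} {D2 : w_data B2}
    {A1 : ty S Γ1} {B1 : ty S (ext A1)} {D1 : w_data B1}
    {A : ty S Γ} {B : ty S (ext A)} {D : w_data B} (m1 : w_map D1 D).

Lemma w_comp_canon (m2 : w_map D2 D1) : w_canon m1 -> w_canon m2 -> w_canon (w_comp m1 m2).
Proof.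
by move=> [ca cb cw cf cp] [ca' cb' cw' cf' cp']; split; apply: canon_comp.
Qed.

Lemma w_canon_factor (τ : hom Γ2 Γ1) (m : w_map D2 D) : w_canon m -> w_canon m1 ->
  tover (wm_a m) = tover (wm_a m1) ∘ τ ->
  exists m2 : w_map D2 D1, [/\ w_canon m2, tover (wm_a m2) = τ & w_comp m1 m2 = m].
Proof.
move=> cm cm1 o.
have [m2 [_ om2 e]] := w_map_factor (w_canon_cart cm) (w_canon_cart cm1) o.
exists m2; split=> //; subst m; case: cm cm1 => [ca cb cw cf cp] [ca' cb' cw' cf' cp'].
by split; [exact: canon_cancel ca' ca|exact: canon_cancel cb' cb|exact: canon_cancel cw' cw
  |exact: canon_cancel cf' cf|exact: canon_cancel cp' cp].
Qed.

End Comp.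

Lemma w_arr_canon (Γ : S) (A : ty S Γ) (B : ty S (ext A)) (D : w_data B) :
  w_data_chosen pi D -> canon (w_arr (w_ar D)).
Proof. by move=> h; apply: sig_canon (wdc_fam h) (canon_lift _ _). Qed.

Lemma w_chosen_reix (Γ Δ : S) (σ : hom Δ Γ) (A : ty S Γ) (B : ty S (ext A)) (D : w_data B) :
  w_data_chosen pi D -> w_data_chosen pi (w_data_reix D σ).
Proof.
move=> h; split.
  apply: canon_sig_unique; last by rewrite w_arr_over over_lift.
    apply: (canon_cancel Ssplit (canon_lift (w_ty D) σ)); rewrite /= tfactorK.
    exact: canon_comp (w_arr_canon h) (canon_lift _ _).
  exact: canon_lift.
by rewrite /= (wdc_fun h) -pi_form_reix.
Qed.

(** The canonical arrow fixes the W-type, the chosen weakening and Π-type fix the arity, and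
    cartesianness of [wm_w] fixes [w_sup]. *)
Lemma w_chosen_ext (Γ' Γ : S) (A' : ty S Γ') (B' : ty S (ext A')) (D1 D2 : w_data B')
    (A : ty S Γ) (B : ty S (ext A)) (D : w_data B) (m1 : w_map D1 D) (m2 : w_map D2 D) :
  w_data_chosen pi D1 -> w_data_chosen pi D2 -> w_canon m1 -> w_canon m2 ->
  tover (wm_a m1) = tover (wm_a m2) -> D1 = D2.
Proof.
case: D1 m1 => W1 [fam1 arr1 carr1 oarr1 fun1] sup1 eo1 m1.
case: D2 m2 => W2 [fam2 arr2 carr2 oarr2 fun2] sup2 eo2 m2.
move=> [/= e1 e1'] [/= e2 e2'] cm1 cm2 o.
have [ca1 cb1 cw1 cf1 cp1] := cm1; have [ca2 cb2 cw2 cf2 cp2] := cm2.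
have ew := canon_sig_unique cw1 cw2 (etrans (wm_w_over m1) (etrans o (esym (wm_w_over m2)))).
have eW : W1 = W2 := f_equal (@projT1 _ _) ew; simpl in eW; subst W2.
have eF := etrans e1 (esym e2).
have efam : fam1 = fam2 := f_equal (@projT1 _ _) eF; subst fam2.
have earr := inj_pair2 _ (fun W' => tmap W' _) _ _ _ eF; subst arr2.
have efun := etrans e1' (esym e2'); move: efun {e1' e2' e1 e2 eF} => efun; subst fun2.
have ecarr := proof_irrelevance _ carr1 carr2; have eoarr := proof_irrelevance _ oarr1 oarr2.
subst carr2 oarr2.
have ea : wm_a m1 = wm_a m2 by apply: canon_unique.
have eb : wm_b m1 = wm_b m2 by apply: canon_unique; rewrite // !wm_b_over ea.
have ep : wm_pi m1 = wm_pi m2.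
  apply: canon_unique => //.
  exact: etrans (wm_pi_over m1) (etrans (f_equal (fun b => tover b) eb) (esym (wm_pi_over m2))).
have ew2 : wm_w m1 = wm_w m2.
  apply: canon_unique => //.
  exact: etrans (wm_w_over m1) (etrans o (esym (wm_w_over m2))).
have es : sup1 = sup2.
  apply: (cart_hom_ext (canon_cart cw1)); last by rewrite eo1 eo2.
  by have := wm_sup m1; have := wm_sup m2; rewrite /= -ew2 -ep => -> ->.
by subst sup2; rewrite (proof_irrelevance _ eo1 eo2).
Qed.

Lemma w_chosen_exists (Γ' Γ : S) (A' : ty S Γ') (B' : ty S (ext A'))
    (A : ty S Γ) (B : ty S (ext A)) (D : w_data B) (a : tmap A' A) (b : tmap B' B) :
  w_data_chosen pi D -> canon a -> canon b -> tover b = emap a ->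
  exists (D' : w_data B') (m : w_map D' D), [/\ w_data_chosen pi D', w_canon m & wm_a m = a].
Proof.
move=> hD ca cb ob; pose W := (w_ty D).[tover a]; pose w := lift (w_ty D) (tover a).
have ow : tover w = tover a := over_lift _ _.
pose R : w_arity B' W := WArity (lift_cartesian W (disp A' ∘ disp B')) (over_lift _ _) (pi_form pi _).
have cR : canon (tcomp w (w_arr R)) by apply: canon_comp => //; exact: canon_lift.
have [|f [cf of_ fK]] := canon_factor (σ := emap b) Ssplit cR (w_arr_canon hD).
  by rewrite over_comp ow !w_arr_over mcompA -disp_emap -!mcompA disp_emap ob.
have [p [cp op k]] : exists p : tmap (pi_ty (w_fun R)) (w_pi D),
    [/\ canon p, tover p = tover b & app_compat (D := w_fun (w_ar D)) b f p].
  by rewrite /w_pi (wdc_fun hD); apply: pi_form_canon.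
have es : disp (w_ty D) ∘ (w_sup D ∘ emap p) = tover w ∘ (disp A' ∘ disp (pi_ty (w_fun R))).
  rewrite mcompA w_sup_over -mcompA disp_emap op ob !mcompA disp_emap ow.
  by [].
pose D' := WData (w_ar := R) (disp_cpair (lift_cartesian _ _) es).
exists D'; exists (@WMap _ _ _ _ _ D' _ _ D a b w f p ob ow of_ op fK k (emap_cpair _ es)).
by split.
Qed.

End ChosenW.

Section ChosenProblems.
Context {S : compcat} (Ssplit : is_split S) (pi : strictly_stable (pi_former S)).

Section Problem.
Context {Γ : S} {A : ty S Γ} {B : ty S (ext A)} (D : w_data B).

(* The type family of the inductive hypotheses, for the motive [M]. *)
Definition w_hyp_fam (M : ty S (ext (w_ty D))) : ty S (ext B.[disp (w_pi D)]) :=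
  M.[w_subterm D (over_lift B (disp (w_pi D)))].

Definition w_hyp_ty (M : ty S (ext (w_ty D))) : ty S (ext (w_pi D)) :=
  pi_ty (pi_form pi (w_hyp_fam M)).

Definition w_prob (M : ty S (ext (w_ty D))) (c : hom (ext (w_hyp_ty M)) (ext M))
    (e : disp M ∘ c = w_sup D ∘ disp (w_hyp_ty M)) : w_problem D :=
  @WProblem S Γ A B D M _ _ (lift_cartesian B (disp (w_pi D))) (over_lift _ _)
    _ _ (lift_cartesian M _) (over_lift _ _) (pi_form pi (w_hyp_fam M)) c e.

Lemma w_prob_chosen M c e : w_problem_chosen pi (@w_prob M c e).
Proof. by split. Qed.

(** Chosen weakenings and Π-types leave only the motive and the recursive step free, the two
    ingredients that a generic problem has to classify. *)
Lemma w_problem_chosenE (P : w_problem D) : w_problem_chosen pi P ->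
  exists M c e, P = @w_prob M c e.
Proof.
case: P => M dom darr dcart dover cod carr ccart cover hyp c e [/= e1 e2 e3].
have ed : dom = B.[disp (w_pi D)] := f_equal (@projT1 _ _) e1; subst dom.
have ea := inj_pair2 _ (fun B' => tmap B' B) _ _ _ e1; subst darr.
have eo := proof_irrelevance _ dover (over_lift _ _); subst dover.
have ec : cod = w_hyp_fam M := f_equal (@projT1 _ _) e2; subst cod.
have ea' := inj_pair2 _ (fun C' => tmap C' M) _ _ _ e2; subst carr hyp.
have e4 := proof_irrelevance _ dcart (lift_cartesian _ _); subst dcart.
have e5 := proof_irrelevance _ ccart (lift_cartesian _ _); subst ccart.
have e6 := proof_irrelevance _ cover (over_lift _ _); subst cover.
by exists M, c, e.
Qed.

End Problem.

Definition wp_canon {Γ' Γ : S} {A' : ty S Γ'} {B' : ty S (ext A')} {D' : w_data B'}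
  {A : ty S Γ} {B : ty S (ext A)} {D : w_data B} {m : w_map D' D} {P' : w_problem D'}
  {P : w_problem D} (q : wp_map m P' P) : Prop :=
  [/\ canon (wp_mot q), canon (wp_dom q), canon (wp_cod q) & canon (wp_hyp q)].

Section ProblemMaps.
Context {Γ' Γ : S} {A' : ty S Γ'} {B' : ty S (ext A')} {D' : w_data B'}
  {A : ty S Γ} {B : ty S (ext A)} {D : w_data B} (m : w_map D' D) (cm : w_canon m).

Lemma wp_canon_unique (P' : w_problem D') (P : w_problem D) (q q' : wp_map m P' P) :
  wp_canon q -> wp_canon q' -> wp_mot q = wp_mot q' /\ wp_hyp q = wp_hyp q'.
Proof.
move=> [c1 c2 c3 c4] [c1' c2' c3' c4'].
by split; apply: canon_unique; rewrite // ?wp_mot_over // !wp_hyp_over !wp_dom_over.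
Qed.

(** Since weakenings and Π-types are chosen, a canonical arrow of motives induces the arrows between
    all other types; only compatibility with the recursive steps remains as a condition. *)
Lemma w_prob_map (M' : ty S (ext (w_ty D'))) (M : ty S (ext (w_ty D))) (μ : tmap M' M) :
  canon μ -> tover μ = emap (wm_w m) ->
  exists h : tmap (w_hyp_ty M') (w_hyp_ty M), [/\ canon h, tover h = emap (wm_pi m) &
    forall c' e' c e, emap μ ∘ c' = c ∘ emap h ->
    exists q : wp_map m (@w_prob _ _ _ D' M' c' e') (@w_prob _ _ _ D M c e),
      [/\ wp_canon q, wp_mot q = μ & wp_hyp q = h]].
Proof.
move=> cμ oμ; have [ca cb cw cf cp] := cm.
have [|δ [cδ oδ δK]] := canon_factor (h := tcomp (wm_b m) (lift B' (disp (w_pi D'))))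
    (g := lift B (disp (w_pi D))) (σ := emap (wm_pi m)) Ssplit
    (canon_comp Ssplit cb (canon_lift _ _)) (canon_lift _ _).
  by rewrite over_comp !over_lift disp_emap wm_pi_over.
have sE := w_subterm_map (over_lift B' (disp (w_pi D'))) (over_lift B (disp (w_pi D))) oδ δK.
have [|γ [cγ oγ γK]] := canon_factor
    (h := tcomp μ (lift M' (w_subterm D' (over_lift B' (disp (w_pi D'))))))
    (g := lift M (w_subterm D (over_lift B (disp (w_pi D))))) (σ := emap δ) Ssplit
    (canon_comp Ssplit cμ (canon_lift _ _)) (canon_lift _ _).
  by rewrite over_comp !over_lift oμ sE.
have [h [ch oh k]] := pi_form_canon pi cδ cγ oγ.
exists h; split=> //; first by rewrite oh.
move=> c' e' c e ec.
exists (@WPMap _ _ _ _ _ _ _ _ _ m (w_prob e') (w_prob e) μ δ γ h oμ oδ oγ oh δK γK k ec).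
by split.
Qed.

Lemma w_hyp_pullback (H' : ty S (ext (w_pi D'))) (H : ty S (ext (w_pi D))) (h : tmap H' H) :
  canon h -> tover h = emap (wm_pi m) ->
  is_pullback (emap h) (disp A' ∘ (disp (w_pi D') ∘ disp H'))
    (disp A ∘ (disp (w_pi D) ∘ disp H)) (tover (wm_a m)).
Proof.
move=> ch oh; have [ca _ _ _ cp] := cm.
have pa := cartesian_pullback (canon_cart ca).
have pp := cart_pullback (canon_cart cp) (etrans (wm_pi_over m) (wm_b_over m)).
have ph := cart_pullback (canon_cart ch) oh.
apply/pullback_sym/(pullback_paste (pullback_sym pa)).
exact: (pullback_paste (pullback_sym pp) (pullback_sym ph)).
Qed.

Lemma pi_lam_compat (P' : w_problem D') (P : w_problem D) (q : wp_map m P' P)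
    (e' : w_hyp P' = pi_form pi (w_cod P')) (e : w_hyp P = pi_form pi (w_cod P)) :
  wp_canon q -> lam_compat q (pi_lam e') (pi_lam e).
Proof.
move=> [c1 c2 c3 c4] b' b eb; rewrite -(wp_dom_over q).
exact: (pi_lam_canon e e' c2 c3 (wp_cod_over q) c4 (wp_hyp_over q) (wp_app (w := q)) eb).
Qed.

End ProblemMaps.
End ChosenProblems.

(** * The generic recursion problem *)

Section GenericProblem.
Context {S : compcat} (Ssplit : is_split S) (LF : condition_LF S) (U : local_universes S).
Context {Cl : pi_class S} (pi : strictly_stable (pi_former S)).
Context (pi_Cl : forall (Γ : S) (A : ty S Γ) (B : ty S (ext A)), Cl (pi_form pi B)).

(* The generic recursion problem on the reindexings of [D], with motive named
   by [k], together with a solution of it. *)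
Record generic_rec (Γ0 : S) (A0 : ty S Γ0) (B0 : ty S (ext A0)) (D0 : w_data B0) (k : code U) :=
  GenericRec {
  gr_ob : S;
  gr_A : ty S gr_ob;
  gr_B : ty S (ext gr_A);
  gr_D : w_data gr_B;
  gr_map : w_map gr_D D0;
  gr_canon : w_canon gr_map;
  gr_P : w_problem gr_D;
  gr_chosen : w_problem_chosen pi gr_P;
  gr_mot : tmap (w_mot gr_P) (gen k);
  gr_mot_canon : canon gr_mot;
  gr_rec : section (w_mot gr_P);
  gr_solves : w_solves (pi_lam (wpc_hyp gr_chosen)) gr_rec;
  gr_exists : forall (Γ : S) (A : ty S Γ) (B : ty S (ext A)) (D : w_data B) (f : w_map D D0)
    (P : w_problem D) (g : tmap (w_mot P) (gen k)),
    w_canon f -> w_problem_chosen pi P -> canon g ->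
    exists (f' : w_map D gr_D) (q : wp_map f' P gr_P), w_canon f' /\ wp_canon q;
  gr_unique : forall (Γ : S) (A : ty S Γ) (B : ty S (ext A)) (D : w_data B)
    (P : w_problem D) (f f' : w_map D gr_D) (q : wp_map f P gr_P) (q' : wp_map f' P gr_P),
    w_canon f -> w_canon f' -> wp_canon q -> wp_canon q' ->
    tover (wm_a (w_comp gr_map f)) = tover (wm_a (w_comp gr_map f')) ->
    tover (wm_a f) = tover (wm_a f') }.

Lemma generic_rec_exists (Γ0 : S) (A0 : ty S Γ0) (B0 : ty S (ext A0)) (D0 : w_data B0)
    (k : code U) : w_robust Cl D0 -> inhabited (generic_rec D0 k).
Proof.
move=> rob.
(* First stage: the names of motives on reindexings of the W-type. *)
have [R] := generic_name_exists LF (w_ty D0) (univ k).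
set u1 := gn_map R; pose D1 := w_data_reix D0 u1; pose m1 := w_reix_map u1 D0.
have cm1 : w_canon m1 by exact: w_reix_canon.
pose M1 : ty S (ext (w_ty D1)) := (gen k).[gn_name R].
pose H1 := w_hyp_ty pi M1; pose Z := M1.[w_sup D1 ∘ disp H1].
have tf : tame (disp A0.[u1] ∘ (disp (w_pi D1) ∘ disp H1)).
  by left; do 2?[apply: display_comp]; apply: display_disp.
(* Second stage: a recursive step for the generic motive is a section of [Z], the motive pulled back
   along [sup], over the context extended by [x], [f] and the inductive hypothesis. *)
have [V [u2 cl]] := LF_classifier LF tf (or_introl (display_disp Z)).
pose D2 := w_data_reix D1 u2; pose m2 := w_reix_map u2 D1.
have cm2 : w_canon m2 by exact: w_reix_canon.
pose M2 : ty S (ext (w_ty D2)) := M1.[emap (wm_w m2)]; pose μ2 := lift M1 (emap (wm_w m2)).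
have cμ2 : canon μ2 := canon_lift _ _.
have [h2 [ch2 oh2 pm2]] := w_prob_map Ssplit pi cm2 cμ2 (over_lift _ _).
have pb2 := w_hyp_pullback cm2 ch2 oh2; rewrite [tover _]over_lift in pb2.
have [e [_ eh cle]] := cl _ _ _ (pullback_sym pb2).
have ec : disp M1 ∘ (qmap _ M1 ∘ e) = emap (wm_w m2) ∘ (w_sup D2 ∘ disp (w_hyp_ty pi M2)).
  by rewrite mcompA disp_q -mcompA eh -mcompA disp_emap oh2 mcompA -wm_sup -mcompA.
pose P2 := @w_prob _ pi _ _ _ D2 M2 (rpair ec) (disp_rpair ec).
have hP2 : w_problem_chosen pi P2 := w_prob_chosen (disp_rpair ec).
pose m := w_comp m1 m2; have cm : w_canon m by apply: w_comp_canon.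
(* Robustness solves the generic problem for the strict λ-abstraction, which is in turn compatible
   with all canonical arrows. *)
have [r hr] := rob _ _ _ _ m (w_canon_cart cm) P2 (pi_Cl _) (pi_lam (wpc_hyp hP2)).
pose g2 : tmap (w_mot P2) (gen k) := tcomp (lift (gen k) (gn_name R)) μ2.
have cg2 : canon g2 by apply: canon_comp => //; exact: canon_lift.
exists; apply: (@GenericRec _ _ _ D0 k _ _ _ D2 m cm P2 hP2 g2 cg2 r hr).
(* [τ1] classifies the name of the motive and [τ2] the recursive step. *)
- move=> Γ A B D f P g cf hP; have [M [c [ec' eP]]] := w_problem_chosenE hP; subst P => cg.
  have [_ _ cw _ _] := cf.
  have [τ1 [[τ1e τ1n] _]] := gn_univ R (canon_cart cw) (tover g).
  have [|f1 [cf1 of1 f1K]] := w_canon_factor (τ := τ1) Ssplit cf cm1.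
    by rewrite [tover (wm_a m1)]over_lift -wm_w_over -τ1e.
  have ew : gn_name R ∘ emap (wm_w f1) = tover g.
    apply: τ1n; first by rewrite -f1K [RHS]emap_comp.
    exact: etrans (disp_emap (wm_w f1)) (f_equal (fun s => s ∘ _) (etrans (wm_w_over f1) of1)).
  have [|μ1 [cμ1 oμ1 μ1K]] := canon_factor (h := g) (g := lift (gen k) (gn_name R))
    (σ := emap (wm_w f1)) Ssplit cg (canon_lift _ _); first by rewrite over_lift ew.
  have [h1 [ch1 oh1 _]] := w_prob_map Ssplit pi cf1 cμ1 oμ1.
  have pb1 := w_hyp_pullback cf1 ch1 oh1; rewrite of1 in pb1.
  have ez : disp M1 ∘ (emap μ1 ∘ c) = w_sup D1 ∘ disp H1 ∘ emap h1.
    by rewrite mcompA disp_emap oμ1 -mcompA ec' mcompA wm_sup -!mcompA disp_emap oh1.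
  have [τ2 [[τ2e τ2z] _]] := cle _ _ _ _ _ (pullback_sym pb1) (rpair ez) (disp_rpair _).
  have [|f2 [cf2 of2 f2K]] := w_canon_factor (τ := τ2) Ssplit cf1 cm2.
    by rewrite [tover (wm_a m2)]over_lift of1 τ2e.
  have [|μ [cμ oμ μK]] := canon_factor (h := μ1) (g := μ2) (σ := emap (wm_w f2)) Ssplit cμ1 cμ2.
    by rewrite oμ1 over_lift -f2K [LHS]emap_comp.
  have [h [ch oh mq]] := w_prob_map Ssplit pi cf2 cμ oμ.
  have hK : tcomp h2 h = h1.
    apply: canon_unique => //; first exact: canon_comp.
    by rewrite over_comp oh2 oh oh1 -f2K [RHS]emap_comp.
  have eh1 : e ∘ emap h = rpair ez.
    apply: τ2z; last by rewrite -emap_comp hK.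
    by have := w_hyp_pullback cf2 ch oh; rewrite of2 => -[].
  have [|q [cq _ _]] := mq _ ec' _ (disp_rpair ec); last by exists f2, q.
  apply: reix_hom_ext.
    rewrite [RHS]mcompA q_rpair -[RHS]mcompA eh1 q_rpair mcompA.
    by rewrite -[qmap _ M1]/(emap μ2) -emap_comp μK.
  rewrite [RHS]mcompA disp_rpair -!mcompA [LHS]mcompA disp_emap oμ -mcompA ec' [LHS]mcompA wm_sup.
  by rewrite -!mcompA disp_emap oh.
- move=> Γ A B D P f f' q q' cf cf' cq cq' oo.
  have em : w_comp m f = w_comp m f' by apply: w_canon_unique => //; apply: w_comp_canon.
  have [cμ _ _ ch] := cq; have [cμ' _ _ ch'] := cq'.
  have cg : canon (tcomp g2 (wp_mot q)) by apply: canon_comp.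
  have cg' : canon (tcomp g2 (wp_mot q')) by apply: canon_comp.
  have eg := inj_pair2 _ _ _ _ _ (named_unique cg cg').
  have name (f0 : w_map D D2) (q0 : wp_map f0 P P2) (t : hom (ext (w_ty D)) (ext (w_ty D1))) :
      qmap u1 (w_ty D0) ∘ t = emap (wm_w (w_comp m f0)) ->
      disp (w_ty D1) ∘ t = u2 ∘ tover (wm_a f0) ∘ disp (w_ty D) ->
      gn_name R ∘ t = tover (tcomp g2 (wp_mot q0)).
    move=> t1 t2; rewrite !over_comp over_lift over_lift wp_mot_over -mcompA; congr (_ ∘ _).
    apply: reix_hom_ext; first by rewrite t1 /= !emap_comp -!mcompA.
    have d2 : disp (w_ty D1) ∘ emap (wm_w m2) = u2 ∘ disp (w_ty D2) by rewrite disp_emap over_lift.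
    have d0 : disp (w_ty D2) ∘ emap (wm_w f0) = tover (wm_a f0) ∘ disp (w_ty D).
      by rewrite disp_emap wm_w_over.
    by rewrite [LHS]t2 [RHS]mcompA d2 -!mcompA d0.
  have [_ _ cw _ _] := w_comp_canon Ssplit cm cf.
  have [t [_ ut]] := gn_univ R (canon_cart cw) (tover (tcomp g2 (wp_mot q))).
  have o0 (f0 : w_map D D2) : u1 ∘ (u2 ∘ tover (wm_a f0)) = tover (wm_w (w_comp m f0)).
    by rewrite wm_w_over /= !over_comp !over_lift mcompA.
  (* The common name of the motive forces agreement in the first stage; the recursive step then
     forces it in the second. *)
  have oτ : u2 ∘ tover (wm_a f) = u2 ∘ tover (wm_a f').
    transitivity t; first by symmetry; apply: ut; split; [exact: o0|exact: name].
    by apply: ut; split; [rewrite em; exact: o0|rewrite em eg; exact: name].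
  have em1 : w_comp m2 f = w_comp m2 f'.
    by apply: w_canon_unique => //; [apply: w_comp_canon|apply: w_comp_canon|
      rewrite /= !over_comp !over_lift].
  have omot (f0 : w_map D D2) (q0 : wp_map f0 P P2) :
      tover (tcomp μ2 (wp_mot q0)) = emap (wm_w (w_comp m2 f0)).
    by rewrite over_comp over_lift (wp_mot_over q0) -emap_comp.
  have eμ : tcomp μ2 (wp_mot q) = tcomp μ2 (wp_mot q').
    apply: canon_unique; [exact: canon_comp|exact: canon_comp|].
    by rewrite !omot em1.
  have ohyp (f0 : w_map D D2) (q0 : wp_map f0 P P2) :
      tover (tcomp h2 (wp_hyp q0)) = emap (wm_pi (w_comp m2 f0)).
    by rewrite over_comp oh2 (wp_hyp_over q0) (wp_dom_over q0) -emap_comp.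
  have eh2 : tcomp h2 (wp_hyp q) = tcomp h2 (wp_hyp q').
    apply: canon_unique; [exact: canon_comp|exact: canon_comp|].
    by rewrite !ohyp em1.
  have cf1 := w_comp_canon Ssplit cm2 cf.
  have ch1 : canon (tcomp h2 (wp_hyp q)) by exact: canon_comp.
  have pb1 := w_hyp_pullback cf1 ch1 (ohyp f q).
  have ez : disp Z ∘ (e ∘ emap (wp_hyp q)) = emap (tcomp h2 (wp_hyp q)).
    by rewrite mcompA eh emap_comp.
  have [t0 [_ ut0]] := cle _ _ _ _ _ (pullback_sym pb1) _ ez.
  have uq (f0 : w_map D D2) (q0 : wp_map f0 P P2) : w_canon f0 -> wp_canon q0 ->
      u2 ∘ tover (wm_a f0) = tover (wm_a (w_comp m2 f)) ->
      tcomp h2 (wp_hyp q0) = tcomp h2 (wp_hyp q) ->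
      tcomp μ2 (wp_mot q0) = tcomp μ2 (wp_mot q) -> t0 = tover (wm_a f0).
    move=> cf0 [cμ0 _ _ ch0] o1 o2 o3; apply: ut0; split=> // t' t1 t2.
    have -> : t' = emap (wp_hyp q0).
      apply: (pullback_ext pb2); first by rewrite t2 -o2 emap_comp.
      have oh0 : tover (wp_hyp q0) = emap (wm_pi f0) by rewrite wp_hyp_over wp_dom_over.
      by rewrite t1; have [] := w_hyp_pullback cf0 ch0 oh0.
    have eP (f3 : w_map D D2) (q3 : wp_map f3 P P2) :
        qmap (w_sup D1 ∘ disp H1) M1 ∘ (e ∘ emap (wp_hyp q3))
        = emap (tcomp μ2 (wp_mot q3)) ∘ w_rec P.
      rewrite emap_comp -[RHS]mcompA (wp_rec q3) [RHS]mcompA.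
      by rewrite -[emap μ2]/(qmap (emap (wm_w m2)) M1) q_rpair mcompA.
    apply: reix_hom_ext; first by rewrite !eP o3.
    by rewrite !mcompA eh -!emap_comp o2.
  transitivity t0; first by symmetry; apply: (uq f q) => //; rewrite /= over_comp over_lift.
  by apply: (uq f' q') => //; rewrite em1 /= over_comp over_lift.
Qed.

End GenericProblem.

(** * Strict W-types in a split comprehension category *)

Section StrictWTheorem.
Context {S : compcat} (Ssplit : is_split S) (LF : condition_LF S) (U : local_universes S).
Context (F : family_universes S) {Cl : pi_class S}.
Context (pi : strictly_stable (pi_former S)).
Context (pi_Cl : forall (Γ : S) (A : ty S Γ) (B : ty S (ext A)), Cl (pi_form pi B)).
Context (hW : forall (Γ : S) (A : ty S Γ) (B : ty S (ext A)),
  exists W : ty S Γ, forall R : w_arity B W, Cl (w_fun R) ->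
  exists (sup : hom (ext (pi_ty (w_fun R))) (ext W))
    (e : disp W ∘ sup = disp A ∘ disp (pi_ty (w_fun R))), w_robust Cl (WData e)).

Lemma w_chosen_robust (Γ : S) (A : ty S Γ) (B : ty S (ext A)) :
  exists D : w_data B, w_data_chosen pi D /\ w_robust Cl D.
Proof.
have [W hR] := hW B.
have [sup [e rob]] := hR (WArity (lift_cartesian W (disp A ∘ disp B)) (over_lift _ _)
  (pi_form pi _)) (pi_Cl _).
by exists (WData e).
Qed.

Lemma w_family_unique (Γ : S) (A : ty S Γ) (B : ty S (ext A)) (D D' : w_data B) (k k' : fcode F)
    (D0 : forall k, w_data (fgenB (f := F) k)) (m : w_map D (D0 k)) (m' : w_map D' (D0 k')) :
  w_canon m -> w_canon m' ->
  existT (fun k => hom Γ (funiv k)) k (tover (wm_a m)) = existT _ k' (tover (wm_a m')).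
Proof.
move=> [ca cb _ _ _] [ca' cb' _ _ _].
exact: family_unique ca cb erefl (wm_b_over m) ca' cb' erefl (wm_b_over m').
Qed.

Lemma strict_W : inhabited (strictly_stable_W pi).
Proof.
have /dep_choice [D0 hD0] := fun k => w_chosen_robust (fgenB (f := F) k).
have R k (c : code U) : generic_rec pi (D0 k) c.
  exact: (epsilon (generic_rec_exists Ssplit LF pi_Cl c (proj2 (hD0 k))) (fun=> True)).
pose FF Γ (A : ty S Γ) (B : ty S (ext A)) (D : w_data B) :=
  w_data_chosen pi D /\ exists k (m : w_map D (D0 k)), w_canon m.
pose EE Γ (A : ty S Γ) (B : ty S (ext A)) (D : w_data B) (P : w_problem D)
    (s : section (w_mot P)) :=
  exists k c (f : w_map D (gr_D (R k c))) (q : wp_map f P (gr_P (R k c))),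
  [/\ w_canon f, wp_canon q & emap (wp_mot q) ∘ sval s = sval (gr_rec (R k c)) ∘ emap (wm_w f)].
have FF1 Γ (A : ty S Γ) (B : ty S (ext A)) : exists! D : w_data B, FF Γ A B D.
  have [[k τ] [[a [b /= [ca cb oa ob]]] _]] := fnamed F B.
  have [D [m [hD cm _]]] := w_chosen_exists Ssplit (proj1 (hD0 k)) ca cb ob.
  exists D; split; first by split=> //; exists k, m.
  move=> D' [hD' [k' [m' cm']]]; have e := w_family_unique cm cm'.
  have ek : k = k' := f_equal (@projT1 _ _) e; subst k'.
  exact: (w_chosen_ext hD hD' cm cm' (inj_pair2 _ _ _ _ _ e)).
have FFreix Γ Δ (σ : hom Δ Γ) (A : ty S Γ) (B : ty S (ext A)) (D : w_data B) :
    FF Γ A B D -> FF Δ A.[σ] B.[qmap σ A] (w_data_reix D σ).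
  move=> [hD [k [m cm]]]; split; first exact: w_chosen_reix.
  exists k, (w_comp m (w_reix_map σ D)); apply: w_comp_canon => //; exact: w_reix_canon.
have EE1 Γ (A : ty S Γ) (B : ty S (ext A)) (D : w_data B) (P : w_problem D) :
    FF Γ A B D -> w_problem_chosen pi P -> exists! s, EE Γ A B D P s.
  move=> [hD [k [m cm]]] hP; have [[c n] [[g [/= cg og]] _]] := named U (w_mot P).
  have [f [q [cf cq]]] := gr_exists (R k c) cm hP cg.
  have [cμ _ _ _] := cq.
  have es : disp (w_mot (gr_P (R k c))) ∘ (sval (gr_rec (R k c)) ∘ emap (wm_w f))
      = tover (wp_mot q) ∘ idm _.
    by rewrite mcompA section_id comp_idl comp_idr wp_mot_over.
  exists (mk_section (disp_cpair (canon_cart cμ) es)); split.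
    by exists k, c, f, q; split=> //; exact: emap_cpair.
  move=> s' [k' [c' [f' [q' [cf' cq' es']]]]].
  (* The input family determines the index [k], the motive its code [c], and [gr_unique] then the
     classifying map, so any two specified solutions restrict the same generic one. *)
  have ek := w_family_unique (w_comp_canon Ssplit (gr_canon (R k c)) cf)
    (w_comp_canon Ssplit (gr_canon (R k' c')) cf').
  have ekk : k = k' := f_equal (@projT1 _ _) ek; subst k'.
  have [cμ' _ _ _] := cq'.
  have ec := named_unique (canon_comp Ssplit (gr_mot_canon (R k c)) cμ)
    (canon_comp Ssplit (gr_mot_canon (R k c')) cμ').
  have ecc : c = c' := f_equal (@projT1 _ _) ec; subst c'.
  have ea := gr_unique cf cf' cq cq' (inj_pair2 _ _ _ _ _ ek).
  have ef : f = f' by exact: w_canon_unique.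
  case: f' / ef q' cf' cq' es' cμ' {ek ec ea} => q' _ cq' es' _.
  have [eq _] := wp_canon_unique cq cq'.
  apply: sig_ext; apply: (cart_hom_ext (canon_cart cμ)).
    by rewrite [LHS]emap_cpair eq es'.
  by rewrite !section_id.
have EEsolves Γ (A : ty S Γ) (B : ty S (ext A)) (D : w_data B) (P : w_problem D) s
    (hP : w_problem_chosen pi P) : EE Γ A B D P s -> w_solves (pi_lam (wpc_hyp hP)) s.
  move=> [k [c [f [q [cf cq es]]]]]; have [cμ _ _ _] := cq.
  exact: (wp_solves_pull (pi_lam_compat _ (wpc_hyp (gr_chosen (R k c))) cq) es (canon_cart cμ)
    (gr_solves (R k c))).
have EEreix Γ Δ (σ : hom Δ Γ) (A : ty S Γ) (B : ty S (ext A)) (D : w_data B) (P : w_problem D) s :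
    EE Γ A B D P s -> EE Δ A.[σ] B.[qmap σ A] (w_data_reix D σ) (w_problem_reix P σ)
      (reix_section s (qmap σ (w_ty D))).
  move=> [k [c [f [q [cf cq es]]]]].
  exists k, c, (w_comp f (w_reix_map σ D)), (wp_comp q (wp_reix_map σ P)).
  split; first by apply: w_comp_canon => //; exact: w_reix_canon.
    by case: cq => c1 c2 c3 c4; split; apply: canon_comp => //; exact: canon_lift.
  have eq := q_reix_section s (qmap σ (w_ty D)).
  by rewrite /= !emap_comp -mcompA eq !mcompA es.
pose form Γ (A : ty S Γ) (B : ty S (ext A)) := sval (unique_choice (FF1 Γ A B)).
have formF Γ (A : ty S Γ) (B : ty S (ext A)) : FF Γ A B (form Γ A B).
  exact: (proj2_sig (unique_choice (FF1 Γ A B))).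
have F_eq Γ (A : ty S Γ) (B : ty S (ext A)) (D : w_data B) : D = form Γ A B -> FF Γ A B D.
  by move=> ->.
pose elim Γ (A : ty S Γ) (B : ty S (ext A)) (D : w_data B) e P hP :=
  sval (unique_choice (EE1 Γ A B D P (F_eq Γ A B D e) hP)).
have elimE Γ (A : ty S Γ) (B : ty S (ext A)) (D : w_data B) e P hP :
    EE Γ A B D P (elim Γ A B D e P hP).
  exact: (proj2_sig (unique_choice (EE1 Γ A B D P (F_eq Γ A B D e) hP))).
exists; apply: (@StrictlyStableW S pi form _ _ elim).
- by move=> Γ A B; case: (formF Γ A B).
- move=> Γ Δ σ A B; have [D [_ u]] := FF1 _ _ B.[qmap σ A].
  by rewrite -(u _ (formF _ _ _)) -(u _ (FFreix _ _ σ _ _ _ (formF _ _ B))).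
- by move=> Γ A B D e P h; apply: EEsolves; apply: elimE.
- move=> Γ Δ σ A B D e e' P h h'.
  have [s [_ u]] := EE1 _ _ _ _ (w_problem_reix P σ) (F_eq _ _ _ _ e') h'.
  by rewrite -(u _ (elimE _ _ _ _ e' _ h')) -(u _ (EEreix _ _ σ _ _ _ _ _ (elimE _ _ _ _ e _ h))).
Qed.

End StrictWTheorem.

Lemma W_models (C : compcat) (C_full : is_full C) (LF : condition_LF C) (Cl : pi_class C) :
  stable_pi_class Cl -> weakly_stable_W Cl -> models_with_W (split_replacement C).
Proof.
move=> hCl hW; split.
- exact: replacement_full.
- exact: replacement_split.
- by case: LF => -[].
- have LF' := replacement_LF LF; have s' := @replacement_split C.
  have U := replacement_universes C.
  have [F] := family_universes_exist s' LF' U.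
  have [pi hpi] := replacement_pi hCl LF; exists pi.
  exact: (strict_W s' LF' U F hpi (replacement_W hCl hW)).
Qed.

Theorem theorem3p4p1 (C : compcat) (C_full : is_full C) (C_LF : condition_LF C) :
  (weakly_stable (sum_former C) ->
     models_with (sum_former (split_replacement C))) /\
  (weakly_stable (pi_former C) ->
     models_with (pi_former (split_replacement C))) /\
  (weakly_stable (id_former C) ->
     models_with (id_former (split_replacement C))) /\
  (weakly_stable (sig_former C) ->
     models_with (sig_former (split_replacement C))) /\
  (weakly_stable (zero_former C) ->
     models_with (zero_former (split_replacement C))) /\
  (weakly_stable (unit_former C) ->
     models_with (unit_former (split_replacement C))) /\
  (forall Cl : pi_class C, stable_pi_class Cl -> weakly_stable_W Cl ->
     models_with_W (split_replacement C)).
Proof.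
split; first exact: sum_models.
split; first exact: pi_models.
split; first exact: id_models.
split; first exact: sig_models.
split; first exact: zero_models.
split; first exact: unit_models.
by move=> Cl; apply: W_models.
Qed.
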